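(* Suppose that $Z$ is a bounded random variable. Let $0\le t_0<t_1<\infty$ and suppose that $U$ is twice continuously differentiable on $[t_0,t_1]$ and that $\inf_{t_0\le t\le t_1}[-U''(t)]>0$. Then, as $n\to\infty$, $$\sup_{t_0\le t\le t_1}\bigl|\tilde U_n(t)-U_n^{\#}(t)\bigr| = O_p[\varepsilon_n^2],\qquad \varepsilon_n=\sqrt{\frac{\log n}{n}} .$$
   Context: Setting. $\mathbf X=(X_1,X_2,X_3)$ is a random vector and $Z$ a nonnegative random variable such that the joint law of $(\mathbf X,Z)$ is invariant under orthogonal transformations of $\mathbf X$ and has a density with respect to $\lambda^3\times\nu$, where $\lambda^3$ is Lebesgue measure on $\mathbb R^3$ and $\nu$ is a $\sigma$-finite Borel measure on $[0,\infty)$; thus $P[\mathbf X\in d\mathbf x,\,Z\in dz]=\rho(\|\mathbf x\|,z)\,d\mathbf x\,\nu\{dz\}$ for a nonnegative measurable function $\rho$ on $[0,\infty)^2$. Put $Y=X_1^2+X_2^2$. The pair $(Y,Z)$ has density, with respect to $\lambda\times\nu$ ($\lambda$ = Lebesgue measure on $[0,\infty)$), $$g(y,z)=\pi\int_y^\infty\frac{\rho(\sqrt x,z)}{\sqrt{x-y}}\,dx .$$ For $x,y\ge 0$ let $$\psi(y)=\int_0^\infty z\,g(y,z)\,\nu\{dz\},\qquad \Psi(y)=\int_y^\infty\frac{\psi(t)}{\sqrt{t-y}}\,dt,\qquad U(x)=\int_0^x\Psi(t)\,dt .$$ $U'$ and $U''$ are derivatives of the function $U$ on $[0,\infty)$ (one-sided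 at $0$). Sample and estimators. $(X_{i,1},X_{i,2},Z_i)$, $i=1,2,\dots$, are i.i.d. copies of $(X_1,X_2,Z)$ and $Y_i=X_{i,1}^2+X_{i,2}^2$. With $a_+=\max(a,0)$, for $x\ge0$, $$U_n^{\#}(x)=\frac1n\sum_{i=1}^n 2Z_i\bigl(\sqrt{Y_i}-\sqrt{(Y_i-x)_+}\bigr),$$ and $\tilde U_n$ is the least concave majorant of $U_n^{\#}$ on $[0,\infty)$. *)

(* Defs.v *)
From HB Require Import structures.
From mathcomp Require Import all_boot all_order all_algebra.
From mathcomp Require Import all_classical all_reals all_analysis.

Set Implicit Arguments.
Unset Strict Implicit.
Unset Printing Implicit Defensive.

Import Order.TTheory GRing.Theory Num.Theory.
Import numFieldNormedType.Exports.

Local Open Scope classical_set_scope.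
Local Open Scope ring_scope.

Notation leb := (@lebesgue_measure _).

Section law.
Context {R : realType}.

(* Points of R^3 are nested pairs [(x1, x2, x3)], for which the library has
   the product sigma-algebra and the product measure. *)
Definition norm3 (x : R * R * R) : R :=
  Num.sqrt (x.1.1 ^+ 2 + x.1.2 ^+ 2 + x.2 ^+ 2).

Definition mulmx3 (Q : 'M[R]_3) (x : R * R * R) : R * R * R :=
  let v := Q *m \col_i nth 0 [:: x.1.1; x.1.2; x.2] i in
  (v 0 0, v 1 0, v 2 0).

Definition orthogonal_mx (Q : 'M[R]_3) : Prop := Q *m Q^T = 1%:M.

Definition orthogonally_invariant d (T : measurableType d)
    (P : probability T R) (X : T -> R * R * R) (Z : T -> R) : Prop :=
  forall (Q : 'M[R]_3) (A : set (R * R * R * R)),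
    orthogonal_mx Q -> measurable A ->
    P [set w | A (mulmx3 Q (X w), Z w)] = P [set w | A (X w, Z w)].

(* [rho] only matters on [0, oo)^2. *)
Definition has_radial_density d (T : measurableType d)
    (P : probability T R) (X : T -> R * R * R) (Z : T -> R)
    (nu : {sigma_finite_measure set R -> \bar R}) (rho : R * R -> R) : Prop :=
  forall A : set (R * R * R * R), measurable A ->
    P [set w | A (X w, Z w)] =
    (\int[((leb \x leb) \x leb) \x nu]_(p in A `&` (setT `*` `[0%R, +oo[))
       (rho (norm3 p.1, p.2))%:E)%E.

End law.

Section functionals.
Context {R : realType}.
Variables (nu : {sigma_finite_measure set R -> \bar R}) (rho : R * R -> R).
Local Open Scope ereal_scope.

(* Integrals of nonnegative functions, hence extended-real valued. *)
Definition g_fun (y z : R) : \bar R :=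
  pi%:E * \int[leb]_(x in `]y, +oo[)
            (rho (Num.sqrt x, z) / Num.sqrt (x - y))%:E.

Definition psi_fun (y : R) : \bar R :=
  \int[nu]_(z in `[0%R, +oo[) (z%:E * g_fun y z).

Definition Psi_fun (y : R) : \bar R :=
  \int[leb]_(t in `]y, +oo[) (psi_fun t * ((Num.sqrt (t - y))^-1)%:E).

(* The integral is finite when [Z] is integrable: it is the expectation of
   2 Z (sqrt Y - sqrt (Y - x)_+), which is at most 2 Z sqrt x. *)
Definition U_fun (x : R) : R := fine (\int[leb]_(t in `[0%R, x]) Psi_fun t).

End functionals.

Section calculus.
Context {R : realType}.
Implicit Types (f h : R -> R) (t x : R).

(* Only increments inside [0, oo) are considered: two-sided derivative at
   [x > 0], right derivative at [x = 0]. *)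
Definition derivable_ge0 f x : Prop :=
  cvg ((f y - f x) / (y - x) @[y --> within `[0, +oo[ x^']).

Definition derive_ge0 f x : R :=
  lim ((f y - f x) / (y - x) @[y --> within `[0, +oo[ x^']).

(* The derivatives at [t0] and [t1] are those of the function on [0, oo), not
   of its restriction to [t0, t1]. *)
Definition twice_continuously_differentiable f t0 t1 : Prop :=
  (forall t, t0 <= t <= t1 ->
     (\forall s \near within `[0, +oo[ (nbhs t), derivable_ge0 f s) /\
     derivable_ge0 (derive_ge0 f) t) /\
  {within `[t0, t1], continuous (derive_ge0 (derive_ge0 f))}.

Definition concave_majorant_ge0 f h : Prop :=
  convex_function (`[0, +oo[ : set R^o) (fun x : R^o => - h x : R^o) /\
  (forall x, 0 <= x -> f x <= h x).

Definition least_concave_majorant_ge0 f h : Prop :=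
  concave_majorant_ge0 f h /\
  (forall k, concave_majorant_ge0 f k -> forall x, 0 <= x -> h x <= k x).

End calculus.

Section sampling.
Context {R : realType} d {T : measurableType d} (P : probability T R).

Definition mutually_independent d' (T' : measurableType d')
    (S : nat -> {RV P >-> T'}) : Prop :=
  forall (J : seq nat) (A : nat -> set T'),
    uniq J -> (forall j, measurable (A j)) ->
    P (\bigcap_(j in [set` J]) (S j @^-1` A j)) =
    (\prod_(j <- J) P (S j @^-1` A j))%E.

(* [S i] is the observation [(X_{i+1,1}, X_{i+1,2}, Z_{i+1})]. *)
Definition U_sharp (S : nat -> {RV P >-> (R * R * R)%type}) (n : nat) (w : T) (x : R) : R :=
  n%:R^-1 * \sum_(i < n)
    let Y := (S i w).1.1 ^+ 2 + (S i w).1.2 ^+ 2 in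
    2 * (S i w).2 * (Num.sqrt Y - Num.sqrt (Num.max (Y - x) 0)).

(* [A n = O_p(a n)].  Since [P] is only meaningful on measurable sets, the
   bound on the probability of the event [|A n| > M a n] is expressed through
   a measurable set containing it; this is the usual definition when the event
   is measurable. *)
Definition bigO_p (A : nat -> T -> \bar R) (a : nat -> R) : Prop :=
  forall e : R, 0 < e -> exists M : R, \forall n \near \oo,
    exists B : set T, [/\ measurable B,
      [set w | ((M * a n)%:E < `|A n w|)%E] `<=` B & (P B <= e%:E)%E].

End sampling.

Definition eps {R : realType} (n : nat) : R := Num.sqrt (ln n%:R / n%:R).

(* Main.v *)
Require Import Defs.
From HB Require Import structures.
From mathcomp Require Import all_boot all_order all_algebra.
From mathcomp Require Import all_classical all_reals all_analysis.
From mathcomp Require Import measurable_realfun.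
From mathcomp Require Import ring lra.

(** Write f_x = 2 Z (sqrt Y - sqrt (Y - x)_+) and let m(x) be the integral of
    z rho(sqrt x, z) over nu(dz).  The estimator U_n^# (x) is the empirical mean
    of f_x.  Carrying out the two Abel transforms in the definition of Psi, whose
    composition is governed by the Beta integral
    int_t^x ds / (sqrt (s - t) sqrt (x - s)) = pi, gives

      U(x) = E f_x    and    Psi(t) = pi^2 int_t^oo m        ([Psi_funE],
                                                   [integral_Psi_score]).

    So Psi is nonincreasing, U is concave, U' = Psi wherever U' exists, and
    formally -U'' = pi^2 m.  The hypotheses on U'' on [t0, t1] therefore say two things
    ([population_bounds]): U lies quadratically below its tangents,
    U(s) <= U(t) + U'(t) (s - t) - 2 kappa (s - t)^2, and the mass of m near t
    is proportional to length, whence E[Z; |Y - t| <= r] = O(r).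

    A least concave majorant lies below every affine majorant.  Hence it is
    enough to find, for each t in a grid of mesh n^-2, a slope beta such that
    U_n^# (s) <= U_n^# (t) + beta (s - t) + K eps_n^2 for all s in the grid;
    monotonicity and Hoelder continuity of U_n^# fill the gaps of the grid, and
    far to the right the bound U_n^# (s) <= 2 M sqrt s suffices
    ([majorant_from_grid]).

    The slope beta = U'(t) would lose a logarithm: the derivative
    Z / sqrt (Y - t)_+ of x |-> f_x at t has infinite variance, and Var (f_s - f_t) is of
    order h^2 log (1 / h) for h = s - t.  The remedy is to let the slope follow
    the sample.  With phi_t = Z 1(Y - t > eps_n) / sqrt (Y - t), the
    slope is beta = U'(t) + (P_n - P) phi_t, where P_n is the empirical measure;
    what is left of the fluctuation of U_n^# (s) - U_n^# (t) is (P_n - P) W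
    with

      W = f_s - f_t - (s - t) phi_t,
      |W| = O(H / sqrt eps_n),  E W^2 = O(H^3 / eps_n),  H = max(|h|, eps_n)

    ([remainder_middle], [remainder_moment]).  The exponential inequality
    [chernoff_upper] with parameter proportional to eps_n / H then gives
    (P_n - P) W <= kappa h^2 + K eps_n^2 outside an event of probability at most
    exp(-5 n eps_n^2) = n^-5 ([remainder_deviation]).  The term kappa h^2 is
    absorbed by the strict concavity of U, and the O(n^4) pairs of grid points
    cost a total probability O(1 / n) ([good_event]).  The fluctuation
    (P_n - P) phi_t is small outside an event of equally small probability, so that
    the random slope stays between two positive constants ([trunc_isqrt_deviation]). *)

Set Implicit Arguments.
Unset Strict Implicit.
Unset Printing Implicit Defensive.

Import Order.TTheory GRing.Theory Num.Theory.
Import numFieldNormedType.Exports.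

Local Open Scope classical_set_scope.
Local Open Scope ring_scope.

(** * Transfer of weighted integrals *)

Section transfer.
Import HBNNSimple.
Context d d' (T : measurableType d) (T' : measurableType d') (R : realType).
Variables (mu : {measure set T -> \bar R}) (mu' : {measure set T' -> \bar R}).
Variables (phi : T -> T') (w : T -> R) (v : T' -> R).
Hypotheses (mphi : measurable_fun setT phi) (mw : measurable_fun setT w)
  (mv : measurable_fun setT v) (w0 : forall x, 0 <= w x)
  (v0 : forall y, 0 <= v y).
Local Open Scope ereal_scope.

(** Two weighted measures that agree on sets have the same integrals: nonnegative
    functions are increasing limits of simple ones.  This covers changes of
    variables, image laws and densities at once. *)
Lemma transfer_integral (g : T' -> \bar R) :
  (forall A, measurable A ->
    \int[mu]_x (w x * \1_A (phi x))%:E = \int[mu']_y (v y * \1_A y)%:E) ->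
  measurable_fun setT g -> (forall y, 0 <= g y) ->
  \int[mu]_x ((w x)%:E * g (phi x)) = \int[mu']_y ((v y)%:E * g y).
Proof.
move=> wv mg g0.
pose h := nnsfun_approx measurableT mg.
have mh n : measurable_fun setT (h n) by [].
have h0 n y : (0 <= h n y)%R by [].
have hnd y : nondecreasing_seq (fun n => (h n y)%:E).
  by move=> m n mn; rewrite lee_fin; exact/lefP/nd_nnsfun_approx.
have hg y : EFin \o h ^~ y @ \oo --> g y by apply: cvg_nnsfun_approx.
have E1 : \int[mu]_x ((w x)%:E * g (phi x)) =
    limn (fun n => \int[mu]_x ((w x * h n (phi x))%:E)).
  rewrite -monotone_convergence//.
  - apply: eq_integral => x _; apply/esym/cvg_lim => //.
    under eq_fun do rewrite EFinM.
    by apply: cvgeZl => //; exact: hg.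
  - move=> n; apply/measurable_EFinP; apply: measurable_funM => //.
    exact: measurableT_comp.
  - by move=> n x _; rewrite lee_fin mulr_ge0.
  - by move=> x _ m n mn; rewrite lee_fin ler_wpM2l// -lee_fin; exact: hnd.
have E2 : \int[mu']_y ((v y)%:E * g y) =
    limn (fun n => \int[mu']_y ((v y * h n y)%:E)).
  rewrite -monotone_convergence//.
  - apply: eq_integral => x _; apply/esym/cvg_lim => //.
    under eq_fun do rewrite EFinM.
    by apply: cvgeZl => //; exact: hg.
  - by move=> n; apply/measurable_EFinP; apply: measurable_funM.
  - by move=> n x _; rewrite lee_fin mulr_ge0.
  - by move=> x _ m n mn; rewrite lee_fin ler_wpM2l// -lee_fin; exact: hnd.
rewrite E1 E2; congr (limn _); apply/funext => n.
have mf k : measurable (h n @^-1` [set k]) by [].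
have m1 (A : set T') : measurable A -> measurable_fun setT (fun x => \1_A (phi x) : R).
  by move=> mA; exact: (measurableT_comp (measurable_indic mA) mphi).
transitivity (\sum_(k \in range (h n)) (k%:E *
    \int[mu]_x (w x * \1_(h n @^-1` [set k]) (phi x))%:E)).
  transitivity (\int[mu]_x \sum_(k \in range (h n))
      (k * (w x * \1_(h n @^-1` [set k]) (phi x)))%:E).
    apply: eq_integral => x _; rewrite fsumEFin// fimfunE; congr EFin.
    rewrite mulrC mulr_fsuml; apply: eq_fsbigr => k _.
    by rewrite mulrAC -mulrA.
  rewrite ge0_integral_fsum//; last 2 first.
  - move=> k; apply/measurable_EFinP; do 2 apply: measurable_funM => //.
    exact: m1.
  - move=> k x _; rewrite lee_fin mulrCA mulr_ge0// -lee_fin.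
    exact: nnfun_muleindic_ge0.
  apply: eq_fsbigr => k /[!inE] -[y _ <-].
  under eq_integral do rewrite EFinM.
  rewrite ge0_integralZl_EFin//.
  - by move=> x _; rewrite lee_fin mulr_ge0.
  - by apply/measurable_EFinP; apply: measurable_funM => //; exact: m1.
transitivity (\sum_(k \in range (h n)) (k%:E *
    \int[mu']_x (v x * \1_(h n @^-1` [set k]) x)%:E)).
  by apply: eq_fsbigr => k _; rewrite wv.
transitivity (\int[mu']_x \sum_(k \in range (h n))
      (k * (v x * \1_(h n @^-1` [set k]) x))%:E).
  rewrite ge0_integral_fsum//; last 2 first.
  - move=> k; apply/measurable_EFinP; do 2 apply: measurable_funM => //.
  - move=> k x _; rewrite lee_fin mulrCA mulr_ge0// -lee_fin.
    exact: nnfun_muleindic_ge0.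
  apply: eq_fsbigr => k /[!inE] -[y _ <-].
  under [in RHS]eq_integral do rewrite EFinM.
  rewrite ge0_integralZl_EFin//.
  - by move=> x _; rewrite lee_fin mulr_ge0.
  - by apply/measurable_EFinP; apply: measurable_funM.
apply: eq_integral => x _; rewrite fsumEFin// fimfunE; congr EFin.
rewrite [RHS]mulrC mulr_fsuml; apply: eq_fsbigr => k _.
by rewrite mulrAC -mulrA.
Qed.

End transfer.

Section improper_FTC.
Context {R : realType}.
Implicit Types (f F : R -> R) (a b : R).

(** The integrand may blow up at both ends, as inverse square roots do: the
    compact fundamental theorem is applied on [a + e_n, b - e_n] with e_n
    decreasing to 0, and monotone convergence concludes. *)
Lemma ge0_integral_oo_FTC f F a b (la lb : R) : a < b ->
  (forall x, x \in `]a, b[ -> 0 <= f x) ->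
  (forall x, x \in `]a, b[ -> {for x, continuous f}) ->
  (forall x, x \in `]a, b[ -> is_derive x 1 F (f x)) ->
  F x @[x --> a^'+] --> la -> F x @[x --> b^'-] --> lb ->
  (\int[leb]_(x in `]a, b[) (f x)%:E = (lb - la)%:E)%E.
Proof.
move=> ab f0 cf dF Fa Fb.
(* the factor 1/3 keeps the interval [a + e n, b - e n] nondegenerate *)
pose e n : R := (b - a) / 3 / n.+1%:R.
have e0 n : 0 < e n by rewrite !divr_gt0// subr_gt0.
have e3 n : e n <= (b - a) / 3.
  by rewrite ler_piMr ?divr_ge0 ?subr_ge0 ?(ltW ab)// invf_le1// ler1n.
have ee m n : (m <= n)%N -> e n <= e m.
  move=> mn; rewrite ler_wpM2l ?divr_ge0 ?subr_ge0 ?(ltW ab)//.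
  by rewrite lef_pV2 ?posrE// ler_nat.
have ecvg : e @ \oo --> 0.
  by rewrite -(mulr0 ((b - a) / 3)); apply: cvgMr; exact: cvg_harmonic.
pose I n : set R := `[a + e n, b - e n]%classic.
have Iab n x : I n x -> x \in `]a, b[.
  by rewrite /I/= !in_itv/= => /andP[]; have := e0 n; lra.
have UI : \bigcup_n I n = `]a, b[%classic.
  apply/seteqP; split => [x [n _ /Iab]//|x /=].
  rewrite in_itv/= => /andP[ax xb].
  have : 0 < Num.min (x - a) (b - x) by rewrite lt_min !subr_gt0 ax xb.
  move/cvgrPdist_lt : ecvg => /[apply] -[N _ /(_ N (leqnn N))].
  rewrite sub0r normrN ger0_norm ?(ltW (e0 N))// lt_min => /andP[h1 h2].
  by exists N => //; rewrite /I/= in_itv/=; move: h1 h2; lra.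
rewrite -UI.
have mf : measurable_fun `]a, b[ f.
  by apply: open_continuous_measurable_fun => // x /set_mem; exact: cf.
have : (\int[leb]_(x in I n) (f x)%:E @[n --> \oo] -->
    \int[leb]_(x in \bigcup_n I n) (f x)%:E)%E.
  apply: ge0_nondecreasing_set_cvg_integral => //.
  - move=> m n mn; rewrite subsetEset => x; rewrite /I/= !in_itv/=.
    by move=> /andP[h1 h2]; have h3 := ee _ _ mn; apply/andP; split; lra.
  - by move=> n; exact: measurable_itv.
  - move=> n; apply/measurable_EFinP.
    by apply: (measurable_funS _ _ mf) => //; exact: Iab.
  - by move=> n x /Iab xab; rewrite lee_fin f0.
move/cvg_unique; apply; first exact: ereal_hausdorff.
have -> : (fun n => \int[leb]_(x in I n) (f x)%:E)%E =
    (fun n => (F (b - e n) - F (a + e n))%:E).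
  apply/funext => n; rewrite /I.
  have ae : a + e n < b - e n.
    have := e3 n; have : 0 < b - a by rewrite subr_gt0.
    lra.
  have dFI x : x \in `]a + e n, b - e n[ -> is_derive x 1 F (f x).
    by move=> xI; apply: dF; apply: (Iab n); exact: subset_itv_oo_cc.
  have cF x : x \in `[a + e n, b - e n] -> {for x, continuous F}.
    move=> xI; apply: differentiable_continuous; apply/derivable1_diffP.
    by have [] := dF x (Iab n x xI).
  rewrite (@continuous_FTC2 _ f F)//.
  - apply/continuous_in_subspaceT => x /set_mem xI; apply: cf; exact: (Iab n).
  - split.
    + by move=> x xI; have [] := dFI x xI.
    + apply: cvg_at_right_filter; apply: cF.
      by rewrite in_itv/= lexx ltW.
    + apply: cvg_at_left_filter; apply: cF.
      by rewrite in_itv/= lexx ltW.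
  - by move=> x xI; rewrite derive1E; apply: derive_val; exact: dFI.
apply: cvg_EFin; first exact: nearW.
apply: cvgB.
- move/cvg_at_leftP : Fb; apply; split.
    by move=> n; rewrite ltrBlDr ltrDl.
  by rewrite -[X in _ --> X]subr0; apply: cvgB => //; exact: cvg_cst.
- move/cvg_at_rightP : Fa; apply; split.
    by move=> n; rewrite ltrDl.
  by rewrite -[X in _ --> X]addr0; apply: cvgD => //; exact: cvg_cst.
Qed.

End improper_FTC.

Section density_measure.
Context d (T : measurableType d) (R : realType).
Local Open Scope ereal_scope.

Lemma density_measure (mu : {measure set T -> \bar R}) (w : T -> R)
    (phi : T -> R) :
  measurable_fun setT w -> (forall x, 0 <= w x)%R ->
  measurable_fun setT phi ->
  exists m : {measure set (measurableTypeR R) -> \bar R},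
    forall A, measurable A -> m A = \int[mu]_x (w x * \1_A (phi x))%:E.
Proof.
move=> mw w0 mphi.
pose m (A : set (measurableTypeR R)) : \bar R :=
  \int[mu]_(x in phi @^-1` A) (w x)%:E.
have m0 : m set0 = 0 by rewrite /m preimage_set0 integral_set0.
have mge0 A : 0 <= m A by apply: integral_ge0 => x _; rewrite lee_fin.
have msa : semi_sigma_additive m.
  move=> F mF tF mUF; rewrite /m preimage_bigcup.
  apply: (@semi_sigma_additive_nng_induced _ _ _ mu (EFin \o w)).
  - exact/measurable_EFinP.
  - by move=> x; rewrite lee_fin.
  - by move=> n; rewrite -[X in measurable X]setTI; apply: mphi => //; exact: mF.
  - by apply/trivIsetP => i j _ _ ij; rewrite -preimage_setI; move/trivIsetP : tF => /(_ i j I I ij) ->; rewrite preimage_set0.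
  - by rewrite -preimage_bigcup -[X in measurable X]setTI; apply: mphi => //; exact: bigcup_measurable.
pose M := isMeasure.Build _ (measurableTypeR R) R m m0 mge0 msa.
pose m1 : {measure set (measurableTypeR R) -> \bar R} := HB.pack m M.
exists m1 => A mA; rewrite /=.
rewrite /m integral_mkcond; apply: eq_integral => x _.
rewrite patchE indicE; have [Ax|nA] := pselect (A (phi x)); last first.
  by rewrite (memNset nA) mulr0 memNset.
by rewrite (mem_set Ax) mulr1 mem_set.
Qed.

End density_measure.

Section transfer_itv.
Context d (T : measurableType d) (R : realType).
Local Open Scope ereal_scope.

(** Half-open intervals form a generating pi-system, so that a change of variable
    on the line need only be checked on them; finiteness on bounded intervals is
    what makes the two measures unique. *)
Lemma transfer_eq_itv (mu : {measure set T -> \bar R})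
    (w : T -> R) (v : R -> R) (phi : T -> R) :
  measurable_fun setT w -> measurable_fun setT v -> measurable_fun setT phi ->
  (forall x, 0 <= w x)%R -> (forall u, 0 <= v u)%R ->
  (forall a b : R, (a < b)%R -> \int[mu]_x (w x * \1_(`]a, b]%classic) (phi x))%:E =
    \int[leb]_u (v u * \1_(`]a, b]%classic) u)%:E) ->
  (forall a b : R, \int[leb]_u (v u * \1_(`]a, b]%classic) u)%:E < +oo) ->
  forall g : R -> \bar R, measurable_fun setT g -> (forall y, 0 <= g y) ->
  \int[mu]_x ((w x)%:E * g (phi x)) = \int[leb]_u ((v u)%:E * g u).
Proof.
move=> mw mv mphi w0 v0 wv vfin g mg g0.
apply: transfer_integral => // A mA.
have [m mE] := density_measure mu mw w0 mphi.
have [m' mE'] := @density_measure _ (measurableTypeR R : measurableType _) R leb v id mv v0 (@measurable_id _ _ setT).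
rewrite -mE// -mE'//.
have H1 := @measure_unique _ R (measurableTypeR R) (@ocitv R).
have H2 := H1 (fun k : nat => `](- k%:R)%R, k%:R]%classic) erefl (@ocitvI R).
apply: H2 => //.
- by move=> k; exact: is_ocitv.
- exact: bigcup_itvT.
- move=> _ [[a b] _ <-] /=.
  have [ab|ba] := ltP a b; last by rewrite set_itv_ge ?measure0// bnd_simp -leNgt.
  by rewrite mE// mE'//; exact: wv.
- move=> k /=.
  have [ab|ba] := ltP (- k%:R)%R (k%:R : R).
    by rewrite mE//= wv//; exact: vfin.
  by rewrite set_itv_ge ?measure0// bnd_simp -leNgt.
Qed.

End transfer_itv.

(** * Integrals of the Abel kernel *)

Section abel_kernel.
Context {R : realType}.

(** Square roots of nonpositive numbers and inverses of 0 are 0, so that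
    [isqrt (x - y)] is the Abel kernel on the whole line, with its support
    condition y < x built in. *)
Definition isqrt (u : R) : R := (Num.sqrt u)^-1.

Lemma isqrt_ge0 u : 0 <= isqrt u.
Proof. by rewrite invr_ge0 sqrtr_ge0. Qed.

Lemma isqrt_le0 u : u <= 0 -> isqrt u = 0.
Proof. by move=> u0; rewrite /isqrt ler0_sqrtr// invr0. Qed.

Lemma measurable_sqrt : measurable_fun setT (@Num.sqrt R).
Proof. by apply: continuous_measurable_fun; exact: sqrt_continuous. Qed.

Lemma continuous_isqrt u : 0 < u -> {for u, continuous isqrt}.
Proof.
move=> u0; apply: cvgV; first by rewrite gt_eqF// sqrtr_gt0.
exact: sqrt_continuous.
Qed.

Lemma measurable_isqrt : measurable_fun setT isqrt.
Proof.
have -> : isqrt = isqrt \_ `]0, +oo[.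
  apply/funext => u; rewrite patchE; case: ifPn => //.
  by rewrite notin_setE/= in_itv/= andbT => /negP; rewrite -leNgt => /isqrt_le0.
apply: (measurable_restrictT isqrt _).1; first exact: measurable_itv.
apply: open_continuous_measurable_fun => // x /set_mem/=.
by rewrite in_itv/= andbT; exact: continuous_isqrt.
Qed.

End abel_kernel.

Section integrals.
Context {R : realType}.

Lemma integral_mul_indic d (T : measurableType d)
    (mu : {measure set T -> \bar R}) (f : T -> R) (A : set T) :
  (\int[mu]_x (f x * \1_A x)%:E = \int[mu]_(x in A) (f x)%:E)%E.
Proof.
rewrite [RHS]integral_mkcond; apply: eq_integral => x _.
rewrite patchE indicE; have [Ax|nA] := pselect (A x).
  by rewrite (mem_set Ax) mulr1.
by rewrite (memNset nA) mulr0.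
Qed.

Lemma integral_isqrt_shift (y a b : R) : 0 <= a -> a < b ->
  (\int[leb]_(x in `](y + a ^+ 2)%R, (y + b ^+ 2)%R]) (isqrt (x - y))%:E =
  (2 * (b - a))%:E)%E.
Proof.
move=> a0 ab.
have ab2 : a ^+ 2 < b ^+ 2 by rewrite ltr_pXn2r// nnegrE (le_trans a0)// ltW.
have ab' : y + a ^+ 2 < y + b ^+ 2 by rewrite ltrD2l.
have pos x : x \in `]y + a ^+ 2, y + b ^+ 2[ -> 0 < x - y.
  by rewrite in_itv/= => /andP[h _]; rewrite subr_gt0 (le_lt_trans _ h)// lerDl sqr_ge0.
have cF : continuous (fun x : R => 2 * Num.sqrt (x - y)).
  move=> x; apply: cvgM; first exact: cvg_cst.
  apply: (@cvg_comp _ _ _ (fun x => x - y) Num.sqrt); last exact: sqrt_continuous.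
  by apply: cvgB; [exact: cvg_id|exact: cvg_cst].
have E : (\int[leb]_(x in `](y + a ^+ 2)%R, (y + b ^+ 2)%R[) (isqrt (x - y))%:E =
  (2 * Num.sqrt (y + b ^+ 2 - y) - 2 * Num.sqrt (y + a ^+ 2 - y))%:E)%E.
  apply: (ge0_integral_oo_FTC (F := fun x => 2 * Num.sqrt (x - y))) => //.
  - by move=> x _; exact: isqrt_ge0.
  - move=> x /pos xy; apply: (@continuous_comp _ _ _ (fun x => x - y) isqrt).
      by apply: cvgB; [exact: cvg_id|exact: cvg_cst].
    exact: continuous_isqrt.
  - move=> x /pos xy.
    have dx : is_derive x 1 (fun x : R => x - y) 1.
      by rewrite -[X in is_derive _ _ _ X]subr0; apply: is_deriveB.
    have ds := is_derive1_sqrt xy.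
    have dsx := @is_derive1_comp _ Num.sqrt (fun x : R => x - y) x _ _ ds dx.
    apply: is_derive_eq.
    rewrite /GRing.scale/= /isqrt; field.
    by rewrite gt_eqF// sqrtr_gt0.
  - by apply: cvg_at_right_filter; exact: cF.
  - by apply: cvg_at_left_filter; exact: cF.
rewrite -(@integral_itv_bndo_bndc _ _ _ (fun x => (isqrt (x - y))%:E)); last first.
  apply/measurable_EFinP; apply: (measurableT_comp measurable_isqrt).
  by apply: measurable_funB.
rewrite E; congr EFin.
rewrite addrAC subrr add0r addrAC subrr add0r !sqrtr_sqr.
by rewrite !ger0_norm ?mulrBr// (le_trans a0)// ltW.
Qed.

End integrals.

Section substitution.
Context {R : realType}.
Local Open Scope ereal_scope.

Lemma measurable_isqrtB (y : R) : measurable_fun setT (fun x : R => isqrt (x - y)).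
Proof.
by apply: (measurableT_comp measurable_isqrt); apply: measurable_funB.
Qed.

Lemma measurable_isqrtBl (y : R) : measurable_fun setT (fun x : R => isqrt (y - x)).
Proof.
by apply: (measurableT_comp measurable_isqrt); apply: measurable_funB.
Qed.

(** The substitution x = y + u^2, for arbitrary nonnegative measurable G. *)
Lemma integral_isqrt_sqr (y : R) (G : R -> \bar R) :
  measurable_fun setT G -> (forall x, 0 <= G x) ->
  \int[leb]_x ((isqrt (x - y))%:E * G x) =
  \int[leb]_u ((2 * \1_(`]0%R, +oo[%classic) u)%:E * G (y + u ^+ 2)%R).
Proof.
move=> mG G0.
pose phi (x : R) : R := Num.sqrt (x - y).
have mphi : measurable_fun setT phi.
  apply: (measurableT_comp measurable_sqrt); exact: measurable_funB.
have mv : measurable_fun setT (fun u : R => 2 * \1_(`]0%R, +oo[%classic) u : R)%R.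
  by apply: measurable_funM => //; exact: measurable_indic.
transitivity (\int[leb]_x ((isqrt (x - y))%:E * G (y + phi x ^+ 2)%R)).
  apply: eq_integral => x _; have [xy|xy] := leP (x - y)%R 0%R.
    by rewrite isqrt_le0// !mul0e.
  by rewrite /phi sqr_sqrtr ?(ltW xy)// [(y + _)%R]addrC subrK.
have mG' : measurable_fun setT (fun u : R => G (y + u ^+ 2)%R).
  apply: (measurableT_comp mG); apply: measurable_funD => //.
have key (a b : R) : \int[leb]_x (isqrt (x - y) * \1_(`]a, b]%classic) (phi x))%:E =
    \int[leb]_u (2 * \1_(`]0%R, +oo[%classic) u * \1_(`]a, b]%classic) u)%:E.
  have [b0|b0] := leP b 0%R.
    rewrite [LHS]integral0_eq ?[RHS]integral0_eq// => x _.
      rewrite !indicE !mem_setE ?in_itv/= andbT -mulrA -natrM mulnb.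
      case: (ltP 0%R x) => [x0|//]; rewrite ?mulr0// andTb.
      by rewrite (lt_geF (le_lt_trans b0 x0)) andbF mulr0.
    have [xy|xy] := leP (x - y)%R 0%R; first by rewrite isqrt_le0// mul0r.
    rewrite indicE !mem_setE ?in_itv/= (@lt_geF _ _ b (phi x)) ?andbF ?mulr0//.
    by rewrite (le_lt_trans b0)// sqrtr_gt0.
  pose a' := Num.max a 0%R.
  have a'0 : (0 <= a')%R by rewrite le_max lexx orbT.
  have [ba|ab] := leP b a'.
    have ba' : (b <= a)%R by move: ba; rewrite le_max (lt_geF b0) orbF.
    rewrite set_itv_ge ?bnd_simp -?leNgt//.
    by rewrite !integral0_eq// => x _; rewrite indic0 mulr0.
  transitivity (\int[leb]_x (isqrt (x - y) *
      \1_(`](y + a' ^+ 2)%R, (y + b ^+ 2)%R]%classic) x)%:E).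
    apply: eq_integral => x _; congr EFin.
    have [xy|xy] := leP (x - y)%R 0%R; first by rewrite isqrt_le0// !mul0r.
    congr (_ * _)%R; rewrite !indicE !mem_setE ?in_itv/=.
    rewrite -ltrBrDl -lerBlDl; congr (nat_of_bool _)%:R; congr andb.
    - rewrite -[in RHS](sqr_sqrtr (ltW xy)) ltr_pXn2r ?nnegrE ?sqrtr_ge0//.
      by rewrite gt_max sqrtr_gt0 xy andbT.
    - by rewrite -[in RHS](sqr_sqrtr (ltW xy)) ler_pXn2r ?nnegrE ?sqrtr_ge0// ltW.
  rewrite (@integral_mul_indic _ _ (measurableTypeR R) leb (fun x : R => isqrt (x - y))) integral_isqrt_shift//.
  transitivity (\int[leb]_u (2 * \1_(`]a', b]%classic) u)%:E).
    rewrite (@integral_mul_indic _ _ (measurableTypeR R) leb (fun=> 2%R)) integral_cst//=.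
    by rewrite lebesgue_measure_itv/= lte_fin ab EFinM EFinB.
  apply: eq_integral => u _; rewrite -mulrA; congr (_ * _)%:E.
  rewrite !indicE !mem_setE ?in_itv/= andbT -natrM mulnb gt_max.
  by rewrite andbA [(_ && (0 < u)%R)%E]andbC.
apply: (@transfer_eq_itv _ _ _ leb (fun x => isqrt (x - y))
    (fun u => 2 * \1_(`]0%R, +oo[%classic) u)%R phi) => //.
- exact: measurable_isqrtB.
- by move=> x; exact: isqrt_ge0.
- move=> a b.
  apply: (@le_lt_trans _ _ (\int[leb]_u (2 * \1_(`]a, b]%classic) u)%:E)).
    apply: ge0_le_integral => //=.
    - apply/measurable_EFinP; apply: measurable_funM; first exact: mv.
      exact: measurable_indic.
    - apply/measurable_EFinP; apply: measurable_funM => //; exact: measurable_indic.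
    - move=> x _; rewrite lee_fin !indicE -mulrA ler_wpM2l// ler_piMl//.
      by rewrite lern1 leq_b1.
  rewrite (@integral_mul_indic _ _ (measurableTypeR R) leb (fun=> 2%R)) integral_cst//=.
  by rewrite lebesgue_measure_itv/=; case: ifP => _; rewrite ?mule0 -?EFinM ltry.
Qed.

End substitution.

Section kernels.
Context {R : realType}.

(** Here the kernel is integrated in its subtracted variable; cutting the interval
    at s covers all positions of s. *)
Lemma integral_isqrt_rev (s p q : R) : p <= q ->
  (\int[leb]_(t in `[p, q]) (isqrt (s - t))%:E =
  (2 * (Num.sqrt (s - p) - Num.sqrt (s - q)))%:E)%E.
Proof.
move=> pq.
have [sp|ps] := leP s p.
  rewrite integral0_eq.
    by rewrite !ler0_sqrtr ?subr_le0// ?subr0 ?mulr0// (le_trans sp).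
  move=> t /=; rewrite in_itv/= => /andP[pt _].
  by rewrite isqrt_le0// subr_le0 (le_trans sp).
pose q' := Num.min q s.
have q's : q' <= s by rewrite ge_min lexx orbT.
have -> : (\int[leb]_(t in `[p, q]) (isqrt (s - t))%:E =
    \int[leb]_(t in `[p, q']) (isqrt (s - t))%:E)%E.
  rewrite -2!(@integral_mul_indic _ _ (measurableTypeR R) leb (fun t => isqrt (s - t))).
  apply: eq_integral => t _; congr EFin.
  have [st|ts] := leP s t; first by rewrite isqrt_le0 ?mul0r// subr_le0.
  congr (_ * _); rewrite !indicE !mem_setE ?in_itv/= le_min.
  by rewrite (ltW ts) andbT.
have -> : Num.sqrt (s - q) = Num.sqrt (s - q').
  rewrite /q'; have [//|sq] := leP q s.
  by rewrite subrr sqrtr0 ler0_sqrtr// subr_le0 ltW.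
have : p <= q' by rewrite le_min pq ltW.
rewrite le_eqVlt => /predU1P[->|pq'].
  by rewrite set_itv1 integral_set1 subrr mulr0.
rewrite integral_itv_bndoo; last first.
  by apply/measurable_EFinP; apply: measurable_funTS; exact: measurable_isqrtBl.
have pos x : x \in `]p, q'[ -> 0 < s - x.
  by rewrite in_itv/= subr_gt0 => /andP[_ /lt_le_trans]; exact.
have cB : continuous (fun x : R => s - x).
  by move=> x; apply: cvgB; [exact: cvg_cst|exact: cvg_id].
have cF : continuous (fun x : R => - 2 * Num.sqrt (s - x)).
  move=> x; apply: cvgM; first exact: cvg_cst.
  apply: (@cvg_comp _ _ _ (fun x => s - x) Num.sqrt); last exact: sqrt_continuous.
  exact: cB.
transitivity (- 2 * Num.sqrt (s - q') - - 2 * Num.sqrt (s - p))%:E; last first.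
  by congr EFin; ring.
apply: (ge0_integral_oo_FTC (F := fun x => - 2 * Num.sqrt (s - x))) => //.
- by move=> x _; exact: isqrt_ge0.
- move=> x /pos xy; apply: (@continuous_comp _ _ _ (fun x => s - x) isqrt).
    exact: cB.
  exact: continuous_isqrt.
- move=> x /pos xy.
  have dx : is_derive x 1 (fun x : R => s - x) (- 1).
    by rewrite -[X in is_derive _ _ _ X]sub0r; apply: is_deriveB.
  have ds := is_derive1_sqrt xy.
  have dsx := @is_derive1_comp _ Num.sqrt (fun x : R => s - x) x _ _ ds dx.
  apply: is_derive_eq.
  rewrite /GRing.scale/= /isqrt; field.
  by rewrite gt_eqF// sqrtr_gt0.
- by apply: cvg_at_right_filter; exact: cF.
- by apply: cvg_at_left_filter; exact: cF.
Qed.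

Lemma cvg_asin_left1 : asin x @[x --> (1 : R)^'-] --> (pi / 2 : R).
Proof.
have pi0 := @pi_gt0 R.
apply/cvgrPdist_lt => e e0.
pose h := Num.min (e / 2) (pi / 4) : R.
have h0 : 0 < h by rewrite lt_min !divr_gt0.
have he : h < e by rewrite (@le_lt_trans _ _ (e / 2)) ?ge_min ?lexx// ltr_pdivrMr// mulr_natr mulr2n ltrDl.
have hpi : h <= pi / 4 by rewrite ge_min lexx orbT.
have hin : pi / 2 - h \in `[- (pi / 2), pi / 2] by rewrite in_itv/=; apply/andP; split; lra.
have s1 : sin (pi / 2 - h) < 1.
  rewrite -[ltRHS]sin_pihalf ltr_sin//; last by rewrite in_itv/=; apply/andP; split; lra.
  by rewrite ltrBlDr ltrDl.
have sN1 : -1 <= sin (pi / 2 - h) by exact: sin_geN1.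
near=> x.
have x1 : x < 1 by near: x; exact: nbhs_left_lt.
have xs : sin (pi / 2 - h) < x by near: x; exact: nbhs_left_gt.
have xin : -1 <= x <= 1 by rewrite (ltW x1) (le_trans sN1)// ltW.
have al := asin_lepi2 xin; have ag := asin_geNpi2 xin.
have : pi / 2 - h < asin x.
  rewrite -ltr_sin ?asinK ?in_itv//=; first exact/andP.
rewrite ger0_norm ?subr_ge0//; lra.
Unshelve. all: by end_near. Qed.

(** The primitive is 2 asin (u / sqrt v); its limit at the right end is obtained
    from [cvg_asin_left1] because asin is not differentiable at 1. *)
Lemma integral_arcsine (v : R) : 0 < v ->
  (\int[leb]_u ((2 * \1_(`]0%R, +oo[%classic) u) * isqrt (v - u ^+ 2))%:E = pi%:E)%E.
Proof.
move=> v0; pose c := Num.sqrt v.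
have c0 : 0 < c by rewrite sqrtr_gt0.
have c2 : c ^+ 2 = v by rewrite sqr_sqrtr// ltW.
transitivity (\int[leb]_(u in `]0%R, c[) (2 * isqrt (v - u ^+ 2))%:E)%E.
  rewrite -(@integral_mul_indic _ _ (measurableTypeR R) leb (fun u => 2 * isqrt (v - u ^+ 2))).
  apply: eq_integral => u _; congr EFin.
  rewrite mulrAC; have [cu|uc] := leP c u.
    by rewrite isqrt_le0 ?mulr0 ?mul0r// subr_le0 -c2 ler_pXn2r// nnegrE ltW// (lt_le_trans c0).
  by congr (_ * _); rewrite !indicE !mem_setE ?in_itv/= uc andbT.
have pos u : u \in `]0, c[ -> 0 < v - u ^+ 2.
  rewrite in_itv/= => /andP[u0 uc].
  by rewrite subr_gt0 -c2 ltr_pXn2r// nnegrE ltW.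
have cB : continuous (fun x : R => v - x ^+ 2).
  by move=> x; apply: cvgB; [exact: cvg_cst|exact: exprn_continuous].
have uc1 u : u \in `]0, c[ -> -1 < u / c < 1.
  rewrite in_itv/= => /andP[u0 uc]; rewrite ltr_pdivrMr// mul1r uc andbT.
  by rewrite (@lt_trans _ _ 0)// ?ltrN10// divr_gt0.
transitivity (2 * (pi / 2) - 0 : R)%:E; last first.
  by rewrite subr0 mulrC divfK.
apply: (ge0_integral_oo_FTC (F := fun x => 2 * asin (x / c))) => //.
- by move=> x _; rewrite mulr_ge0// isqrt_ge0.
- move=> x /pos xy; apply: cvgM; first exact: cvg_cst.
  by have := @continuous_comp _ _ _ (fun x : R => v - x ^+ 2) isqrt x (cB x) (continuous_isqrt xy).
- move=> x xc.
  have dx : is_derive x 1 (fun x : R => x / c) c^-1.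
    have -> : (fun x : R => x / c) = c^-1 \*: (@id R).
      by apply/funext => w /=; rewrite /GRing.scale/= mulrC.
    by apply: is_derive_eq; rewrite /GRing.scale/= mulr1.
  have ds := is_derive1_asin (uc1 _ xc).
  have dsx := @is_derive1_comp _ asin (fun x : R => x / c) x _ _ ds dx.
  apply: is_derive_eq.
  rewrite /GRing.scale/= /isqrt.
  have -> : 1 - (x / c) ^+ 2 = (v - x ^+ 2) / c ^+ 2.
    by rewrite -c2; field; rewrite gt_eqF.
  have sp : 0 < Num.sqrt (v - x ^+ 2) by rewrite sqrtr_gt0; exact: pos.
  rewrite sqrtrM ?(ltW (pos _ xc))// sqrtrV ?sqr_ge0// sqrtr_sqr gtr0_norm//.
  by field; rewrite !gt_eqF.
- have as0 : asin (0 / c) = 0 :> R.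
    rewrite mul0r -[X in asin X]sin0 sinK// in_itv/=.
    by apply/andP; split; have := @pi_gt0 R; lra.
  apply: cvg_at_right_filter.
  rewrite -[X in _ --> X](mulr0 2) -[in X in _ --> X]as0.
  apply: cvgM; first exact: cvg_cst.
  have cc : {for 0, continuous (fun x : R => x / c)}.
    by apply: cvgM; [exact: cvg_id|exact: cvg_cst].
  have ca : {for 0 / c, continuous (@asin R)}.
    by apply: continuous_asin; rewrite mul0r ltrN10 ltr01.
  exact: (continuous_comp cc ca).
- apply: cvgM; first exact: cvg_cst.
  apply/cvg_at_leftP => u [uc ucv].
  have /cvg_at_leftP := cvg_asin_left1; apply; split.
    by move=> n; rewrite ltr_pdivrMr// mul1r.
  rewrite -[X in _ --> X](divff (lt0r_neq0 c0)).
  by apply: cvgM => //; exact: cvg_cst.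
Qed.

(** The Beta integral B(1/2, 1/2): the substitution s = t + u^2 turns it into the
    arcsine integral.  It is the reason why the composition of two Abel transforms
    is, up to pi, plain integration. *)
Lemma integral_beta (t x : R) : t < x ->
  (\int[leb]_s (isqrt (s - t) * isqrt (x - s))%:E = pi%:E)%E.
Proof.
move=> tx.
under eq_integral do rewrite EFinM.
rewrite integral_isqrt_sqr; last 2 first.
- by apply/measurable_EFinP; exact: measurable_isqrtBl.
- by move=> s; rewrite lee_fin isqrt_ge0.
rewrite -(@integral_arcsine (x - t)) ?subr_gt0//.
by apply: eq_integral => u _; rewrite -EFinM opprD addrA.
Qed.

Lemma ge0_integral_even (H : R -> \bar R) : measurable_fun setT H ->
  (forall u, 0 <= H u)%E -> (forall u, H (- u) = H u) ->
  (\int[leb]_u H u = \int[leb]_u ((2 * \1_(`]0%R, +oo[%classic) u)%:E * H u))%E.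
Proof.
move=> mH H0 Hev.
have mf (D : set R) : measurable D -> measurable_fun D H.
  by move=> mD; exact: measurable_funTS.
have E : (\int[leb]_(u in `]0%R, +oo[) H u = \int[leb]_(u in `]-oo, 0%R]) H u)%E.
  rewrite integral_itv_obnd_cbnd; last by apply: mf; exact: measurable_itv.
  rewrite ge0_integration_by_substitution0//.
  by apply: eq_integral => u _; rewrite Hev.
have -> : (\int[leb]_u ((2 * \1_(`]0%R, +oo[%classic) u)%:E * H u) =
   \int[leb]_(u in `]0%R, +oo[) (2%:E * H u))%E.
  rewrite [RHS]integral_mkcond; apply: eq_integral => u _.
  rewrite patchE indicE; have [Ax|nA] := pselect (`]0%R, +oo[%classic u).
    by rewrite (mem_set Ax) mulr1.
  by rewrite (memNset nA) mulr0 mul0e.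
rewrite ge0_integralZl//; last by apply: mf; exact: measurable_itv.
rewrite -(setUv `]-oo, 0%R]%classic) ge0_integral_setU//=; last 3 first.
- exact: measurableC.
- by rewrite setUv.
- exact/disj_setPCl.
- by rewrite setCitvl -E mule_natl mule2n.
Qed.

End kernels.

(** * Polar coordinates *)

Section product3.
Context d1 d2 (T1 : measurableType d1) (T2 : measurableType d2) {R : realType}.
Variables (m1 : {sigma_finite_measure set T1 -> \bar R})
  (m2 : {sigma_finite_measure set T2 -> \bar R}).
Local Open Scope ereal_scope.

(** Fubini's theorem asks for a sigma-finite structure on each factor; this
    supplies one for a factor that is itself a product. *)
Lemma sigma_finite_product :
  exists m : {sigma_finite_measure set (T1 * T2)%type -> \bar R},
    (m : set (T1 * T2)%type -> \bar R) = m1 \x m2.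
Proof.
have sf : sigma_finite setT (m1 \x m2).
  have /sigma_finiteP[F [TF ndF Foo]] := sigma_finiteT m1.
  have /sigma_finiteP[G [TG ndG Goo]] := sigma_finiteT m2.
  exists (fun n => F n `*` G n).
    rewrite -setXTT TF TG; apply/seteqP; split => [[x y]|[x y] [n _ []/= ? ?]].
      move=> [/= [n _ Fnx] [k _ Gky]]; exists (maxn n k) => //; split.
      - by move: x Fnx; exact/subsetPset/ndF/leq_maxl.
      - by move: y Gky; exact/subsetPset/ndG/leq_maxr.
    by split; exists n.
  move=> k; have [? ?] := Foo k; have [? ?] := Goo k.
  split; first exact: measurableX.
  by rewrite product_measure1E// lte_mul_pinfty// ge0_fin_numE.
pose M := @Measure_isSigmaFinite.Build _ (T1 * T2)%type R (m1 \x m2) sf.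
pose m : {sigma_finite_measure set (T1 * T2)%type -> \bar R} := HB.pack (m1 \x m2) M.
by exists m.
Qed.

Context d3 (T3 : measurableType d3) (m3 : {sigma_finite_measure set T3 -> \bar R}).
Variable f : (T1 * T2 * T3)%type -> \bar R.
Hypotheses (mf : measurable_fun setT f) (f0 : forall p, 0 <= f p).

Lemma fubini_tonelli1_prod :
  \int[(m1 \x m2) \x m3]_p f p = \int[m1 \x m2]_q fubini_F m3 f q.
Proof. by have [m <-] := sigma_finite_product; exact: fubini_tonelli1. Qed.

Lemma fubini_tonelli2_prod :
  \int[(m1 \x m2) \x m3]_p f p = \int[m3]_z \int[m1 \x m2]_q f (q, z).
Proof. by have [m <-] := sigma_finite_product; exact: fubini_tonelli2. Qed.

End product3.

Section polar.
Context {R : realType}.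
Local Open Scope ereal_scope.

Lemma measurable_isqrtB2 :
  measurable_fun setT (fun p : R * R => isqrt (p.2 - p.1)).
Proof.
by apply: (measurableT_comp measurable_isqrt); apply: measurable_funB.
Qed.

Lemma integral_sqr (y : R) (G : R -> \bar R) :
  measurable_fun setT G -> (forall x, 0 <= G x) ->
  \int[leb]_u G (y + u ^+ 2)%R = \int[leb]_x ((isqrt (x - y))%:E * G x).
Proof.
move=> mG G0.
have mG' : measurable_fun setT (fun u : R => G (y + u ^+ 2)%R).
  apply: (measurableT_comp mG); exact: measurable_funD.
rewrite ge0_integral_even ?integral_isqrt_sqr// => u.
by rewrite sqrrN.
Qed.

(** The angle of a half circle, whatever its radius. *)
Lemma integral_isqrt_circle (x : R) :
  \int[leb]_u (isqrt (x - u ^+ 2))%:E = (pi * \1_(`]0%R, +oo[%classic) x)%:E.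
Proof.
have [x0|x0] := leP x 0%R.
  rewrite integral0_eq.
    by rewrite indicE mem_setE ?in_itv/= (le_gtF x0) mulr0.
  by move=> u _; rewrite isqrt_le0// subr_le0 (le_trans x0)// sqr_ge0.
have mi : measurable_fun setT (fun u : R => (isqrt (x - u ^+ 2))%:E).
  apply/measurable_EFinP; apply: (measurableT_comp measurable_isqrt).
  exact: measurable_funB.
rewrite ge0_integral_even//.
- under eq_integral do rewrite -EFinM.
  rewrite integral_arcsine//.
  by rewrite indicE mem_setE ?in_itv/= x0 mulr1.
- by move=> u; rewrite lee_fin isqrt_ge0.
- by move=> u; rewrite sqrrN.
Qed.

(** Polar coordinates with y = r^2 as radial variable, so that the Jacobian is
    constant.  No angle is needed: substituting x = a^2 + b^2 for b and exchanging
    the integrals leaves the constant angle [integral_isqrt_circle]. *)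
Lemma polar_integral (G : R -> \bar R) :
  measurable_fun setT G -> (forall x, 0 <= G x) ->
  \int[leb]_a \int[leb]_b G (a ^+ 2 + b ^+ 2)%R =
  pi%:E * \int[leb]_(y in `]0%R, +oo[) G y.
Proof.
move=> mG G0.
pose f (p : R * R) := (isqrt (p.2 - p.1 ^+ 2))%:E * G p.2.
have mf : measurable_fun setT f.
  apply: emeasurable_funM; last exact: (measurableT_comp mG).
  apply/measurable_EFinP; apply: (measurableT_comp measurable_isqrt).
  by apply: measurable_funB => //; exact: measurable_funX.
have f0 p : 0 <= f p by rewrite mule_ge0// lee_fin isqrt_ge0.
transitivity (\int[leb]_a \int[leb]_x f (a, x)).
  by apply: eq_integral => a _; rewrite integral_sqr.
rewrite fubini_tonelli// [X in _ = _ * X]integral_mkcond -ge0_integralZl//.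
- apply: eq_integral => x _; rewrite /f/=.
  rewrite ge0_integralZr//.
  + rewrite integral_isqrt_circle patchE indicE.
    by case: (_ \in _); rewrite ?mulr1// mulr0 mul0e mule0.
  + apply/measurable_EFinP; apply: (measurableT_comp measurable_isqrt).
    exact: measurable_funB.
  + by move=> u _; rewrite lee_fin isqrt_ge0.
- apply/(measurable_restrictT _ _).1 => /=; first exact: measurable_itv.
  exact: measurable_funTS.
- by move=> x _; rewrite patchE; case: ifP.
- by rewrite lee_fin pi_ge0.
Qed.

(** Functions of Y = x1^2 + x2^2 and of the squared norm in R^3: the plane
    coordinates are polar, and the third one is replaced by the squared norm,
    which brings in the Abel kernel. *)
Lemma integral_R3_radial (H : R * R -> \bar R) :
  measurable_fun setT H -> (forall p, 0 <= H p) ->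
  \int[(leb \x leb) \x leb]_p H ((p.1.1 ^+ 2 + p.1.2 ^+ 2)%R,
      (p.1.1 ^+ 2 + p.1.2 ^+ 2 + p.2 ^+ 2)%R) =
  pi%:E * \int[leb]_(y in `]0%R, +oo[) \int[leb]_x ((isqrt (x - y))%:E * H (y, x)).
Proof.
move=> mH H0.
have mN : measurable_fun setT (fun p : R * R => p.1 ^+ 2 + p.2 ^+ 2)%R.
  by apply: measurable_funD; apply: measurable_funX => /=.
pose N (p : R * R) : R := (p.1 ^+ 2 + p.2 ^+ 2)%R.
pose f3 (p : R * R * R) := H (N p.1, (N p.1 + p.2 ^+ 2)%R).
have mf3 : measurable_fun setT f3.
  apply: (measurableT_comp mH); apply: measurable_fun_pair => /=.
  + exact: (measurableT_comp mN).
  + apply: measurable_funD; first exact: (measurableT_comp mN).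
    exact: measurable_funX.
have f30 p : 0 <= f3 p by exact: H0.
transitivity (\int[leb \x leb]_q fubini_F leb f3 q).
  exact: (@fubini_tonelli1_prod _ _ (measurableTypeR R) (measurableTypeR R) R
    leb leb _ (measurableTypeR R) leb f3 mf3 f30).
pose G y := \int[leb]_x ((isqrt (x - y))%:E * H (y, x)).
have mG : measurable_fun setT G.
  apply: (@measurable_fun_fubini_tonelli_F _ _ _ _ _ leb
    (fun p : R * R => (isqrt (p.2 - p.1))%:E * H p)).
  - by apply: emeasurable_funM => //; apply/measurable_EFinP; exact: measurable_isqrtB2.
  - by move=> p; rewrite mule_ge0// lee_fin isqrt_ge0.
have G0 y : 0 <= G y.
  by apply: integral_ge0 => x _; rewrite mule_ge0// lee_fin isqrt_ge0.
rewrite -polar_integral//.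
transitivity (\int[leb \x leb]_p G (N p)); last first.
  have mGN : measurable_fun setT (fun p => G (N p)) by exact: (measurableT_comp mG).
  exact: (@fubini_tonelli1 _ _ (measurableTypeR R) (measurableTypeR R) R leb leb
    (fun p => G (N p)) mGN (fun p => G0 (N p))).
apply: eq_integral => p _; rewrite /fubini_F/= /f3/=.
rewrite (integral_sqr (N p) (G := fun x => H (N p, x)))//.
by apply: (measurableT_comp mH); exact: measurable_fun_pair.
Qed.

End polar.

(** * Abel transforms of the radial mass *)

Section model.
Context {R : realType}.
Variables (nu : {sigma_finite_measure set R -> \bar R}) (rho : R * R -> R).
Let quadrant : set (R * R) := [set p | 0 <= p.1 /\ 0 <= p.2].
Hypotheses (rho_meas : measurable_fun quadrant rho)
  (rho_ge0 : forall x z, 0 <= x -> 0 <= z -> 0 <= rho (x, z)).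
Local Open Scope ereal_scope.

Let quadrantE : quadrant = `[0%R, +oo[%classic `*` `[0%R, +oo[%classic.
Proof.
by apply/seteqP; split => -[x z]; rewrite /quadrant/= !in_itv/= !andbT.
Qed.

Let measurable_quadrant : measurable quadrant.
Proof. by rewrite quadrantE; apply: measurableX; exact: measurable_itv. Qed.

(** Extending the density by 0 gives a nonnegative measurable function on the whole
    plane, so that Fubini's theorem applies without side conditions. *)
Definition rho0 : R * R -> R := rho \_ [set p | (0 <= p.1 /\ 0 <= p.2)%R].

Lemma measurable_rho0 : measurable_fun setT rho0.
Proof. exact/(measurable_restrictT _ _).1. Qed.

Lemma rho0_ge0 p : (0 <= rho0 p)%R.
Proof.
rewrite /rho0 patchE; case: ifPn => //; case: p => x z.
by rewrite inE => -[]/=; exact: rho_ge0.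
Qed.

Lemma rho0E x z : (0 <= x)%R -> (0 <= z)%R -> rho0 (x, z) = rho (x, z).
Proof. by move=> x0 z0; rewrite /rho0 patchE mem_set. Qed.

Definition pospart (z : R) : R := Num.max z 0%R.

Lemma pospart_ge0 z : (0 <= pospart z)%R.
Proof. by rewrite le_max lexx orbT. Qed.

Lemma measurable_pospart : measurable_fun setT pospart.
Proof. exact: measurable_maxr. Qed.

(** The function m of the introduction. *)
Definition radial_mass (x : R) : \bar R :=
  \int[nu]_z (pospart z * rho0 (Num.sqrt x, z))%:E.

Let measurable_integrand : measurable_fun setT
  (fun p : R * R => (pospart p.2 * rho0 (Num.sqrt p.1, p.2))%R).
Proof.
apply: measurable_funM; first exact: (measurableT_comp measurable_pospart).
apply: (measurableT_comp measurable_rho0); apply: measurable_fun_pair => //.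
exact: (measurableT_comp measurable_sqrt).
Qed.

Lemma radial_mass_ge0 x : 0 <= radial_mass x.
Proof.
by apply: integral_ge0 => z _; rewrite lee_fin mulr_ge0 ?pospart_ge0 ?rho0_ge0.
Qed.

Lemma measurable_radial_mass : measurable_fun setT radial_mass.
Proof.
apply: (@measurable_fun_fubini_tonelli_F _ _ _ _ _ nu
    (fun p : R * R => (pospart p.2 * rho0 (Num.sqrt p.1, p.2))%:E)).
- exact/measurable_EFinP.
- by move=> p; rewrite lee_fin mulr_ge0 ?pospart_ge0 ?rho0_ge0.
Qed.

(** The function psi, rewritten as one Abel transform of the radial mass. *)
Definition abel_mass (y : R) : \bar R :=
  pi%:E * \int[leb]_x ((isqrt (x - y))%:E * radial_mass x).

Lemma abel_mass_ge0 y : 0 <= abel_mass y.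
Proof.
rewrite mule_ge0 ?lee_fin ?pi_ge0//; apply: integral_ge0 => x _.
by rewrite mule_ge0 ?lee_fin ?isqrt_ge0// radial_mass_ge0.
Qed.

Let measurable_abel_integrand : measurable_fun setT
  (fun p : R * R => (isqrt (p.2 - p.1))%:E * radial_mass p.2).
Proof.
apply: emeasurable_funM; last exact: (measurableT_comp measurable_radial_mass).
by apply/measurable_EFinP; exact: measurable_isqrtB2.
Qed.

Lemma measurable_abel_mass : measurable_fun setT abel_mass.
Proof.
apply: emeasurable_funM => //.
apply: (@measurable_fun_fubini_tonelli_F _ _ _ _ _ leb
    (fun p : R * R => (isqrt (p.2 - p.1))%:E * radial_mass p.2)) => // p.
by rewrite mule_ge0 ?lee_fin ?isqrt_ge0// radial_mass_ge0.
Qed.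

Lemma mass_swap (y : R) :
  \int[nu]_z \int[leb]_x (isqrt (x - y) * (pospart z * rho0 (Num.sqrt x, z)))%:E
  = \int[leb]_x ((isqrt (x - y))%:E * radial_mass x).
Proof.
pose f (p : R * R) := (isqrt (p.1 - y) * (pospart p.2 * rho0 (Num.sqrt p.1, p.2)))%:E.
have mf : measurable_fun setT f.
  apply/measurable_EFinP; apply: measurable_funM => //.
  exact: (measurableT_comp (measurable_isqrtB y)).
have f0 p : 0 <= f p.
  by rewrite lee_fin !mulr_ge0 ?isqrt_ge0 ?pospart_ge0 ?rho0_ge0.
rewrite -(@fubini_tonelli _ _ _ _ _ leb nu f)//.
apply: eq_integral => x _; rewrite /f/=.
under eq_integral do rewrite EFinM.
rewrite ge0_integralZl_EFin//.
- by move=> z _; rewrite lee_fin mulr_ge0 ?pospart_ge0 ?rho0_ge0.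
- apply/measurable_EFinP.
  exact: (measurableT_comp measurable_integrand (measurable_pair1 x)).
- exact: isqrt_ge0.
Qed.

Lemma psi_funE (y : R) : (0 <= y)%R -> psi_fun nu rho y = abel_mass y.
Proof.
move=> y0; rewrite /psi_fun /abel_mass -mass_swap.
have m1 z : measurable_fun setT (fun x : R =>
    (isqrt (x - y) * (pospart z * rho0 (Num.sqrt x, z)))%R).
  apply: measurable_funM; first exact: measurable_isqrtB.
  exact: (measurableT_comp measurable_integrand (measurable_pair2 z)).
rewrite -ge0_integralZl//; last 3 first.
- apply: (@measurable_fun_fubini_tonelli_G _ _ _ _ _ leb (fun p : R * R =>
    (isqrt (p.1 - y) * (pospart p.2 * rho0 (Num.sqrt p.1, p.2)))%:E)).
  + apply/measurable_EFinP; apply: measurable_funM => //.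
    exact: (measurableT_comp (measurable_isqrtB y)).
  + by move=> p; rewrite lee_fin !mulr_ge0 ?isqrt_ge0 ?pospart_ge0 ?rho0_ge0.
- move=> z _; apply: integral_ge0 => x _.
  by rewrite lee_fin !mulr_ge0 ?isqrt_ge0 ?pospart_ge0 ?rho0_ge0.
- by rewrite lee_fin pi_ge0.
rewrite [LHS]integral_mkcond; apply: eq_integral => z _.
rewrite patchE; case: ifPn => [|]; last first.
  rewrite notin_setE/= in_itv/= andbT => /negP; rewrite -ltNge => z0.
  rewrite integral0_eq ?mule0// => x _.
  by rewrite /pospart (max_idPr (ltW z0)) mul0r mulr0.
rewrite inE/= in_itv/= andbT => z0.
rewrite /g_fun muleCA; congr (_ * _).
under [in RHS]eq_integral do rewrite mulrCA EFinM.
rewrite ge0_integralZl_EFin//; last 3 first.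
- by move=> x _; rewrite lee_fin mulr_ge0 ?isqrt_ge0 ?rho0_ge0.
- apply/measurable_EFinP/measurable_funM; first exact: measurable_isqrtB.
  apply: (measurableT_comp measurable_rho0); apply: measurable_fun_pair => //.
  exact: measurable_sqrt.
- exact: pospart_ge0.
rewrite {1}/pospart (max_idPl z0); congr (_ * _).
rewrite [LHS]integral_mkcond; apply: eq_integral => x _.
rewrite patchE; case: ifPn => [|]; last first.
  rewrite notin_setE/= in_itv/= andbT => /negP; rewrite -leNgt => xy.
  by rewrite isqrt_le0 ?mul0r// subr_le0.
by rewrite rho0E ?sqrtr_ge0// mulrC.
Qed.

Lemma Psi_fun_abel (t : R) : (0 <= t)%R ->
  Psi_fun nu rho t = \int[leb]_s ((isqrt (s - t))%:E * abel_mass s).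
Proof.
move=> t0; rewrite /Psi_fun.
rewrite integral_mkcond; apply: eq_integral => s _.
rewrite patchE; case: ifPn => [|]; last first.
  rewrite notin_setE/= in_itv/= andbT => /negP; rewrite -leNgt => st.
  by rewrite isqrt_le0 ?mul0e// subr_le0.
rewrite inE/= in_itv/= andbT => ts.
have s0 : (0 <= s)%R by rewrite (le_trans t0)// ltW.
by rewrite -/(isqrt (s - t)) (psi_funE s0) muleC.
Qed.

(** Psi is the Abel transform of the Abel transform of the radial mass; after
    exchanging the integrals the inner one is the Beta integral.  Monotonicity of
    Psi, and the relation between its increments and the radial mass, are read off
    this formula. *)
Lemma Psi_funE (t : R) : (0 <= t)%R ->
  Psi_fun nu rho t = (pi ^+ 2)%:E * \int[leb]_(x in `]t, +oo[) radial_mass x.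
Proof.
move=> t0; rewrite Psi_fun_abel//.
have I0 s x : 0 <= (isqrt (x - s))%:E * radial_mass x.
  by rewrite mule_ge0 ?lee_fin ?isqrt_ge0// radial_mass_ge0.
pose f (p : R * R) := (isqrt (p.1 - t))%:E * ((isqrt (p.2 - p.1))%:E * radial_mass p.2).
have mf : measurable_fun setT f.
  apply: emeasurable_funM => //; apply/measurable_EFinP.
  exact: (measurableT_comp (measurable_isqrtB t)).
have f0 p : 0 <= f p by rewrite mule_ge0 ?lee_fin ?isqrt_ge0.
have mI s : measurable_fun setT (fun x : R => (isqrt (x - s))%:E * radial_mass x).
  apply: emeasurable_funM; last exact: measurable_radial_mass.
  by apply/measurable_EFinP; exact: measurable_isqrtB.
transitivity (pi%:E * \int[leb]_s \int[leb]_x f (s, x)).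
  rewrite -ge0_integralZl//; last 3 first.
  - exact: (@measurable_fun_fubini_tonelli_F _ _ _ _ _ leb f).
  - by move=> s _; apply: integral_ge0.
  - by rewrite lee_fin pi_ge0.
  apply: eq_integral => s _.
  rewrite /abel_mass muleCA; congr (_ * _).
  rewrite -ge0_integralZl//; first exact: mI.
  by rewrite lee_fin isqrt_ge0.
rewrite fubini_tonelli// expr2 EFinM -muleA; congr (_ * _).
rewrite [X in _ = _ * X]integral_mkcond -ge0_integralZl//; last 3 first.
- apply/(measurable_restrictT _ _).1 => /=; first exact: measurable_itv.
  apply: measurable_funTS; exact: measurable_radial_mass.
- by move=> x _; rewrite patchE; case: ifP => // _; exact: radial_mass_ge0.
- by rewrite lee_fin pi_ge0.
apply: eq_integral => x _; rewrite /f/= patchE.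
under eq_integral do rewrite muleA.
rewrite ge0_integralZr//; last 3 first.
- apply: emeasurable_funM; apply/measurable_EFinP; first exact: measurable_isqrtB.
  exact: measurable_isqrtBl.
- by move=> s _; rewrite mule_ge0 ?lee_fin ?isqrt_ge0.
- exact: radial_mass_ge0.
case: ifPn => [|].
  rewrite inE/= in_itv/= andbT => tx.
  by under eq_integral do rewrite -EFinM; rewrite integral_beta.
rewrite notin_setE/= in_itv/= andbT => /negP; rewrite -leNgt => xt.
rewrite integral0_eq ?mule0 ?mul0e// => s _.
have [st|ts] := leP s t; first by rewrite isqrt_le0 ?mul0e// subr_le0.
by rewrite [X in _ * X%:E]isqrt_le0 ?mule0// subr_le0 (le_trans xt)// ltW.
Qed.

(** Exchanging the integrals over t and s leaves the integral of the kernel over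
    t in [0, x], which is the function of the observation that defines the
    estimator. *)
Lemma integral_Psi_fun (x : R) : (0 <= x)%R ->
  \int[leb]_(t in `[0%R, x]) Psi_fun nu rho t =
  \int[leb]_(s in `]0%R, +oo[)
    ((2 * (Num.sqrt s - Num.sqrt (s - x)))%:E * abel_mass s).
Proof.
move=> x0.
pose f (p : R * R) := (isqrt (p.2 - p.1))%:E *
  ((\1_(`[0%R, x]%classic) p.1)%:E * abel_mass p.2).
have mf : measurable_fun setT f.
  apply: emeasurable_funM.
    by apply/measurable_EFinP; exact: measurable_isqrtB2.
  apply: emeasurable_funM; last exact: (measurableT_comp measurable_abel_mass).
  apply/measurable_EFinP.
  apply: (measurableT_comp (f := (\1_(`[0%R, x]%classic) : R -> R)) (g := fst)) => //.
have f0 p : 0 <= f p.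
  by rewrite mule_ge0 ?lee_fin ?isqrt_ge0// mule_ge0 ?abel_mass_ge0.
transitivity (\int[leb]_t \int[leb]_s f (t, s)).
  rewrite integral_mkcond; apply: eq_integral => t _.
  rewrite patchE /f/= indicE; case: ifPn => [|_].
    rewrite inE/= in_itv/= => /andP[t0 _]; rewrite Psi_fun_abel//.
    by under [in RHS]eq_integral do rewrite mul1e.
  by rewrite integral0_eq// => s _; rewrite mul0e mule0.
rewrite (@fubini_tonelli _ _ (measurableTypeR R) (measurableTypeR R) R leb leb f mf f0).
rewrite [RHS]integral_mkcond; apply: eq_integral => s _.
under eq_integral do rewrite /f/= muleA.
rewrite ge0_integralZr//; last 3 first.
- apply: emeasurable_funM; apply/measurable_EFinP; first exact: measurable_isqrtBl.
  exact: measurable_indic.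
- by move=> t _; rewrite mule_ge0 ?lee_fin ?isqrt_ge0.
- exact: abel_mass_ge0.
under eq_integral do rewrite -EFinM.
rewrite (@integral_mul_indic _ _ (measurableTypeR R) leb (fun t : R => isqrt (s - t))).
rewrite integral_isqrt_rev// subr0 patchE; case: ifPn => [//|].
rewrite notin_setE/= in_itv/= andbT => /negP; rewrite -leNgt => s0.
rewrite !ler0_sqrtr ?subr0 ?mulr0 ?mul0e//.
by rewrite subr_le0 (le_trans s0).
Qed.

(** By symmetry of Fubini's theorem the Abel transform can be moved from the mass
    to the test function. *)
Lemma integral_abel_mass (h : R -> \bar R) : measurable_fun setT h ->
  (forall y, 0 <= h y) ->
  \int[leb]_(y in `]0%R, +oo[) (h y * abel_mass y) =
  pi%:E * \int[leb]_x (radial_mass x *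
     \int[leb]_(y in `]0%R, +oo[) ((isqrt (x - y))%:E * h y)).
Proof.
move=> mh h0.
pose k (p : R) := (\1_(`]0%R, +oo[%classic) p)%:E * h p.
have mk : measurable_fun setT k.
  apply: emeasurable_funM => //; apply/measurable_EFinP; exact: measurable_indic.
have k0 p : 0 <= k p by rewrite mule_ge0.
pose f (p : R * R) := k p.1 * ((isqrt (p.2 - p.1))%:E * radial_mass p.2).
have mf : measurable_fun setT f.
  by apply: emeasurable_funM => //; exact: (measurableT_comp mk).
have I0 s x : 0 <= (isqrt (x - s))%:E * radial_mass x.
  by rewrite mule_ge0 ?lee_fin ?isqrt_ge0// radial_mass_ge0.
have f0 p : 0 <= f p by rewrite mule_ge0.
have mI s : measurable_fun setT (fun x : R => (isqrt (x - s))%:E * radial_mass x).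
  apply: emeasurable_funM; last exact: measurable_radial_mass.
  by apply/measurable_EFinP; exact: measurable_isqrtB.
transitivity (pi%:E * \int[leb]_y \int[leb]_x f (y, x)).
  rewrite integral_mkcond -ge0_integralZl//; last 3 first.
  - exact: (@measurable_fun_fubini_tonelli_F _ _ _ _ _ leb f).
  - by move=> y _; apply: integral_ge0.
  - by rewrite lee_fin pi_ge0.
  apply: eq_integral => y _.
  rewrite /f/= ge0_integralZl//; last exact: mI.
  rewrite patchE /k indicE; case: ifPn => _; rewrite ?mul1e ?mul0e ?mule0//.
  by rewrite /abel_mass muleCA.
rewrite (@fubini_tonelli _ _ (measurableTypeR R) (measurableTypeR R) R leb leb f mf f0).
congr (_ * _); apply: eq_integral => x _.
under eq_integral do rewrite /f/= muleA muleC.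
rewrite ge0_integralZl//; last 3 first.
- apply: emeasurable_funM; first exact: mk.
  by apply/measurable_EFinP; exact: measurable_isqrtBl.
- by move=> y _; rewrite mule_ge0 ?lee_fin ?isqrt_ge0.
- exact: radial_mass_ge0.
congr (_ * _); rewrite [RHS]integral_mkcond; apply: eq_integral => y _.
rewrite patchE /k indicE; case: ifPn => _; rewrite ?mul1e ?mul0e//.
by rewrite muleC.
Qed.

End model.

(** * The law of the observations *)

Section law.
Context {R : realType} d0 (T0 : measurableType d0) (P0 : probability T0 R).
Variables (X : {RV P0 >-> (R * R * R)%type}) (Z : {RV P0 >-> R}).
Variables (nu : {sigma_finite_measure set R -> \bar R}) (rho : R * R -> R).
Hypotheses (rho_meas : measurable_fun [set p : R * R | 0 <= p.1 /\ 0 <= p.2] rho)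
  (rho_ge0 : forall x z, 0 <= x -> 0 <= z -> 0 <= rho (x, z))
  (XZ_dens : has_radial_density P0 X Z nu rho).
Local Open Scope ereal_scope.

Definition sqnorm2 (x : R * R) : R := (x.1 ^+ 2 + x.2 ^+ 2)%R.

Lemma measurable_sqnorm2 : measurable_fun setT sqnorm2.
Proof. by apply: measurable_funD; apply: measurable_funX. Qed.

Lemma measurable_norm3 : measurable_fun setT (@norm3 R).
Proof.
apply: (measurableT_comp measurable_sqrt).
apply: measurable_funD; last exact: measurable_funX.
exact: (measurableT_comp measurable_sqnorm2).
Qed.

Lemma law_integral (g : R * R * R * R -> \bar R) :
  measurable_fun setT g -> (forall p, 0 <= g p) ->
  \int[P0]_w g (X w, Z w) =
  \int[((leb \x leb) \x leb) \x nu]_p ((rho0 rho (norm3 p.1, p.2))%:E * g p).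
Proof.
move=> mg g0.
have mphi : measurable_fun setT (fun w => (X w, Z w)).
  exact: measurable_fun_pair.
have mv : measurable_fun setT (fun p : R * R * R * R => rho0 rho (norm3 p.1, p.2)).
  apply: (measurableT_comp (measurable_rho0 rho_meas)).
  apply: measurable_fun_pair => //; exact: (measurableT_comp measurable_norm3).
have := @transfer_integral _ _ T0 _ R P0
  ((leb \x leb) \x leb \x nu : {measure set _ -> \bar R}) (fun w => (X w, Z w))
  (cst 1%R) (fun p => rho0 rho (norm3 p.1, p.2)) mphi _ mv _ _ g _ mg g0.
move=> <-//.
- by apply: eq_integral => w _; rewrite mul1e.
- by move=> p; exact: rho0_ge0.
move=> A mA.
transitivity (P0 [set w | A (X w, Z w)]).
  rewrite -[X in P0 X]setIT -integral_indic//; last first.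
    by rewrite -[X in measurable X]setTI; exact: mphi.
  by apply: eq_integral => w _; rewrite mul1r.
rewrite XZ_dens// [LHS]integral_mkcond; apply: eq_integral => p _.
rewrite patchE indicE.
have [Ap|nAp] := pselect (A p); last first.
  by rewrite (memNset nAp) mulr0 memNset// => -[].
rewrite (mem_set Ap) mulr1; case: ifPn => [|].
  rewrite inE => -[_ [_ /=]]; rewrite in_itv/= andbT => p2.
  by rewrite rho0E// sqrtr_ge0.
rewrite notin_setE => np; rewrite /rho0 patchE memNset// => -[_ /= p2].
by apply: np; split => //; split => //=; rewrite in_itv/= p2.
Qed.

Let layer (y z : R) : \bar R :=
  \int[leb]_x (isqrt (x - y) * (pospart z * rho0 rho (Num.sqrt x, z)))%:E.

Let layer_ge0 y z : 0 <= layer y z.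
Proof.
apply: integral_ge0 => x _.
by rewrite lee_fin !mulr_ge0 ?isqrt_ge0 ?pospart_ge0 ?rho0_ge0.
Qed.

Let measurable_layer : measurable_fun setT (fun p : R * R => layer p.1 p.2).
Proof.
apply: (@measurable_fun_fubini_tonelli_F _ _ (R * R)%type (measurableTypeR R) R leb
  (fun p : R * R * R => (isqrt (p.2 - p.1.1) *
     (pospart p.1.2 * rho0 rho (Num.sqrt p.2, p.1.2)))%:E)).
  apply/measurable_EFinP; apply: measurable_funM.
    apply: (measurableT_comp measurable_isqrt); apply: measurable_funB => //.
    exact: measurableT_comp.
  apply: measurable_funM.
    apply: (measurableT_comp measurable_pospart); exact: measurableT_comp.
  apply: (measurableT_comp (measurable_rho0 rho_meas)).
  apply: measurable_fun_pair; last exact: measurableT_comp.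
  exact: (measurableT_comp measurable_sqrt).
by move=> p; rewrite lee_fin !mulr_ge0 ?isqrt_ge0 ?pospart_ge0 ?rho0_ge0.
Qed.

(** This says that psi(y) dy is the measure E[Z; Y in dy]: integrate the density
    first over R^3 for fixed z, where [integral_R3_radial] produces the Abel kernel,
    then over z. *)
Lemma expectation_abel (h : R -> \bar R) : measurable_fun setT h ->
  (forall y, 0 <= h y) ->
  \int[P0]_w ((pospart (Z w))%:E * h (sqnorm2 (X w).1)) =
  \int[leb]_(y in `]0%R, +oo[) (h y * abel_mass nu rho y).
Proof.
move=> mh h0.
pose g (p : R * R * R * R) := (pospart p.2)%:E * h (sqnorm2 p.1.1).
have mg : measurable_fun setT g.
  apply: emeasurable_funM.
    by apply/measurable_EFinP; exact: (measurableT_comp measurable_pospart).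
  apply: (measurableT_comp mh); apply: (measurableT_comp measurable_sqnorm2).
  exact: measurableT_comp.
have g0 p : 0 <= g p by rewrite mule_ge0// lee_fin pospart_ge0.
rewrite (law_integral mg g0).
pose f (p : R * R * R * R) := (rho0 rho (norm3 p.1, p.2))%:E * g p.
have mf : measurable_fun setT f.
  apply: emeasurable_funM => //; apply/measurable_EFinP.
  apply: (measurableT_comp (measurable_rho0 rho_meas)).
  apply: measurable_fun_pair => //; exact: (measurableT_comp measurable_norm3).
have f0 p : 0 <= f p by rewrite mule_ge0// lee_fin rho0_ge0.
pose k (p : R) := (\1_(`]0%R, +oo[%classic) p)%:E * h p.
have mk : measurable_fun setT k.
  apply: emeasurable_funM => //; apply/measurable_EFinP; exact: measurable_indic.
have k0 p : 0 <= k p by rewrite mule_ge0.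
pose F (p : R * R) := pi%:E * (k p.1 * layer p.1 p.2).
have mF : measurable_fun setT F.
  apply: emeasurable_funM => //; apply: emeasurable_funM => //.
  exact: (measurableT_comp mk).
have F0 p : 0 <= F p by rewrite mule_ge0 ?lee_fin ?pi_ge0// mule_ge0.
transitivity (\int[nu]_z \int[(leb \x leb) \x leb]_q f (q, z)).
  have [m mE] := @sigma_finite_product _ _ (measurableTypeR R) (measurableTypeR R) R leb leb.
  have := @fubini_tonelli2_prod _ _ (measurableTypeR R * measurableTypeR R)%type
    (measurableTypeR R) R m leb _ R nu f mf f0.
  by rewrite mE.
transitivity (\int[nu]_z \int[leb]_y F (y, z)).
  apply: eq_integral => z _.
  pose H (p : R * R) := (pospart z * rho0 rho (Num.sqrt p.2, z))%:E * h p.1.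
  have mH : measurable_fun setT H.
    apply: emeasurable_funM; last exact: (measurableT_comp mh).
    apply/measurable_EFinP; apply: measurable_funM => //.
    apply: (measurableT_comp (measurable_rho0 rho_meas)).
    apply: measurable_fun_pair => //; exact: (measurableT_comp measurable_sqrt).
  have H0 p : 0 <= H p.
    by rewrite mule_ge0// lee_fin mulr_ge0 ?pospart_ge0 ?rho0_ge0.
  have mI y : measurable_fun setT (fun x : R =>
      (isqrt (x - y) * (pospart z * rho0 rho (Num.sqrt x, z)))%:E).
    apply/measurable_EFinP; apply: measurable_funM; first exact: measurable_isqrtB.
    apply: measurable_funM => //.
    apply: (measurableT_comp (measurable_rho0 rho_meas)).
    apply: measurable_fun_pair => //; exact: measurable_sqrt.
  have I0 y x : 0 <= (isqrt (x - y) * (pospart z * rho0 rho (Num.sqrt x, z)))%:E.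
    by rewrite lee_fin !mulr_ge0 ?isqrt_ge0 ?pospart_ge0 ?rho0_ge0.
  have mL : measurable_fun setT (fun y => k y * layer y z).
    apply: emeasurable_funM; first exact: mk.
    exact: (measurableT_comp measurable_layer (measurable_pair2 z)).
  transitivity (\int[(leb \x leb) \x leb]_p H
    ((p.1.1 ^+ 2 + p.1.2 ^+ 2)%R, (p.1.1 ^+ 2 + p.1.2 ^+ 2 + p.2 ^+ 2)%R)).
    by apply: eq_integral => q _; rewrite /f /g /H/= muleA [in RHS]mulrC EFinM.
  rewrite (integral_R3_radial mH H0) /F/= ge0_integralZl//; last 2 first.
  - by move=> y _; rewrite mule_ge0.
  - by rewrite lee_fin pi_ge0.
  congr (_ * _); rewrite [LHS]integral_mkcond; apply: eq_integral => y _.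
  rewrite patchE /k indicE; case: ifPn => _; rewrite ?mul1e ?mul0e//.
  rewrite /layer muleC -ge0_integralZr//; last exact: mI.
  by apply: eq_integral => x _; rewrite /H/= muleA -EFinM.
transitivity (\int[leb]_y \int[nu]_z F (y, z)).
  exact/esym/(@fubini_tonelli _ _ (measurableTypeR R) R R leb nu F mF F0).
rewrite [RHS]integral_mkcond; apply: eq_integral => y _.
rewrite /F/= patchE ge0_integralZl//; last 3 first.
- apply: emeasurable_funM => //.
  exact: (measurableT_comp measurable_layer (measurable_pair1 y)).
- by move=> z _; rewrite mule_ge0.
- by rewrite lee_fin pi_ge0.
rewrite ge0_integralZl//; last exact: (measurableT_comp measurable_layer (measurable_pair1 y)).
rewrite /layer (mass_swap nu rho_meas rho_ge0).
rewrite /k indicE; case: ifPn => _; rewrite ?mul1e ?mul0e ?mule0//.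
by rewrite /abel_mass muleCA.
Qed.

End law.

(** * An exponential inequality *)

(** Since 1 - y / 2 <= exp(- y / 2), exp y <= (1 - y / 2)^-2; the rest is
    algebra. *)
Lemma expR_le_quadratic (R : realType) (y : R) : y <= 1 / 3 ->
  expR y <= 1 + y + y ^+ 2.
Proof.
move=> y3.
have h : 1 - y / 2 <= expR (- (y / 2)) by exact: expR_ge1Dx.
have p : 0 < 1 - y / 2 by lra.
have e : expR y = (expR (- (y / 2)) ^+ 2)^-1.
  by rewrite -expRM_natl -expRN; congr expR; field.
rewrite e -[leRHS]invrK lef_pV2 ?posrE ?exprn_gt0 ?expR_gt0 ?invr_gt0//; last first.
  by have := sqr_ge0 (y + 1 / 2); rewrite !expr2; nra.
apply: (@le_trans _ _ ((1 - y / 2) ^+ 2)); last first.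
  by rewrite ler_pXn2r// nnegrE ltW// expR_gt0.
have q : 0 < 1 + y + y ^+ 2 by have := sqr_ge0 (y + 1 / 2); rewrite !expr2; nra.
rewrite -[leLHS]mul1r ler_pdivrMr// -subr_ge0.
have -> : (1 - y / 2) ^+ 2 * (1 + y + y ^+ 2) - 1 =
    y ^+ 2 / 4 * (1 - 3 * y + y ^+ 2) by field.
by rewrite mulr_ge0 ?divr_ge0 ?sqr_ge0//; have := sqr_ge0 y; lra.
Qed.

Section chernoff.
Context {R : realType} d (T : measurableType d) (P : probability T R).
Context d' (T' : measurableType d') (L : probability T' R).
Variable S : nat -> {RV P >-> T'}.
Hypotheses (S_indep : mutually_independent S)
  (S_law : forall i A, measurable A -> P (S i @^-1` A) = L A).

Let indic_prod (n : nat) (A : nat -> set T') (w : T) :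
  \prod_(i < n) (\1_(A i) (S i w) : R) =
  \1_(\bigcap_(j in [set` iota 0 n]) (S j @^-1` A j)) w.
Proof.
rewrite indicE; have [h|h] := pselect
    ((\bigcap_(j in [set` iota 0 n]) (S j @^-1` A j)) w).
  rewrite (mem_set h) big1// => i _; rewrite indicE mem_set//.
  by apply: h; rewrite /= mem_iota add0n leq0n/=.
rewrite (memNset h).
have [i [iA Ai]] : exists i : 'I_n, True /\ ~ A i (S i w).
  apply: contrapT => /forallNP H; apply: h => j/=.
  rewrite mem_iota add0n leq0n/= => jn; apply: contrapT => nA.
  by apply: (H (Ordinal jn)); split.
by rewrite (bigD1 i)//= indicE (memNset Ai) mul0r.
Qed.

(** Independence is given for events.  It passes to products of a bounded function
    by replacing the indicators of events with u one index at a time, each time by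
    the transfer of integrals from indicators to functions. *)
Lemma independent_product (u : T' -> R) (B : R) (n : nat) :
  measurable_fun setT u -> (forall p, 0 <= u p <= B) ->
  (\int[P]_w (\prod_(i < n) u (S i w))%:E =
   (fine (\int[L]_p (u p)%:E) ^+ n)%:E)%E.
Proof.
move=> mu uB.
have u0 p : 0 <= u p by have /andP[] := uB p.
pose e := fine (\int[L]_p (u p)%:E)%E.
have ufin : (\int[L]_p (u p)%:E)%E \is a fin_num.
  rewrite ge0_fin_numE; last by apply: integral_ge0 => p _; rewrite lee_fin.
  apply: (@le_lt_trans _ _ (\int[L]_p B%:E)%E).
    apply: ge0_le_integral => //.
    - by move=> p _; rewrite lee_fin.
    - exact/measurable_EFinP.
    - by move=> p _; rewrite lee_fin; have /andP[] := uB p.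
  rewrite integral_cst// [X in (_ * X)%E](_ : _ = 1%E) ?mule1 ?ltry//.
  exact: probability_setT.
have e0 : 0 <= e by apply: fine_ge0; apply: integral_ge0 => p _; rewrite lee_fin.
pose g k (A : nat -> set T') i : T' -> R := if (i < k)%N then u else \1_(A i).
pose f k (A : nat -> set T') i : R := if (i < k)%N then e else fine (L (A i)).
have g0 k A i p : 0 <= g k A i p by rewrite /g; case: ifP => // _; rewrite indicE.
have f0 k A i : 0 <= f k A i by rewrite /f; case: ifP => // _; exact: fine_ge0.
have mg k A i : measurable (A i) -> measurable_fun setT (g k A i).
  by move=> mA; rewrite /g; case: ifP => // _; exact: measurable_indic.
suff Q k : (k <= n)%N -> forall A, (forall i, measurable (A i)) ->
    (\int[P]_w (\prod_(i < n) g k A i (S i w))%:E = (\prod_(i < n) f k A i)%:E)%E.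
  have := Q n (leqnn n) (fun=> setT) (fun=> measurableT).
  have -> : \prod_(i < n) f n (fun=> setT) i = e ^+ n.
    rewrite -[in RHS](card_ord n) -prodr_const; apply: eq_bigr => i _.
    by rewrite /f ltn_ord.
  by under eq_integral do under eq_bigr do rewrite /g ltn_ord.
elim: k => [_|k IH kn] A mA.
  rewrite /g /f.
  under eq_integral do rewrite /= indic_prod.
  rewrite integral_indic//; last first.
    apply: fin_bigcap_measurable => [|j _]; first exact: finite_seq.
   by rewrite -[X in measurable X]setTI; apply: measurable_funP.
  rewrite setIT; apply: etrans (S_indep (iota_uniq 0 n) mA) _.
  rewrite -[X in iota _ X]subn0 -/(index_iota 0 n) big_mkord.
  rewrite (big_morph EFin EFinM erefl); apply: eq_bigr => i _.
  by rewrite S_law//= fineK// fin_num_measure.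
have kn' := ltnW kn.
pose c := \prod_(i < n | i != Ordinal kn) f k A i.
have c0 : 0 <= c by apply: prodr_ge0 => i _.
have gk (i : 'I_n) : i != Ordinal kn -> (i < k.+1)%N = (i < k)%N.
  by move=> ik; rewrite ltnS leq_eqVlt; case: eqP => // h; move: ik; rewrite -val_eqE/= h eqxx.
pose w0 w := \prod_(i < n | i != Ordinal kn) g k A i (S i w).
have mw0 : measurable_fun setT w0.
  rewrite /w0; under eq_fun do rewrite big_mkcond.
  apply: measurable_prod => i _; case: (i != Ordinal kn) => //.
  by apply: (measurableT_comp (mg k A i (mA i))).
have ne (i : 'I_n) : i != Ordinal kn -> (nat_of_ord i == k) = false.
  by move=> ik; apply/negbTE; apply: contra ik; rewrite -val_eqE.
have key : forall D, measurable D ->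
    (\int[P]_w (w0 w * \1_D (S k w))%:E = \int[L]_p (cst c p * \1_D p)%:E)%E.
  move=> D mD.
  pose A' i := if i == k then D else A i.
  have mA' i : measurable (A' i) by rewrite /A'; case: ifP.
  have := IH kn' A' mA'.
  rewrite (bigD1 (Ordinal kn))//=.
  rewrite {1}/f ltnn /A' eqxx (eq_bigr (fun i : 'I_n => f k A i)); last first.
    by move=> i ik; rewrite /f (ne _ ik).
  rewrite -/c => h.
  transitivity ((fine (L D) * c)%:E); last first.
    under eq_integral do rewrite EFinM.
    rewrite ge0_integralZl_EFin//; last exact/measurable_EFinP/measurable_indic.
    by rewrite integral_indic// setIT EFinM fineK ?fin_num_measure// muleC.
  rewrite -h; apply: eq_integral => w _; congr EFin.
  rewrite (bigD1 (Ordinal kn))//= {1}/g ltnn eqxx mulrC; congr (_ * _).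
  by apply: eq_bigr => i ik; rewrite /g (ne _ ik).
have := @transfer_integral _ _ T T' R P L (S k) w0 (cst c) _ mw0 _ _ _
   (EFin \o u) key _ _.
have -> : (\int[P]_w (\prod_(i < n) g k.+1 A i (S i w))%:E =
    \int[P]_w ((w0 w)%:E * (EFin \o u) (S k w)))%E.
  apply: eq_integral => w _; rewrite (bigD1 (Ordinal kn))//= -EFinM mulrC.
  rewrite {2}/g ltnSn; congr (_ * _)%:E.
  by apply: eq_bigr => i ik; rewrite /g gk.
move=> ->//.
- rewrite ge0_integralZl_EFin//.
  + rewrite (bigD1 (Ordinal kn))//= {1}/f ltnSn EFinM muleC /e fineK//.
    by congr (_ * _%:E)%E; apply: eq_bigr => i ik; rewrite /f gk.
  + by move=> p _; rewrite lee_fin.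
  + exact/measurable_EFinP.
- by move=> w; apply: prodr_ge0.
- exact/measurable_EFinP.
Qed.

(** Markov's inequality for exp(lam sum g), with
    E exp(lam g) <= 1 + lam E g + lam^2 v <= exp(lam E g + lam^2 v).  The quadratic
    estimate of the exponential asks for an upper bound on lam g, and lam is free:
    it will be matched to the scale of g. *)
Lemma chernoff_upper (g : T' -> R) (lam v x B : R) (n : nat) :
  measurable_fun setT g -> 0 <= lam -> (forall p, `|g p| <= B) ->
  (forall p, lam * g p <= 1 / 3) ->
  (\int[L]_p ((g p) ^+ 2)%:E <= v%:E)%E ->
  (P [set w | (n%:R * (fine (\int[L]_p (g p)%:E)%E + x) < \sum_(i < n) g (S i w))%R]
   <= (expR (n%:R * (lam ^+ 2 * v - lam * x)))%:E)%E.
Proof.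
move=> mg lam0 gB lg gv.
set m := fine _.
pose u p := expR (lam * g p).
have mu : measurable_fun setT u.
  by apply: measurableT_comp => //; exact: measurable_funM.
have mg2 : measurable_fun setT (fun p => g p ^+ 2) by exact: measurable_funX.
have uB p : 0 <= u p <= expR (lam * B).
  by rewrite expR_ge0/= ler_expR ler_wpM2l// (le_trans (ler_norm _)).
have u0 p : 0 <= u p by exact: expR_ge0.
have ig : L.-integrable setT (EFin \o g).
  apply: (@le_integrable _ _ _ L setT _ _ (cst B%:E)) => //.
  - exact/measurable_EFinP.
  - by move=> p _ /=; rewrite lee_fin (le_trans (gB p))// ler_norm.
  - exact: finite_measure_integrable_cst.
have mE : (\int[L]_p (g p)%:E)%E = m%:E.
  by rewrite /m fineK//; exact: integrable_fin_num.
have ig2 : L.-integrable setT (EFin \o (fun p => g p ^+ 2)).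
  apply: (@le_integrable _ _ _ L setT _ _ (cst (B ^+ 2)%:E)) => //.
  - exact/measurable_EFinP.
  - move=> p _ /=; rewrite lee_fin normrX (le_trans _ (ler_norm _))//.
    by rewrite ler_pXn2r// nnegrE// (le_trans _ (gB p)).
  - exact: finite_measure_integrable_cst.
have uI : (\int[L]_p (u p)%:E <= (expR (lam * m + lam ^+ 2 * v))%:E)%E.
  apply: (@le_trans _ _ (\int[L]_p ((1 + lam * g p)%:E + (lam ^+ 2 * g p ^+ 2)%:E))%E).
    apply: ge0_le_integral => //.
    - by move=> p _; rewrite lee_fin.
    - exact/measurable_EFinP.
    - apply: emeasurable_funD; apply/measurable_EFinP.
        by apply: measurable_funD => //; exact: measurable_funM.
      exact: measurable_funM.
    - by move=> p _; rewrite -EFinD lee_fin -exprMn; exact: expR_le_quadratic.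
  have i1 : L.-integrable setT (EFin \o (fun p => lam * g p)).
    by rewrite (_ : _ \o _ = (fun p => lam%:E * (g p)%:E)%E)//; exact: integrableZl.
  have i2 : L.-integrable setT (EFin \o (fun p => lam ^+ 2 * g p ^+ 2)).
    by rewrite (_ : _ \o _ = (fun p => (lam ^+ 2)%:E * (g p ^+ 2)%:E)%E)//; exact: integrableZl.
  have i0 : L.-integrable setT (cst (1 : R)%:E) by exact: finite_measure_integrable_cst.
  have i3 : L.-integrable setT (fun p => (1 + lam * g p)%:E).
    have := integrableD measurableT i0 i1.
    by apply: eq_integrable => // p _; rewrite /= EFinD.
  rewrite integralD//.
  rewrite (_ : \int[L]_p (1 + lam * g p)%:E = 1 + lam%:E * m%:E)%E; last first.
    under eq_integral do rewrite EFinD.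
    rewrite integralD// integral_cst// [X in (_ * X + _)%E](_ : _ = 1%E) ?mule1; last exact: probability_setT.
    by under eq_integral do rewrite EFinM; rewrite integralZl// mE.
  under eq_integral do rewrite EFinM.
  rewrite integralZl//.
  apply: (@le_trans _ _ (1 + lam%:E * m%:E + (lam ^+ 2)%:E * v%:E)%E).
    by rewrite leeD2l// lee_wpmul2l// lee_fin sqr_ge0.
  rewrite -!EFinM -!EFinD lee_fin -addrA; exact: expR_ge1Dx.
pose a := expR (- (lam * (n%:R * (m + x)))).
set A := [set w | _].
have mgS i : measurable_fun setT (fun w => g (S i w)) by exact: measurableT_comp.
have mA : measurable A.
  rewrite (_ : A = (fun w => \sum_(i < n) g (S i w)) @^-1` `]n%:R * (m + x), +oo[).
    by rewrite -[X in measurable X]setTI; apply: measurable_sum.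
  by apply/seteqP; split => w; rewrite /A/= in_itv/= andbT.
rewrite -[A]setIT -integral_indic//.
apply: (@le_trans _ _ (\int[P]_w (a%:E * (\prod_(i < n) u (S i w))%:E))%E).
  apply: ge0_le_integral => //.
  - exact/measurable_EFinP/measurable_indic.
  - apply/measurable_EFinP; apply: measurable_funM => //; apply: measurable_prod => i _.
    exact: (measurableT_comp mu).
  - move=> w _; rewrite -EFinM lee_fin.
    have -> : a * \prod_(i < n) u (S i w) =
        expR (lam * (\sum_(i < n) g (S i w) - n%:R * (m + x))).
      by rewrite mulrBr expRB mulr_sumr expR_sum mulrC /a expRN.
    rewrite indicE; have [Aw|nAw] := pselect (A w).
      rewrite mem_set//= -[leLHS]expR0 ler_expR mulr_ge0// subr_ge0; exact: ltW.
    by rewrite memNset// expR_ge0.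
rewrite ge0_integralZl_EFin ?expR_ge0//; last 2 first.
- by move=> w _; rewrite lee_fin; apply: prodr_ge0.
- apply/measurable_EFinP; apply: measurable_prod => i _.
  exact: (measurableT_comp mu).
rewrite (independent_product n mu uB) -EFinM lee_fin.
have u1 : fine (\int[L]_p (u p)%:E)%E <= expR (lam * m + lam ^+ 2 * v).
  rewrite -lee_fin fineK// ge0_fin_numE; last by apply: integral_ge0 => p _; rewrite lee_fin.
  by rewrite (le_lt_trans uI)// ltry.
have u2 : 0 <= fine (\int[L]_p (u p)%:E)%E.
  by apply: fine_ge0; apply: integral_ge0 => p _; rewrite lee_fin.
apply: (@le_trans _ _ (a * expR (lam * m + lam ^+ 2 * v) ^+ n)).
  by rewrite ler_wpM2l ?expR_ge0// lerXn2r// nnegrE// expR_ge0.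
rewrite -expRM_natl -expRD ler_expR le_eqVlt; apply/orP; left; apply/eqP; ring.
Qed.

End chernoff.

(** * The remainder of a truncated expansion of the square root *)

Section taylor.
Context {R : realType}.
Implicit Types a h t H delta : R.

Lemma sqrt_holder (x y : R) : `|Num.sqrt x - Num.sqrt y| <= Num.sqrt `|x - y|.
Proof.
wlog xy : x y / y <= x.
  move=> W; have [/W//|/ltW/W] := leP y x.
  by rewrite distrC [in X in _ <= Num.sqrt X]distrC.
have sxy : Num.sqrt y <= Num.sqrt x by exact: ler_wsqrtr.
rewrite ger0_norm ?subr_ge0// (ger0_norm (x := x - y)) ?subr_ge0// lerBlDr.
have [y0|y0] := leP y 0.
  by rewrite (ler0_sqrtr y0) addr0 ler_wsqrtr// lerDl oppr_ge0.
have x0 : 0 <= x by rewrite (le_trans (ltW y0)).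
have ge0 : 0 <= Num.sqrt (x - y) + Num.sqrt y by rewrite addr_ge0 ?sqrtr_ge0.
rewrite -(ger0_norm ge0) -sqrtr_sqr ler_wsqrtr// sqrrD !sqr_sqrtr ?subr_ge0// ?(ltW y0)//.
have : 0 <= Num.sqrt (x - y) * Num.sqrt y by rewrite mulr_ge0 ?sqrtr_ge0.
by move=> h; rewrite mulr2n; lra.
Qed.

Definition trunc_isqrt delta a : R := isqrt a * (delta < a)%R%:R.

(** With a = y - t and h = s - t this is W / z: the increment of
    2 (sqrt y - sqrt (y - x)_+) from x = t to x = s, less its linear part.  The
    derivative 1 / sqrt a is cut off below delta, where it is too large to have a
    useful second moment. *)
Definition remainder delta h a : R :=
  2 * (Num.sqrt a - Num.sqrt (a - h)) - h * trunc_isqrt delta a.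

Lemma trunc_isqrt_bound delta a : 0 < delta ->
  0 <= trunc_isqrt delta a <= isqrt delta.
Proof.
move=> d0; rewrite /trunc_isqrt; have [da|ad] := ltP delta a; last first.
  by rewrite mulr0 lexx isqrt_ge0.
rewrite mulr1 isqrt_ge0/= /isqrt lef_pV2 ?posrE ?sqrtr_gt0//; last exact: lt_trans da.
by rewrite ler_wsqrtr// ltW.
Qed.

Lemma remainder_left delta h a H : 0 < delta -> delta <= H -> `|h| <= H ->
  a < - H -> remainder delta h a = 0.
Proof.
move=> d0 dH hH aH; have := ler_norml h H; rewrite hH => /esym/andP[h1 h2].
have a0 : a <= 0 by lra.
have ah0 : a - h <= 0 by lra.
rewrite /remainder /trunc_isqrt (ler0_sqrtr a0) (ler0_sqrtr ah0) (isqrt_le0 a0).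
by rewrite !(subr0, mul0r, mulr0).
Qed.

(** Without any expansion: each of the two parts is at most a constant times
    H / sqrt delta, the first by Hoelder continuity of the square root. *)
Lemma remainder_middle delta h a H : 0 < delta -> delta <= H -> `|h| <= H ->
  `|remainder delta h a| <= 3 * (H * isqrt delta).
Proof.
move=> d0 dH hH.
have sd0 : 0 < Num.sqrt delta by rewrite sqrtr_gt0.
have H0 : 0 < H by exact: lt_le_trans dH.
have sH : Num.sqrt H <= H * isqrt delta.
  rewrite /isqrt ler_pdivlMr// -{2}(sqr_sqrtr (ltW H0)) expr2.
  by rewrite ler_wpM2l ?sqrtr_ge0// ler_wsqrtr.
have /andP[t0 t1] := trunc_isqrt_bound a d0.
rewrite /remainder (le_trans (ler_normB _ _))//.
rewrite [leRHS](_ : _ = 2 * (H * isqrt delta) + H * isqrt delta); last by ring.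
apply: lerD.
  rewrite normrM (ger0_norm (x := 2))// ler_wpM2l//.
  apply: le_trans (sqrt_holder _ _) _; apply: le_trans sH.
  by rewrite ler_wsqrtr// opprB addrCA subrr addr0.
by rewrite normrM (ger0_norm t0) ler_pM.
Qed.

(** With p = sqrt a and q = sqrt (a - h) the remainder is exactly (p - q)^2 / p, and
    (p - q)^2 p^2 <= (p^2 - q^2)^2 = h^2. *)
Lemma remainder_right delta h a H : 0 < delta -> delta <= H -> `|h| <= H ->
  H < a -> `|remainder delta h a| <= H ^+ 2 * isqrt a ^+ 3.
Proof.
move=> d0 dH hH Ha; have := ler_norml h H; rewrite hH => /esym/andP[h1 h2].
have a0 : 0 < a by lra.
have ah0 : 0 < a - h by lra.
rewrite /remainder /trunc_isqrt (le_lt_trans dH Ha) mulr1 /isqrt.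
set p := Num.sqrt a; set q := Num.sqrt (a - h).
have p0 : 0 < p by rewrite sqrtr_gt0.
have q0 : 0 < q by rewrite sqrtr_gt0.
have hE : h = p ^+ 2 - q ^+ 2 by rewrite !sqr_sqrtr ?(ltW a0) ?(ltW ah0)//; ring.
have -> : 2 * (p - q) - h * p^-1 = (p - q) ^+ 2 / p.
  by rewrite hE; field; rewrite gt_eqF.
rewrite ger0_norm ?divr_ge0 ?sqr_ge0 ?(ltW p0)//.
rewrite [leRHS](_ : _ = (H ^+ 2 / p ^+ 2) / p); last by field; rewrite gt_eqF.
rewrite ler_wpM2r ?invr_ge0 ?(ltW p0)// ler_pdivlMr ?exprn_gt0//.
have pq : (p - q) ^+ 2 * p ^+ 2 <= h ^+ 2.
  rewrite hE subr_sqr exprMn ler_wpM2l ?sqr_ge0//.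
  by rewrite ler_pXn2r ?nnegrE ?addr_ge0 ?(ltW p0) ?(ltW q0)// lerDl ltW.
apply: (le_trans pq); rewrite -(real_normK (num_real h)).
by rewrite ler_pXn2r ?nnegrE// (le_trans _ hH).
Qed.

Lemma remainder_bound delta h a H : 0 < delta -> delta <= H -> `|h| <= H ->
  remainder delta h a ^+ 2 <=
  9 * (H ^+ 2 / delta) * (`|a| <= H)%R%:R + H ^+ 4 * (a ^- 3 * (H < a)%R%:R).
Proof.
move=> d0 dH hH.
have H0 : 0 < H by exact: lt_le_trans dH.
have [aH|Ha] := ltP a (- H).
  rewrite (remainder_left d0 dH hH aH) expr0n/=; apply: addr_ge0.
    by apply: mulr_ge0 => //; apply: mulr_ge0 => //; rewrite divr_ge0 ?sqr_ge0 ?(ltW d0).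
  have aH' : a < H by rewrite (lt_trans aH)// gtrN.
  by rewrite (lt_gtF aH') !mulr0.
have [Ha'|aH] := ltP H a.
  have a0 : 0 < a by exact: lt_trans Ha'.
  have -> : (`|a| <= H) = false by apply/negbTE; rewrite -ltNge ltr_normr Ha'.
  rewrite mulr0 add0r mulr1.
  have := remainder_right d0 dH hH Ha' => h1.
  rewrite -(real_normK (num_real (remainder _ _ _))).
  have h2 : `|remainder delta h a| ^+ 2 <= (H ^+ 2 * isqrt a ^+ 3) ^+ 2.
    by rewrite ler_pXn2r ?nnegrE// mulr_ge0 ?sqr_ge0// exprn_ge0// isqrt_ge0.
  apply: (le_trans h2); rewrite exprMn -!exprM le_eqVlt; apply/orP; left.
  rewrite /isqrt exprVn; apply/eqP; congr (_ * _^-1).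
  by rewrite (exprM _ 2 3) sqr_sqrtr// ltW.
have -> : (`|a| <= H) by rewrite ler_norml Ha.
rewrite !mulr0 addr0 mulr1 -(real_normK (num_real (remainder _ _ _))).
have := remainder_middle a d0 dH hH => h1.
have h2 : `|remainder delta h a| ^+ 2 <= (3 * (H * isqrt delta)) ^+ 2.
  by rewrite ler_pXn2r ?nnegrE// !mulr_ge0 ?isqrt_ge0 ?(ltW H0).
apply: (le_trans h2); rewrite !exprMn /isqrt exprVn sqr_sqrtr ?(ltW d0)//.
by rewrite le_eqVlt; apply/orP; left; apply/eqP; ring.
Qed.

End taylor.

(** * Moments and deviations *)

Section moments.
Context {R : realType}.

Lemma measurable_gt_nat (c : R) : measurable_fun setT (fun u : R => (c < u)%R%:R : R).
Proof.
rewrite (_ : (fun _ => _) = \1_(`]c, +oo[%classic)); first exact: measurable_indic.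
by apply/funext => u; rewrite indicE mem_setE ?in_itv/= andbT.
Qed.

Lemma measurable_norm_le_nat (c : R) :
  measurable_fun setT (fun u : R => (`|u| <= c)%R%:R : R).
Proof.
rewrite (_ : (fun _ => _) = \1_(`[- c, c]%classic)); first exact: measurable_indic.
by apply/funext => u; rewrite indicE mem_setE ?in_itv/= ler_norml.
Qed.

Lemma measurable_trunc_isqrt (delta : R) : measurable_fun setT (trunc_isqrt delta).
Proof. by apply: measurable_funM; [exact: measurable_isqrt|exact: measurable_gt_nat]. Qed.

Lemma measurable_remainder (delta h : R) : measurable_fun setT (remainder delta h).
Proof.
apply: measurable_funB; last first.
  by apply: measurable_funM => //; exact: measurable_trunc_isqrt.
apply: measurable_funM => //; apply: measurable_funB; first exact: measurable_sqrt.
apply: (measurableT_comp measurable_sqrt); exact: measurable_funB.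
Qed.

Lemma measurable_inv_cube (h : R) : 0 <= h ->
  measurable_fun setT (fun a : R => a ^- 3 * (h < a)%R%:R : R).
Proof.
move=> h0.
rewrite (_ : (fun _ => _) = (fun a => isqrt a ^+ 6 * (h < a)%R%:R)).
  apply: measurable_funM; last exact: measurable_gt_nat.
  by apply: measurable_funX; exact: measurable_isqrt.
apply/funext => a; have [ha|] := ltP h a; last by rewrite !mulr0.
rewrite !mulr1 /isqrt exprVn (exprM _ 2 3) sqr_sqrtr//.
by rewrite (le_trans h0)// ltW.
Qed.

Context d (T : measurableType d) (L : probability T R).
Variables (a z : T -> R) (M C : R).
Hypotheses (ma : measurable_fun setT a) (mz : measurable_fun setT z)
  (M0 : 0 < M) (zM : forall p, 0 <= z p <= M) (C0 : 0 <= C)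
  (conc : forall r, 0 < r ->
    (\int[L]_p (z p * (`|a p| <= r)%R%:R)%:E <= (C * r)%:E)%E).

Let z0 p : 0 <= z p. Proof. by have /andP[] := zM p. Qed.

Let inv_cube_ge0 h u : 0 < h -> 0 <= (u ^- 3 * (h < u)%R%:R : R).
Proof.
move=> h0; have [hu|] := ltP h u; last by rewrite mulr0.
by rewrite mulr1 invr_ge0 exprn_ge0// (le_trans (ltW h0))// ltW.
Qed.

Let mcube h : 0 < h ->
  measurable_fun setT (fun p => z p * (a p ^- 3 * (h < a p)%R%:R)).
Proof.
move=> h0; apply: measurable_funM => //.
exact: (measurableT_comp (measurable_inv_cube (ltW h0))).
Qed.

Let mconc r : measurable_fun setT (fun p => z p * (`|a p| <= r)%R%:R).
Proof.
by apply: measurable_funM => //; exact: (measurableT_comp (measurable_norm_le_nat r)).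
Qed.

(** Doubling h costs the mass of the shell h < a <= 2 h, at most 2 C h, times
    h^-3; these costs form a geometric series with sum below 3 C / h^2.  After N
    doublings the crude bound M / (2^N h)^3 remains. *)
Let inv_cube_moment_dyadic (N : nat) (h : R) : 0 < h ->
  (\int[L]_p (z p * (a p ^- 3 * (h < a p)%R%:R))%:E <=
   (3 * C / h ^+ 2 + M / (2 ^+ N * h) ^+ 3)%:E)%E.
Proof.
elim: N h => [|N IH] h h0.
  apply: (@le_trans _ _ (\int[L]_p (M / h ^+ 3)%:E)%E).
    apply: ge0_le_integral => //.
    - by move=> p _; rewrite lee_fin mulr_ge0// inv_cube_ge0.
    - by apply/measurable_EFinP; exact: mcube.
    - move=> p _; rewrite lee_fin; have /andP[_ zpM] := zM p.
      apply: ler_pM => //; first exact: inv_cube_ge0.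
      have [hu|_] := ltP h (a p); last by rewrite mulr0 invr_ge0 exprn_ge0 ?ltW.
      have a0 : 0 < a p by exact: lt_trans hu.
      by rewrite mulr1 lef_pV2 ?posrE ?exprn_gt0// ler_pXn2r ?nnegrE ?(ltW h0) ?(ltW a0)// ltW.
  rewrite integral_cst// [X in (_ * X)%E](_ : _ = 1%E); last exact: probability_setT.
  rewrite mule1 lee_fin expr0 mul1r lerDr.
  by apply: divr_ge0; [exact: mulr_ge0|exact: sqr_ge0].
have h2 : 0 < 2 * h by rewrite mulr_gt0.
apply: (@le_trans _ _ (\int[L]_p ((h ^- 3 * (z p * (`|a p| <= 2 * h)%R%:R))%:E +
   (z p * (a p ^- 3 * (2 * h < a p)%R%:R))%:E))%E).
  apply: ge0_le_integral => //.
  - by move=> p _; rewrite lee_fin mulr_ge0// inv_cube_ge0.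
  - by apply/measurable_EFinP; exact: mcube.
  - apply: emeasurable_funD; apply/measurable_EFinP; last exact: mcube.
    by apply: measurable_funM => //; exact: mconc.
  - move=> p _; rewrite -EFinD lee_fin [X in _ <= X + _]mulrCA -mulrDr ler_wpM2l//.
    have [hu|_] := ltP h (a p); last first.
      rewrite mulr0 addr_ge0 ?inv_cube_ge0// mulr_ge0// invr_ge0 exprn_ge0//.
      exact: ltW.
    have a0 : 0 < a p by exact: lt_trans hu.
    have [h2u|uh2] := ltP (2 * h) (a p).
      by rewrite !mulr1 lerDr mulr_ge0// invr_ge0 exprn_ge0// ltW.
    rewrite mulr0 addr0 (gtr0_norm a0) uh2 !mulr1 lef_pV2 ?posrE ?exprn_gt0//.
    by rewrite ler_pXn2r ?nnegrE ?(ltW h0) ?(ltW a0)// ltW.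
rewrite ge0_integralD//; last 4 first.
- by move=> p _; rewrite lee_fin !mulr_ge0// invr_ge0 exprn_ge0// ltW.
- by apply/measurable_EFinP; apply: measurable_funM => //; exact: mconc.
- by move=> p _; rewrite lee_fin mulr_ge0// inv_cube_ge0.
- by apply/measurable_EFinP; exact: mcube.
apply: (@le_trans _ _ ((h ^- 3 * (C * (2 * h)))%:E +
    (3 * C / (2 * h) ^+ 2 + M / (2 ^+ N * (2 * h)) ^+ 3)%:E)%E).
  apply: leeD; last exact: IH.
  under eq_integral do rewrite EFinM.
  rewrite ge0_integralZl_EFin//; last 3 first.
  - by move=> p _; rewrite lee_fin mulr_ge0.
  - by apply/measurable_EFinP; exact: mconc.
  - by rewrite invr_ge0 exprn_ge0// ltW.
  by rewrite EFinM lee_wpmul2l ?conc// lee_fin invr_ge0 exprn_ge0// ltW.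
rewrite -EFinD lee_fin addrA.
have -> : 2 ^+ N * (2 * h) = 2 ^+ N.+1 * h by rewrite exprS; ring.
rewrite lerD2r -subr_ge0.
have -> : 3 * C / h ^+ 2 - (h ^- 3 * (C * (2 * h)) + 3 * C / (2 * h) ^+ 2) =
    C / (4 * h ^+ 2) by field; rewrite gt_eqF.
by apply: divr_ge0 => //; apply: mulr_ge0 => //; exact: sqr_ge0.
Qed.

Lemma inv_cube_moment (h : R) : 0 < h ->
  (\int[L]_p (z p * (a p ^- 3 * (h < a p)%R%:R))%:E <= ((3 * C + 1) / h ^+ 2)%:E)%E.
Proof.
move=> h0.
pose N := Num.bound (M / h).
have hN : M / h <= 2 ^+ N.
  have h1 : M / h < N%:R by rewrite /N archi_boundP// divr_ge0 ?ltW.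
  rewrite (le_trans (ltW h1))// -natrX ler_nat ltnW//; exact: ltn_expl.
apply: (le_trans (inv_cube_moment_dyadic N h0)).
rewrite lee_fin [leRHS]mulrDl lerD2l.
have p1 : 1 <= 2 ^+ N :> R by rewrite exprn_ege1// ler1n.
have p0 : 0 < 2 ^+ N :> R by rewrite exprn_gt0.
rewrite ler_pdivrMr ?exprn_gt0 ?mulr_gt0//.
have -> : 1 / h ^+ 2 * (2 ^+ N * h) ^+ 3 = (2 ^+ N) ^+ 3 * h by field; rewrite gt_eqF.
rewrite -ler_pdivrMr// (le_trans hN)// -[leLHS]mul1r exprSr ler_wpM2r ?(ltW p0)//.
by rewrite exprn_ege1.
Qed.

(** The zone |a| <= H contributes its mass C H times H^2 / delta; beyond it
    [remainder_right] and the inverse cubic moment give H^4 / H^2, which is smaller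
    because delta <= H. *)
Lemma remainder_moment (delta h H : R) : 0 < delta -> delta <= H -> `|h| <= H ->
  (\int[L]_p ((z p * remainder delta h (a p)) ^+ 2)%:E <=
   (M * (12 * C + 1) * (H ^+ 3 / delta))%:E)%E.
Proof.
move=> d0 dH hH.
have H0 : 0 < H by exact: lt_le_trans dH.
have Hd0 : 0 <= M * (9 * (H ^+ 2 / delta)).
  by rewrite mulr_ge0 ?(ltW M0)// mulr_ge0// divr_ge0 ?sqr_ge0 ?(ltW d0).
have MH0 : 0 <= M * H ^+ 4 by rewrite mulr_ge0 ?exprn_ge0 ?ltW.
apply: (@le_trans _ _ (\int[L]_p
   ((M * (9 * (H ^+ 2 / delta)) * (z p * (`|a p| <= H)%R%:R))%:E +
   (M * H ^+ 4 * (z p * (a p ^- 3 * (H < a p)%R%:R)))%:E))%E).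
  apply: ge0_le_integral => //.
  - by move=> p _; rewrite lee_fin sqr_ge0.
  - apply/measurable_EFinP; apply: measurable_funX; apply: measurable_funM => //.
    exact: (measurableT_comp (measurable_remainder _ _)).
  - apply: emeasurable_funD; apply/measurable_EFinP; apply: measurable_funM => //.
    exact: mcube.
  - move=> p _; rewrite -EFinD lee_fin exprMn.
    have /andP[_ zpM] := zM p.
    apply: (@le_trans _ _ ((M * z p) * remainder delta h (a p) ^+ 2)).
      by rewrite ler_wpM2r ?sqr_ge0// expr2 ler_wpM2r.
    have := remainder_bound (a p) d0 dH hH => /(ler_wpM2l (mulr_ge0 (ltW M0) (z0 p))).
    move=> h1; apply: (le_trans h1); rewrite le_eqVlt; apply/orP; left.
    by apply/eqP; ring.
rewrite ge0_integralD//; last 4 first.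
- by move=> p _; rewrite lee_fin mulr_ge0// mulr_ge0.
- by apply/measurable_EFinP; apply: measurable_funM => //; exact: mconc.
- by move=> p _; rewrite lee_fin mulr_ge0// mulr_ge0// inv_cube_ge0.
- by apply/measurable_EFinP; apply: measurable_funM => //; exact: mcube.
under eq_integral do rewrite EFinM.
rewrite ge0_integralZl_EFin//; last 2 first.
- by move=> p _; rewrite lee_fin mulr_ge0.
- by apply/measurable_EFinP; exact: mconc.
under [X in (_ + X)%E]eq_integral do rewrite EFinM.
rewrite ge0_integralZl_EFin//; last 2 first.
- by move=> p _; rewrite lee_fin mulr_ge0// inv_cube_ge0.
- by apply/measurable_EFinP; exact: mcube.
apply: (@le_trans _ _ ((M * (9 * (H ^+ 2 / delta)))%:E * (C * H)%:E +
   (M * H ^+ 4)%:E * ((3 * C + 1) / H ^+ 2)%:E)%E).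
  by apply: leeD; rewrite lee_wpmul2l// ?lee_fin// ?conc// inv_cube_moment.
rewrite -!EFinM -EFinD lee_fin -subr_ge0.
have -> : M * (12 * C + 1) * (H ^+ 3 / delta) -
   (M * (9 * (H ^+ 2 / delta)) * (C * H) + M * H ^+ 4 * ((3 * C + 1) / H ^+ 2)) =
   M * H ^+ 2 * (3 * C + 1) * ((H - delta) / delta) by field; rewrite !gt_eqF.
have M0' := ltW M0.
have C3 : 0 <= 3 * C + 1 by rewrite addr_ge0 ?mulr_ge0.
have Hd : 0 <= (H - delta) / delta by apply: divr_ge0; rewrite ?subr_ge0 ?(ltW d0).
by apply: mulr_ge0 => //; apply: mulr_ge0 => //; apply: mulr_ge0 => //; exact: sqr_ge0.
Qed.

End moments.

Section deviations.
Context {R : realType} d (T : measurableType d) (P : probability T R).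
Context d' (T' : measurableType d') (L : probability T' R).
Variable S : nat -> {RV P >-> T'}.
Hypotheses (S_indep : mutually_independent S)
  (S_law : forall i A, measurable A -> P (S i @^-1` A) = L A).
Variables (z y : T' -> R) (M : R).
Hypotheses (mz : measurable_fun setT z) (my : measurable_fun setT y)
  (M0 : 0 < M) (zM : forall p, 0 <= z p <= M).

Definition mean (g : T' -> R) : R := fine (\int[L]_p (g p)%:E)%E.

Definition weighted_remainder (delta t h : R) (p : T') : R :=
  z p * remainder delta h (y p - t).

Definition weighted_trunc (delta t : R) (p : T') : R :=
  z p * trunc_isqrt delta (y p - t).

(** The Chernoff exponent per observation for lam = theta delta / H and variance
    C1 H^3 / delta.  The choice of theta makes the quadratic term half of the gain
    lam kappa H^2, and completing a square in H shows that the other half plus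
    the gain from K delta^2 is at least 5 delta^2, uniformly in H. *)
Let exponent_remainder (kappa C1 theta delta h H K : R) :
  0 < kappa -> 0 < C1 -> theta = kappa / (2 * C1) ->
  K = kappa + 50 / (theta ^+ 2 * kappa) -> 0 < delta -> H = Num.max `|h| delta ->
  (theta * delta / H) ^+ 2 * (C1 * (H ^+ 3 / delta)) -
  theta * delta / H * (kappa * h ^+ 2 + K * delta ^+ 2) <= - (5 * delta ^+ 2).
Proof.
move=> k0 C0 thE KE d0 HE.
have th0 : 0 < theta by rewrite thE divr_gt0// mulr_gt0.
have dH : delta <= H by rewrite HE le_max lexx orbT.
have hH : `|h| <= H by rewrite HE le_max lexx.
have H0 : 0 < H by exact: lt_le_trans dH.
pose K' := 50 / (theta ^+ 2 * kappa).
have K'0 : 0 < K' by rewrite divr_gt0// mulr_gt0// exprn_gt0.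
have x1 : kappa * H ^+ 2 + K' * delta ^+ 2 <= kappa * h ^+ 2 + K * delta ^+ 2.
  rewrite KE -/K' mulrDl addrA lerD2r -mulrDr ler_pM2l//.
  rewrite HE -(real_normK (num_real h)); have [hd|dh] := leP `|h| delta.
    by rewrite lerDr sqr_ge0.
  by rewrite lerDl sqr_ge0.
have thd : 0 <= theta * delta / H by rewrite divr_ge0 ?mulr_ge0 ?ltW.
apply: (@le_trans _ _ ((theta * delta / H) ^+ 2 * (C1 * (H ^+ 3 / delta)) -
  theta * delta / H * (kappa * H ^+ 2 + K' * delta ^+ 2))).
  by rewrite lerD2l lerN2 ler_wpM2l.
have C1E : C1 = kappa / (2 * theta).
  by rewrite thE; field; rewrite !gt_eqF.
rewrite -subr_ge0 C1E /K'.
have -> : - (5 * delta ^+ 2) - ((theta * delta / H) ^+ 2 *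
   (kappa / (2 * theta) * (H ^+ 3 / delta)) - theta * delta / H *
   (kappa * H ^+ 2 + 50 / (theta ^+ 2 * kappa) * delta ^+ 2)) =
   delta / H * (theta * kappa / 2 * (H - 5 * delta / (theta * kappa)) ^+ 2 +
      75 / 2 * (delta ^+ 2 / (theta * kappa))).
  by field; rewrite !gt_eqF.
apply: mulr_ge0; first by rewrite divr_ge0 ?ltW.
apply: addr_ge0; apply: mulr_ge0; rewrite ?sqr_ge0//.
  by rewrite divr_ge0// mulr_ge0 ?ltW.
by rewrite divr_ge0 ?sqr_ge0// mulr_ge0 ?ltW.
Qed.

(** The fluctuation is allowed to be as large as kappa h^2; this is what permits a
    parameter lam of order delta / H at every scale h, and hence the absence of a
    logarithmic factor.  The bound on delta makes lam times the remainder at most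
    1/3. *)
Lemma remainder_deviation (C kappa : R) : 0 <= C -> 0 < kappa ->
  exists K, 0 <= K /\ exists2 delta0, 0 < delta0 &
  forall delta t h n, 0 < delta -> delta <= delta0 ->
  (forall r, 0 < r ->
    (\int[L]_p (z p * (`|y p - t| <= r)%R%:R)%:E <= (C * r)%:E)%E) ->
  (P [set w | (n%:R * (mean (weighted_remainder delta t h) +
      (kappa * h ^+ 2 + K * delta ^+ 2)) <
      \sum_(i < n) weighted_remainder delta t h (S i w))%R] <= (expR (- (5 * (n%:R * delta ^+ 2))))%:E)%E.
Proof.
move=> C0 k0.
pose C1 := M * (12 * C + 1).
have C10 : 0 < C1 by rewrite mulr_gt0// ltr_wpDl// mulr_ge0.
have [theta thE] : exists th, th = kappa / (2 * C1) by eexists.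
have th0 : 0 < theta by rewrite thE divr_gt0// mulr_gt0.
pose K := kappa + 50 / (theta ^+ 2 * kappa).
exists K; split.
  by rewrite addr_ge0 ?ltW// divr_gt0// mulr_gt0// exprn_gt0.
pose q := (9 * M * theta)^-1 : R.
have q0 : 0 < q by rewrite invr_gt0 !mulr_gt0.
exists (q ^+ 2); first by rewrite exprn_gt0.
move=> delta t h n d0 dq conc; set g := weighted_remainder delta t h.
pose H := Num.max `|h| delta.
have dH : delta <= H by rewrite le_max lexx orbT.
have hH : `|h| <= H by rewrite le_max lexx.
have H0 : 0 < H by exact: lt_le_trans dH.
have sd : Num.sqrt delta <= q.
  by rewrite -(ger0_norm (ltW q0)) -sqrtr_sqr ler_wsqrtr.
have sd0 : 0 < Num.sqrt delta by rewrite sqrtr_gt0.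
have ma : measurable_fun setT (fun p => y p - t) by exact: measurable_funB.
have mg : measurable_fun setT g.
  by apply: measurable_funM => //; exact: (measurableT_comp (measurable_remainder _ _)).
have gB p : `|g p| <= M * (3 * (H * isqrt delta)).
  have /andP[z0 zpM] := zM p.
  rewrite normrM (ger0_norm z0) ler_pM//.
  exact: (remainder_middle (y p - t) d0 dH hH).
pose lam := theta * delta / H.
have lam0 : 0 <= lam by rewrite divr_ge0 ?mulr_ge0 ?ltW.
have lg p : lam * g p <= 1 / 3.
  apply: (@le_trans _ _ (lam * (M * (3 * (H * isqrt delta))))).
    by rewrite ler_wpM2l// (le_trans (ler_norm _)).
  have -> : lam * (M * (3 * (H * isqrt delta))) = (9 * M * theta) * Num.sqrt delta / 3.
    by rewrite /lam /isqrt -{1}(sqr_sqrtr (ltW d0)); field; rewrite !gt_eqF.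
  by rewrite ler_wpM2r// -ler_pdivlMl ?mulr_gt0// mulr1.
have gv := remainder_moment ma mz M0 zM C0 conc d0 dH hH.
apply: (le_trans (chernoff_upper S_indep S_law _ n mg lam0 gB lg gv)).
rewrite lee_fin ler_expR.
have -> : - (5 * (n%:R * delta ^+ 2)) = n%:R * - (5 * delta ^+ 2) by ring.
rewrite ler_wpM2l//.
exact: (exponent_remainder k0 C10 thE _ d0 erefl).
Qed.

(** The truncated derivative is at most M / sqrt delta.  This bound alone, used for
    the second moment too, suffices for deviations of constant size. *)
Lemma trunc_isqrt_deviation (x : R) : 0 < x ->
  exists2 delta0, 0 < delta0 & forall delta t n, 0 < delta -> delta <= delta0 ->
  (P [set w | (n%:R * (mean (weighted_trunc delta t) + x) <
      \sum_(i < n) weighted_trunc delta t (S i w))%R] <=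
     (expR (- (5 * (n%:R * delta ^+ 2))))%:E)%E /\
  (P [set w | (\sum_(i < n) weighted_trunc delta t (S i w) <
      n%:R * (mean (weighted_trunc delta t) - x))%R] <=
     (expR (- (5 * (n%:R * delta ^+ 2))))%:E)%E.
Proof.
move=> x0.
pose q := 2 * M / (3 * x).
have q0 : 0 < q by rewrite divr_gt0 ?mulr_gt0.
exists (Num.min (q ^+ 2) (x ^+ 2 / (20 * M ^+ 2))).
  by rewrite lt_min exprn_gt0//= divr_gt0 ?mulr_gt0 ?exprn_gt0.
move=> delta t n d0; rewrite le_min => /andP[dq dx]; set g := weighted_trunc delta t.
have sd : Num.sqrt delta <= q.
  by rewrite -(ger0_norm (ltW q0)) -sqrtr_sqr ler_wsqrtr.
have sd0 : 0 < Num.sqrt delta by rewrite sqrtr_gt0.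
have mg : measurable_fun setT g.
  apply: measurable_funM => //.
  by apply: (measurableT_comp (measurable_trunc_isqrt _)); exact: measurable_funB.
have g0 p : 0 <= g p.
  have /andP[z0 _] := zM p; have /andP[t0 _] := trunc_isqrt_bound (y p - t) d0.
  exact: mulr_ge0.
have gM p : g p <= M * isqrt delta.
  have /andP[z0 zpM] := zM p; have /andP[t0 tb] := trunc_isqrt_bound (y p - t) d0.
  exact: ler_pM.
have gB p : `|g p| <= M * isqrt delta by rewrite ger0_norm.
pose lam := x * delta / (2 * M ^+ 2).
have lam0 : 0 <= lam by rewrite divr_ge0 ?mulr_ge0 ?exprn_ge0 ?ltW.
have lB : lam * (M * isqrt delta) <= 1 / 3.
  have -> : lam * (M * isqrt delta) = x / (2 * M) * Num.sqrt delta.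
    by rewrite /lam /isqrt -{1}(sqr_sqrtr (ltW d0)); field; rewrite !gt_eqF.
  rewrite -ler_pdivlMl ?divr_gt0 ?mulr_gt0// (le_trans sd)//.
  by rewrite le_eqVlt; apply/orP; left; apply/eqP; rewrite /q; field; rewrite !gt_eqF.
have gv : (\int[L]_p ((g p) ^+ 2)%:E <= (M ^+ 2 / delta)%:E)%E.
  apply: (@le_trans _ _ (\int[L]_p (M ^+ 2 / delta)%:E)%E); last first.
    rewrite integral_cst// [X in (_ * X)%E](_ : _ = 1%E) ?mule1//.
    exact: probability_setT.
  apply: ge0_le_integral => //.
  - by move=> p _; rewrite lee_fin sqr_ge0.
  - by apply/measurable_EFinP; exact: measurable_funX.
  - move=> p _; rewrite lee_fin.
    have -> : M ^+ 2 / delta = (M * isqrt delta) ^+ 2.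
      by rewrite exprMn /isqrt exprVn sqr_sqrtr// ltW.
    by rewrite ler_pXn2r// nnegrE// (le_trans (g0 p)).
have ex : lam ^+ 2 * (M ^+ 2 / delta) - lam * x <= - (5 * delta ^+ 2).
  have -> : lam ^+ 2 * (M ^+ 2 / delta) - lam * x = - (delta * (x ^+ 2 / (4 * M ^+ 2))).
    by rewrite /lam; field; rewrite !gt_eqF.
  rewrite lerN2 expr2 mulrCA ler_pM2l//.
  have -> : x ^+ 2 / (4 * M ^+ 2) = 5 * (x ^+ 2 / (20 * M ^+ 2)) by field; rewrite gt_eqF.
  by rewrite ler_pM2l.
have fin : expR (n%:R * (lam ^+ 2 * (M ^+ 2 / delta) - lam * x)) <=
    expR (- (5 * (n%:R * delta ^+ 2))).
  rewrite ler_expR.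
  have -> : - (5 * (n%:R * delta ^+ 2)) = n%:R * - (5 * delta ^+ 2) by ring.
  by rewrite ler_wpM2l.
split.
  have lg p : lam * g p <= 1 / 3 by rewrite (le_trans _ lB)// ler_wpM2l.
  apply: (le_trans (chernoff_upper S_indep S_law x n mg lam0 gB lg gv)).
  by rewrite lee_fin.
pose g' p := - g p.
have mg' : measurable_fun setT g' by exact: measurableT_comp.
have gB' p : `|g' p| <= M * isqrt delta by rewrite normrN.
have lg p : lam * g' p <= 1 / 3.
  by rewrite mulrN; apply: (@le_trans _ _ 0); [rewrite oppr_le0; exact: mulr_ge0|exact: divr_ge0].
have gv' : (\int[L]_p ((g' p) ^+ 2)%:E <= (M ^+ 2 / delta)%:E)%E.
  by under eq_integral do rewrite sqrrN.
have mE : fine (\int[L]_p (g' p)%:E)%E = - mean g.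
  rewrite /g'; under eq_integral do rewrite EFinN.
  by rewrite integral_ge0N ?fineN// => p _; rewrite lee_fin.
have := chernoff_upper S_indep S_law x n mg' lam0 gB' lg gv'.
rewrite mE => h; apply: le_trans (le_trans h _); last by rewrite lee_fin.
rewrite le_eqVlt; apply/orP; left; apply/eqP; congr (P _).
apply/seteqP; split => w /=; rewrite sumrN ltrNr -mulrN opprD opprK//.
Qed.

End deviations.

(** * Primitives of nonincreasing functions *)

Lemma derivable_ge0_lim {R : realType} (f : R -> R) (t : R) : derivable_ge0 f t ->
  forall e, 0 < e -> exists2 eta : R, 0 < eta &
    forall s, 0 <= s -> (s == t) = false -> `|s - t| < eta ->
      `|derive_ge0 f t - (f s - f t) / (s - t)| < e.
Proof.
move=> df e e0.
have /cvgrPdist_lt/(_ e e0) : (f s - f t) / (s - t) @[s --> within `[0, +oo[ t^']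
  --> derive_ge0 f t by exact: df.
move=> [eta /= eta0 h]; exists eta => // s s0 st seta.
have b : ball_ Num.norm t eta s by rewrite /ball_/= distrC.
have st' : s != t by rewrite st.
have s0' : (`[0, +oo[%classic : set R) s by rewrite /= in_itv/= s0.
exact: (h s b st' s0').
Qed.

Section primitive_monotone.
Context {R : realType}.
Variable Psi : R -> \bar R.
Hypotheses (Psi0 : forall t, 0 <= t -> (0 <= Psi t)%E)
  (mPsi : measurable_fun (`[0, +oo[%classic : set R) Psi)
  (Psi_dec : forall s t, 0 <= s -> s <= t -> (Psi t <= Psi s)%E)
  (Psi_fin : forall x, 0 <= x -> (\int[leb]_(t in `[0%R, x]) Psi t < +oo)%E).

Let U x := fine (\int[leb]_(t in `[0%R, x]) Psi t)%E.
Let p t := fine (Psi t).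

Let mPsiS (D : set R) : measurable D -> D `<=` `[0, +oo[%classic ->
  measurable_fun D Psi.
Proof. by move=> mD DS; apply: (measurable_funS _ DS mPsi); exact: measurable_itv. Qed.

Let U_fin x : 0 <= x -> (\int[leb]_(t in `[0%R, x]) Psi t)%E \is a fin_num.
Proof.
move=> x0; rewrite ge0_fin_numE ?Psi_fin//; apply: integral_ge0 => t /=.
by rewrite in_itv/= => /andP[t0 _]; exact: Psi0.
Qed.

Let U_split a b : 0 <= a -> a < b ->
  ((U b - U a)%:E = \int[leb]_(t in `]a, b]) Psi t)%E.
Proof.
move=> a0 ab; have b0 : 0 <= b by rewrite (le_trans a0)// ltW.
rewrite EFinB /U !fineK ?U_fin//.
have -> : `[0, b]%classic = `[0, a]%classic `|` `]a, b]%classic.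
  by rewrite -itv_bndbnd_setU// bnd_simp// ltW.
rewrite ge0_integral_setU//=.
- rewrite addeAC subee ?add0e//; exact: U_fin.
- apply: mPsiS; first exact: measurableU.
  by move=> x /= [|]; rewrite !in_itv/= andbT => /andP[]//; lra.
- by move=> x [|] /=; rewrite in_itv/= => /andP[xa _]; apply: Psi0 => //; rewrite (le_trans a0)// ltW.
- apply/disj_setPS => x [] /=; rewrite !in_itv/= => /andP[_ xa] /andP[ax _].
  by move: (le_lt_trans xa ax); rewrite ltxx.
Qed.

(** By monotonicity an infinite value at t would be infinite on the whole of
    [0, t], and so would be the integral. *)
Lemma Psi_fin_num t : 0 < t -> Psi t \is a fin_num.
Proof.
move=> t0; rewrite ge0_fin_numE; last exact/Psi0/ltW.
have := Psi_fin (ltW t0); rewrite ltNge => h; rewrite ltNge; apply: contra h.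
rewrite leye_eq => /eqP Pt.
suff : (\int[leb]_(x in `[0%R, t]) (cst +oo x) <= \int[leb]_(t in `[0%R, t]) Psi t)%E.
  rewrite integral_cst//= lebesgue_measure_itv/= lte_fin t0 oppr0 adde0.
  by rewrite gt0_mulye// lte_fin.
apply: ge0_le_integral => //.
- by move=> x _; rewrite leey.
- by apply: mPsiS => [|x /=]; [exact: measurable_itv|rewrite !in_itv/= andbT => /andP[]].
- by move=> x /=; rewrite in_itv/= => /andP[x0 xt]; rewrite -Pt Psi_dec.
Qed.

Lemma primitive_ge_slope a b : 0 <= a -> a < b -> p b * (b - a) <= U b - U a.
Proof.
move=> a0 ab; rewrite -lee_fin U_split//.
have b0 : 0 < b by exact: le_lt_trans ab.
apply: (@le_trans _ _ (\int[leb]_(x in `]a, b]) (cst (p b)%:E x))%E).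
  by rewrite integral_cst//= lebesgue_measure_itv/= lte_fin ab EFinM EFinB.
apply: ge0_le_integral => //.
- by move=> x _; rewrite lee_fin fine_ge0// Psi0// ltW.
- by apply: mPsiS => [|x /=]; [exact: measurable_itv|rewrite !in_itv/= andbT => /andP[/ltW/(le_trans a0)]].
- move=> x /=; rewrite in_itv/= => /andP[ax xb]; rewrite /p fineK ?Psi_fin_num//.
  by rewrite Psi_dec// (le_trans a0)// ltW.
Qed.

Lemma primitive_le_slope a b : 0 <= a -> Psi a \is a fin_num -> a < b ->
  U b - U a <= p a * (b - a).
Proof.
move=> a0 fa ab; rewrite -lee_fin U_split//.
have b0 : 0 < b by exact: le_lt_trans ab.
apply: (@le_trans _ _ (\int[leb]_(x in `]a, b]) (cst (p a)%:E x))%E); last first.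
  by rewrite integral_cst//= lebesgue_measure_itv/= lte_fin ab EFinM EFinB.
apply: ge0_le_integral => //.
- by move=> x /=; rewrite in_itv/= => /andP[ax _]; rewrite Psi0// (le_trans a0)// ltW.
- by apply: mPsiS => [|x /=]; [exact: measurable_itv|rewrite !in_itv/= andbT => /andP[/ltW/(le_trans a0)]].
- move=> x /=; rewrite in_itv/= => /andP[ax xb]; rewrite /p fineK//.
  by rewrite Psi_dec// ltW.
Qed.

Lemma integrand_ge0 t : 0 <= t -> 0 <= p t.
Proof. by move=> t0; rewrite fine_ge0// Psi0. Qed.

Lemma integrand_nonincreasing s t : 0 <= s -> Psi s \is a fin_num -> s <= t -> p t <= p s.
Proof.
move=> s0 fs; rewrite le_eqVlt => /predU1P[->//|st].
by apply: fine_le => //; [exact/Psi_fin_num/(le_lt_trans s0)|rewrite Psi_dec// ltW].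
Qed.

(* a form of right continuity of Psi at 0, where there is no left neighbourhood
   to bound Psi from *)
Hypothesis Psi_sup0 : forall c : R, (forall t, 0 < t -> (Psi t <= c%:E)%E) -> (Psi 0%R <= c%:E)%E.

(** Right difference quotients of U at t are at most Psi(t) and at least Psi(s) for
    s to the right of the increment; left ones are at least Psi(t).  Squeezing them
    against the existing derivative identifies it. *)
Lemma derive_ge0_primitive t : 0 <= t -> derivable_ge0 U t ->
  Psi t \is a fin_num /\ derive_ge0 U t = p t.
Proof.
move=> t0 dU; set l := derive_ge0 U t.
have lim := derivable_ge0_lim dU.
have le_l s : t < s -> p s <= l.
  move=> ts; apply/ler_addgt0Pr => e e0.
  have [eta eta0 h] := lim e e0.
  pose y := Num.min (t + eta / 2) s.
  have ty : t < y by rewrite lt_min ts ltrDl divr_gt0.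
  have yeta : `|y - t| < eta.
    rewrite gtr0_norm ?subr_gt0// ltrBlDl gt_min.
    by rewrite ltrD2l ltr_pdivrMr// mulr_natr mulr2n ltrDl eta0.
  have y0 : 0 <= y by rewrite (le_trans t0)// ltW.
  have hy := h y y0 (gt_eqF ty) yeta.
  have q1 : p y <= (U y - U t) / (y - t).
    by rewrite ler_pdivlMr ?subr_gt0//; exact: primitive_ge_slope.
  have fy : Psi y \is a fin_num by apply: Psi_fin_num; exact: le_lt_trans ty.
  have psy : p s <= p y by apply: integrand_nonincreasing => //; rewrite ge_min lexx orbT.
  by move: hy; rewrite ltr_norml => /andP[hy _]; rewrite -/l in hy; lra.
have fin : Psi t \is a fin_num.
  move: t0; rewrite le_eqVlt => /predU1P[t0|]; last exact: Psi_fin_num.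
  rewrite -t0 in le_l *.
  rewrite ge0_fin_numE ?Psi0//; apply: (@le_lt_trans _ _ l%:E); last exact: ltry.
  apply: Psi_sup0 => s s0; have := le_l s s0.
  by rewrite -lee_fin /p fineK// Psi_fin_num.
split => //; apply/eqP; rewrite eq_le; apply/andP; split.
- apply/ler_addgt0Pr => e e0.
  have [eta eta0 h] := lim e e0.
  have ty : t < t + eta / 2 by rewrite ltrDl divr_gt0.
  have yeta : `|t + eta / 2 - t| < eta.
    by rewrite addrAC subrr add0r gtr0_norm ?divr_gt0// ltr_pdivrMr// mulr_natr mulr2n ltrDl.
  have y0 : 0 <= t + eta / 2 by rewrite (le_trans t0)// ltW.
  have hy := h _ y0 (gt_eqF ty) yeta.
  have q1 : (U (t + eta / 2) - U t) / (t + eta / 2 - t) <= p t.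
    by rewrite ler_pdivrMr ?subr_gt0//; exact: primitive_le_slope.
  by move: hy; rewrite ltr_norml => /andP[_ hy]; rewrite -/l in hy; lra.
- have : (0 == t) || (0 < t) by rewrite -le_eqVlt.
  move=> /predU1P[tE|t0'].
    rewrite -tE in le_l fin *; rewrite -lee_fin /p fineK//.
    apply: Psi_sup0 => s s0; have := le_l s s0.
    by rewrite -lee_fin /p fineK// Psi_fin_num.
  apply/ler_addgt0Pr => e e0.
  have [eta eta0 h] := lim e e0.
  pose y := Num.max (t - eta / 2) 0.
  have yt : y < t by rewrite gt_max t0' andbT ltrBlDr ltrDl divr_gt0.
  have yeta : `|y - t| < eta.
    rewrite distrC gtr0_norm ?subr_gt0// ltrBlDl -ltrBlDr lt_max; apply/orP; left.
    by rewrite ltrD2l ltrN2 ltr_pdivrMr// mulr_natr mulr2n ltrDl eta0.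
  have y0 : 0 <= y by rewrite le_max lexx orbT.
  have hy := h y y0 (lt_eqF yt) yeta.
  have q1 : p t <= (U y - U t) / (y - t).
    rewrite -opprB -(opprB t y) invrN mulrNN ler_pdivlMr ?subr_gt0//.
    exact: primitive_ge_slope.
  by move: hy; rewrite ltr_norml => /andP[hy _]; rewrite -/l in hy; lra.
Qed.

End primitive_monotone.

Section slopes.
Context {R : realType}.
Variables (U p : R -> R) (t0 t1 : R).
Hypotheses (t0_ge0 : 0 <= t0) (t01 : t0 < t1)
  (U_p : forall t, 0 <= t -> derivable_ge0 U t -> derive_ge0 U t = p t)
  (U_C2 : twice_continuously_differentiable U t0 t1)
  (U''_lt0 : 0 < inf [set - derive_ge0 (derive_ge0 U) t | t in `[t0, t1]]).

Let D := derive_ge0 (derive_ge0 U).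

Let in_ge0 t : t0 <= t <= t1 -> 0 <= t.
Proof. by move=> /andP[h _]; exact: le_trans h. Qed.

(** At an endpoint of [t0, t1] the derivatives are those of the function on the
    half-line, so that differentiability extends a little beyond the interval. *)
Let near_derivable (t : R) : t0 <= t <= t1 -> exists2 eta : R, 0 < eta &
  forall s, 0 <= s -> `|s - t| < eta -> derivable_ge0 U s.
Proof.
move=> tt; have [[eta /= eta0 h] _] := U_C2.1 t tt.
exists eta => // s s0 st; apply: (h s); last by rewrite /= in_itv/= s0.
by rewrite /ball_/= distrC.
Qed.

Let local_slope (t e : R) : t0 <= t <= t1 -> 0 < e -> exists2 eta : R, 0 < eta &
  forall s, 0 <= s -> `|s - t| < eta -> derivable_ge0 U s /\
    ((s == t) = false -> `|D t - (p s - p t) / (s - t)| < e).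
Proof.
move=> tt e0; have [a a0 ha] := near_derivable tt.
have [_ dD] := U_C2.1 t tt.
have [b b0 hb] := derivable_ge0_lim dD e0.
exists (Num.min a b); first by rewrite lt_min a0.
move=> s s0; rewrite lt_min => /andP[sa sb]; split; first exact: ha.
move=> st; have t_ge0 := in_ge0 tt.
have := hb s s0 st sb; rewrite !U_p//; last exact: ha.
by apply: ha => //; rewrite subrr normr0.
Qed.

Let D_bounds : exists c C : R, 0 < c /\ forall t, t0 <= t <= t1 -> c <= - D t <= C.
Proof.
have [m mt hm] := EVT_max (ltW t01) U_C2.2.
have [m' mt' hm'] := EVT_min (ltW t01) U_C2.2.
exists (inf [set - D t | t in `[t0, t1]]), (- D m'); split => // t tt.
apply/andP; split; last by rewrite lerN2; apply: hm'; rewrite in_itv.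
apply: ge_inf; last by exists t => //=; rewrite in_itv.
exists (- D m) => _ [s sI <-]; rewrite lerN2; exact: hm.
Qed.

Let p_derive t : t0 < t < t1 -> is_derive t 1 p (D t).
Proof.
move=> /andP[tl tr].
have tt : t0 <= t <= t1 by rewrite !ltW.
have t_gt0 : 0 < t by exact: le_lt_trans tl.
have cv : (fun h => h^-1 *: (p (h *: 1 + t) - p t)) @ 0^' --> D t.
  apply/cvgrPdist_lt => e e0.
  have [eta eta0 h] := local_slope tt e0.
  exists (Num.min eta t); first by rewrite /= lt_min eta0.
  move=> k /=; rewrite sub0r normrN lt_min => /andP[keta kt] k0.
  have ks : 0 <= k + t.
    by move: kt; rewrite ltr_norml => /andP[kt _]; rewrite -lerBlDr sub0r ltW.
  have kst : (k + t == t) = false.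
    by apply/negbTE; rewrite -subr_eq0 addrK.
  have kd : `|k + t - t| < eta by rewrite addrK.
  have [_ /(_ kst)] := h _ ks kd.
  by rewrite addrK /GRing.scale/= mulr1 mulrC.
apply: DeriveDef; first by apply: cvgP cv.
exact: cvg_lim cv.
Qed.

Let p_continuous : {within `[t0, t1], continuous p}.
Proof.
apply/subspace_continuousP => t /=; rewrite in_itv/= => tt.
apply/cvgrPdist_lt => e e0.
have [eta eta0 h] := local_slope tt ltr01.
have d0 : 0 < `|D t| + 1 by rewrite ltr_wpDl.
exists (Num.min eta (e / (`|D t| + 1))); first by rewrite /= lt_min eta0 divr_gt0.
move=> s /=; rewrite distrC lt_min in_itv/= => /andP[seta se] /andP[s0 _].
have [->|st] := eqVneq s t; first by rewrite subrr normr0.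
have [_ /(_ (negbTE st)) hs] := h s (le_trans t0_ge0 s0) seta.
have st0 : 0 < `|s - t| by rewrite normr_gt0 subr_eq0.
rewrite distrC.
have -> : p s - p t = ((p s - p t) / (s - t)) * (s - t).
  by rewrite divfK// subr_eq0.
rewrite normrM; apply: (@le_lt_trans _ _ ((`|D t| + 1) * `|s - t|)).
  rewrite ler_wpM2r//.
  have := ler_normB (D t) (D t - (p s - p t) / (s - t)).
  by rewrite opprB addrCA subrr addr0; lra.
by rewrite mulrC -ltr_pdivlMr.
Qed.

(** Inside [t0, t1] this is the mean value theorem with the extrema of U''.  One of
    the two points may lie slightly outside; there the definition of the
    derivative of U' at the endpoint gives the same bounds, with c / 2 and C + c, and
    increments through an endpoint are added up. *)
Lemma slope_bounds : exists c C eta : R, [/\ 0 < c, 0 < C, 0 < eta &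
  forall s s', 0 <= s -> s < s' -> s' - s <= eta ->
    (t0 <= s <= t1) || (t0 <= s' <= t1) ->
    [/\ derivable_ge0 U s, derivable_ge0 U s' &
     c * (s' - s) <= p s - p s' <= C * (s' - s)]].
Proof.
have [c [C [c0 cC]]] := D_bounds.
have tt0 : t0 <= t0 <= t1 by rewrite lexx ltW.
have tt1 : t0 <= t1 <= t1 by rewrite lexx ltW.
have cC' : c <= C by have /andP[h2 h3] := cC t0 tt0; exact: le_trans h3.
have C0 : 0 < C by exact: lt_le_trans cC'.
have c20 : 0 < c / 2 by rewrite divr_gt0.
have [e0 e00 h0] := local_slope tt0 c20.
have [e1 e10 h1] := local_slope tt1 c20.
pose good s s' := [/\ derivable_ge0 U s, derivable_ge0 U s' &
     c / 2 * (s' - s) <= p s - p s' <= (C + c) * (s' - s)].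
have der t : t0 <= t <= t1 -> derivable_ge0 U t.
  move=> tt; have [e ee he] := near_derivable tt; apply: he; first exact: in_ge0.
  by rewrite subrr normr0.
have inner s s' : t0 <= s -> s < s' -> s' <= t1 -> good s s'.
  move=> s0 ss' s1.
  have ts : t0 <= s <= t1 by rewrite s0 (le_trans (ltW ss')).
  have ts' : t0 <= s' <= t1 by rewrite s1 (le_trans s0)// ltW.
  split; [exact: der|exact: der|].
  have sub : `[s, s']%classic `<=` `[t0, t1]%classic.
    by move=> x /=; rewrite !in_itv/= => /andP[h2 h3]; apply/andP; split; lra.
  have [|x xI xE] := @MVT R p D s s' ss' _ (continuous_subspaceW sub p_continuous).
    move=> x; rewrite in_itv/= => /andP[sx xs']; apply: p_derive.
    by apply/andP; split; lra.
  have /andP[Dc DC] : c <= - D x <= C.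
    by apply: cC; move: xI; rewrite in_itv/= => /andP[h2 h3]; apply/andP; split; lra.
  have d0 : 0 < s' - s by rewrite subr_gt0.
  have -> : p s - p s' = - D x * (s' - s) by rewrite mulNr -xE opprB.
  by apply/andP; split; rewrite ler_pM2r//; lra.
have slope t s : t0 <= t <= t1 -> (s == t) = false ->
    `|D t - (p s - p t) / (s - t)| < c / 2 ->
    c / 2 <= (p t - p s) / (s - t) <= C + c.
  move=> tt st; have /andP[Dc DC] := cC t tt.
  rewrite -(opprB (p s)) mulNr ltr_norml => /andP[k1 k2].
  by apply/andP; split; lra.
have left_ s : 0 <= s -> s < t0 -> t0 - s < e0 -> good s t0.
  move=> s0 st se.
  have sd : `|s - t0| < e0 by rewrite distrC gtr0_norm// subr_gt0.
  have [d /(_ (lt_eqF st)) sl] := h0 s s0 sd.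
  have /andP[k1 k2] := slope _ _ tt0 (lt_eqF st) sl.
  have d0 : 0 < t0 - s by rewrite subr_gt0.
  split => //; first exact: der.
  have -> : p s - p t0 = (p t0 - p s) / (s - t0) * (t0 - s).
    by field; rewrite subr_eq0 lt_eqF.
  by apply/andP; split; rewrite ler_pM2r.
have right_ s : t1 < s -> s - t1 < e1 -> good t1 s.
  move=> st se.
  have sd : `|s - t1| < e1 by rewrite gtr0_norm// subr_gt0.
  have s0 : 0 <= s by rewrite (le_trans t0_ge0)// (le_trans (ltW t01))// ltW.
  have [d /(_ (gt_eqF st)) sl] := h1 s s0 sd.
  have /andP[k1 k2] := slope _ _ tt1 (gt_eqF st) sl.
  have d0 : 0 < s - t1 by rewrite subr_gt0.
  split => //; first exact: der.
  have -> : p t1 - p s = (p t1 - p s) / (s - t1) * (s - t1).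
    by rewrite divfK// gt_eqF.
  by apply/andP; split; rewrite ler_pM2r.
have trans s s'' s' : good s s'' -> good s'' s' -> good s s'.
  move=> [d1 d2 /andP[k1 k2]] [d3 d4 /andP[k3 k4]]; split => //.
  have E1 := mulrBr (c / 2); have E2 := mulrBr (C + c).
  by move: k1 k2 k3 k4; rewrite !E1 !E2 => k1 k2 k3 k4; apply/andP; split; lra.
exists (c / 2), (C + c), (Num.min e0 e1 / 2); split => //.
- by rewrite addr_gt0.
- by rewrite divr_gt0// lt_min e00.
move=> s s' s0 ss' se orr.
have emin : s' - s < Num.min e0 e1.
  apply: (le_lt_trans se); rewrite ltr_pdivrMr// mulr_natr mulr2n ltrDl.
  by rewrite lt_min e00.
move: emin; rewrite lt_min => /andP[se0 se1].
have [s0'|t0s] := ltP s t0.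
  have /andP[k1 k2] : t0 <= s' <= t1.
    by move: orr; rewrite leNgt s0'.
  have g1 : good s t0 by apply: left_ => //; lra.
  move: k1; rewrite le_eqVlt => /predU1P[<-//|k1].
  by apply: trans g1 _; exact: inner.
have [s1|t1s] := leP s' t1; first exact: inner.
have /andP[_ k1] : t0 <= s <= t1.
  by move: orr; rewrite (leNgt s') t1s andbF orbF.
move: k1; rewrite le_eqVlt => /predU1P[E|k1].
  by rewrite E; apply: right_ => //; lra.
apply: (trans _ t1); first exact: inner.
by apply: right_ => //; lra.
Qed.

End slopes.

Section supergradient.
Context {R : realType}.
Variable Psi : R -> \bar R.
Hypotheses (Psi0 : forall t : R, 0 <= t -> (0 <= Psi t)%E)
  (mPsi : measurable_fun (`[0, +oo[%classic : set R) Psi)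
  (Psi_dec : forall s t : R, 0 <= s -> s <= t -> (Psi t <= Psi s)%E)
  (Psi_fin : forall x : R, 0 <= x -> (\int[leb]_(t in `[0%R, x]) Psi t < +oo)%E).

Let U x := fine (\int[leb]_(t in `[0%R, x]) Psi t)%E.
Let p t := fine (Psi t).

Variables (t0 t1 c eta B : R).
Hypotheses (t0_ge0 : 0 <= t0) (c0 : 0 < c) (eta0 : 0 < eta) (B0 : 0 < B)
  (t1B : t1 <= B)
  (slope : forall s s' : R, 0 <= s -> s < s' -> s' - s <= eta ->
    (t0 <= s <= t1) || (t0 <= s' <= t1) -> c * (s' - s) <= p s - p s')
  (fin : forall t : R, t0 <= t <= t1 -> Psi t \is a fin_num).

(** For t < s, split the increment at the midpoint v.  The half next to t has mean
    slope at most p(t), and the far half at most p(v), which is smaller than p(t)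
    by at least c min((s - t) / 2, eta); for s - t <= B this minimum is
    at least a constant multiple of s - t.  The case s < t is the mirror image. *)
Lemma strict_supergradient : exists2 kappa : R, 0 < kappa &
  forall t s : R, t0 <= t <= t1 -> 0 <= s <= B ->
    U s <= U t + p t * (s - t) - 2 * kappa * (s - t) ^+ 2.
Proof.
pose k := Num.min (1 / 2) (eta / B).
have k0 : 0 < k by rewrite lt_min !divr_gt0.
exists (c * k / 4); first by rewrite divr_gt0// mulr_gt0.
move=> t s tt /andP[s0 sB].
have t_ge0 : 0 <= t by have /andP[h _] := tt; exact: le_trans h.
have tB : t <= B by have /andP[_ h] := tt; exact: le_trans t1B.
have ft := fin tt.
have gap h : 0 <= h -> h <= B -> h * k <= Num.min (h / 2) eta.
  move=> h0 hB; rewrite le_min; apply/andP; split.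
    by rewrite ler_wpM2l// ge_min mul1r lexx.
  apply: (@le_trans _ _ (h * (eta / B))); first by rewrite ler_wpM2l// ge_min lexx orbT.
  by rewrite mulrCA ger_pMr// ler_pdivrMr// mul1r.
have [st|ts|->] := ltgtP s t; last first.
- by rewrite subrr expr0n/= !mulr0 subr0 addr0.
- pose v := (t + s) / 2.
  have tv : t < v by rewrite /v; lra.
  have vs : v < s by rewrite /v; lra.
  have v0 : 0 < v by exact: le_lt_trans tv.
  have fv : Psi v \is a fin_num by exact: (Psi_fin_num Psi0 mPsi Psi_dec Psi_fin).
  have h1 : U s - U v <= p v * (s - v).
    by apply: (primitive_le_slope Psi0 mPsi Psi_dec Psi_fin) => //; exact: ltW.
  have h2 : U v - U t <= p t * (v - t).
    exact: (primitive_le_slope Psi0 mPsi Psi_dec Psi_fin).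
  pose w := Num.min v (t + eta).
  have tw : t < w by rewrite lt_min tv ltrDl.
  have wv : w <= v by rewrite ge_min lexx.
  have w0 : 0 < w by exact: le_lt_trans tw.
  have fw : Psi w \is a fin_num by exact: (Psi_fin_num Psi0 mPsi Psi_dec Psi_fin).
  have h3 : p v <= p w by apply: (integrand_nonincreasing Psi0 mPsi Psi_dec Psi_fin) => //; exact: ltW.
  have h4 : c * (w - t) <= p t - p w.
    by apply: slope => //; rewrite ?tt// lerBlDl ge_min lexx orbT.
  have wE : w - t = Num.min ((s - t) / 2) eta.
    rewrite /w addr_minl; congr Num.min; last by lra.
    by rewrite /v; lra.
  have h5 : (s - t) * k <= w - t by rewrite wE; apply: gap; lra.
  have h6 : c * ((s - t) * k) <= p t - p v.
    apply: (@le_trans _ _ (c * (w - t))); first by rewrite ler_wpM2l// ltW.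
    lra.
  have h7 : c * ((s - t) * k) * (s - t) <= (p t - p v) * (s - t).
    by rewrite ler_wpM2r// subr_ge0 ltW.
  have e1 : p v * (s - v) = p v * (s - t) / 2 by rewrite /v; field.
  have e2 : p t * (v - t) = p t * (s - t) / 2 by rewrite /v; field.
  have e3 : 2 * (c * k / 4) * (s - t) ^+ 2 = c * ((s - t) * k) * (s - t) / 2 by field.
  move: h7; rewrite mulrBl => h7.
  rewrite e3; rewrite e1 in h1; rewrite e2 in h2; lra.
- pose v := (t + s) / 2.
  have tv : v < t by rewrite /v; lra.
  have vs : s < v by rewrite /v; lra.
  have v0 : 0 < v by exact: le_lt_trans vs.
  have fv : Psi v \is a fin_num by exact: (Psi_fin_num Psi0 mPsi Psi_dec Psi_fin).
  have h1 : p v * (v - s) <= U v - U s.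
    exact: (primitive_ge_slope Psi0 mPsi Psi_dec Psi_fin).
  have h2 : p t * (t - v) <= U t - U v.
    by apply: (primitive_ge_slope Psi0 mPsi Psi_dec Psi_fin) => //; exact: ltW.
  pose w := Num.max v (t - eta).
  have tw : w < t by rewrite gt_max tv ltrBlDr ltrDl.
  have wv : v <= w by rewrite le_max lexx.
  have w0 : 0 < w by exact: lt_le_trans wv.
  have h3 : p w <= p v by apply: (integrand_nonincreasing Psi0 mPsi Psi_dec Psi_fin) => //; exact: ltW.
  have h4 : c * (t - w) <= p w - p t.
    apply: slope => //; rewrite ?tt ?orbT//; first exact: ltW.
    by rewrite lerBlDl -lerBlDr le_max lexx orbT.
  have wE : t - w = Num.min ((t - s) / 2) eta.
    rewrite /w oppr_max addr_minr; congr Num.min; last by lra.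
    by rewrite /v; lra.
  have h5 : (t - s) * k <= t - w by rewrite wE; apply: gap; lra.
  have h6 : c * ((t - s) * k) <= p v - p t.
    apply: (@le_trans _ _ (c * (t - w))); first by rewrite ler_wpM2l// ltW.
    lra.
  have h7 : c * ((t - s) * k) * (t - s) <= (p v - p t) * (t - s).
    by rewrite ler_wpM2r// subr_ge0 ltW.
  have e1 : p v * (v - s) = p v * (t - s) / 2 by rewrite /v; field.
  have e2 : p t * (t - v) = p t * (t - s) / 2 by rewrite /v; field.
  have e3 : 2 * (c * k / 4) * (s - t) ^+ 2 = c * ((t - s) * k) * (t - s) / 2 by field.
  have e4 : p t * (s - t) = - (p t * (t - s)) by ring.
  move: h7; rewrite mulrBl => h7.
  rewrite e3 e4; rewrite e1 in h1; rewrite e2 in h2; lra.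
Qed.

End supergradient.

(** * Mass of the observations near a point *)

Section local_mass.
Context {R : realType}.
Variable m : R -> \bar R.
Hypotheses (mm : measurable_fun setT m) (m0 : forall x, (0 <= m x)%E).
Local Open Scope ereal_scope.

Let mk (t : R) : measurable_fun setT (fun x : R => (isqrt (x - t))%:E * m x).
Proof.
by apply: emeasurable_funM => //; apply/measurable_EFinP; exact: measurable_isqrtB.
Qed.

Let k0 (t x : R) : 0 <= (isqrt (x - t))%:E * m x.
Proof. by rewrite mule_ge0// lee_fin isqrt_ge0. Qed.

Let kernel_le (t a : R) (b : itv_bound R) (mu : R) : (t < a)%R ->
  \int[leb]_(x in [set` Interval (BRight a) b]) m x <= mu%:E ->
  \int[leb]_(x in [set` Interval (BRight a) b]) ((isqrt (x - t))%:E * m x) <=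
  (isqrt (a - t) * mu)%:E.
Proof.
move=> ta mmu.
have mI : measurable [set` Interval (BRight a) b] by exact: measurable_itv.
apply: (@le_trans _ _ (\int[leb]_(x in [set` Interval (BRight a) b])
    ((isqrt (a - t))%:E * m x))).
  apply: ge0_le_integral => //.
  - by apply: measurable_funTS; exact: mk.
  - by apply: measurable_funTS; apply: emeasurable_funM.
  - move=> x /= xI; rewrite lee_wpmul2r// lee_fin.
    have ax : (a < x)%R by move: xI; rewrite in_itv/= => /andP[].
    rewrite /isqrt lef_pV2 ?posrE ?sqrtr_gt0 ?subr_gt0// ?(lt_trans ta)//.
    by rewrite ler_wsqrtr// lerD2r ltW.
rewrite ge0_integralZl//; last by rewrite lee_fin isqrt_ge0.
  by rewrite EFinM lee_wpmul2l// lee_fin isqrt_ge0.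
by apply: measurable_funTS.
Qed.

(** A mass of linear growth integrates the singularity (x - t)^(-1/2): the shells
    between eta / 4^(k+1) and eta / 4^k contribute a geometric series of ratio
    1/2. *)
Lemma isqrt_mass_dyadic (t c eta : R) (k : nat) : (0 <= c)%R -> (0 < eta)%R ->
  (forall r : R, (0 < r)%R -> (r <= eta)%R ->
    \int[leb]_(x in `]t, (t + r)%R]) m x <= (c * r)%:E) ->
  \int[leb]_(x in `](t + eta / 4 ^+ k)%R, (t + eta)%R])
    ((isqrt (x - t))%:E * m x) <= (4 * c * Num.sqrt eta * (1 - 2 ^- k))%:E.
Proof.
move=> c0 eta0 mass; elim: k => [|k IH].
  rewrite expr0 divr1 set_itv_ge ?bnd_simp -?leNgt// integral_set0.
  by rewrite expr0 invr1 subrr mulr0.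
have p4 j : (0 < 4 ^+ j :> R)%R by rewrite exprn_gt0.
have p2 j : (0 < 2 ^+ j :> R)%R by rewrite exprn_gt0.
pose a := (t + eta / 4 ^+ k.+1)%R; pose b := (t + eta / 4 ^+ k)%R.
have ta : (t < a)%R by rewrite ltrDl divr_gt0.
have ab : (a <= b)%R.
  by rewrite lerD2l ler_pM2l// lef_pV2 ?posrE// ler_eXn2l ?ltr1n.
have be : (b <= t + eta)%R.
  by rewrite lerD2l ler_pdivrMr// ler_pMr// exprn_ege1// ler1n.
have -> : `]a, (t + eta)%R]%classic = `]a, b]%classic `|` `]b, (t + eta)%R]%classic.
  by rewrite -itv_bndbnd_setU.
rewrite ge0_integral_setU//=; last 2 first.
- by apply: measurable_funTS; exact: mk.
- apply/disj_setPS => x [] /=; rewrite !in_itv/= => /andP[_ xa] /andP[ax _].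
  by move: (le_lt_trans xa ax); rewrite ltxx.
apply: (@le_trans _ _ ((isqrt (a - t) * (c * (eta / 4 ^+ k)))%:E +
   (4 * c * Num.sqrt eta * (1 - 2 ^- k))%:E)).
  apply: leeD; last exact: IH.
  apply: kernel_le => //.
  apply: (@le_trans _ _ (\int[leb]_(x in `]t, b]) m x)); last first.
    apply: mass; first exact: divr_gt0.
    by rewrite ler_pdivrMr// ler_pMr// exprn_ege1// ler1n.
  apply: ge0_subset_integral => //.
  - by apply: measurable_funTS.
  - by move=> x /=; rewrite !in_itv/= => /andP[h1 ->]; rewrite (lt_trans ta).
rewrite -EFinD lee_fin le_eqVlt; apply/orP; left; apply/eqP.
have -> : isqrt (a - t) = (2 ^+ k.+1 / Num.sqrt eta)%R.
  rewrite /isqrt /a addrAC subrr add0r sqrtrM ?(ltW eta0)// sqrtrV ?(ltW (p4 _))//.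
  have -> : (4 ^+ k.+1 = (2 ^+ k.+1) ^+ 2 :> R)%R.
    by rewrite -exprM mulnC exprM; congr (_ ^+ _)%R; ring.
  by rewrite sqrtr_sqr gtr0_norm// invfM invrK mulrC.
have s0 : (0 < Num.sqrt eta)%R by rewrite sqrtr_gt0.
have -> : (4 ^+ k = (2 ^+ k) ^+ 2 :> R)%R.
  by rewrite -exprM mulnC exprM; congr (_ ^+ _)%R; ring.
rewrite -{2}(sqr_sqrtr (ltW eta0)) exprS.
by field; rewrite !gt_eqF.
Qed.

Lemma isqrt_mass (t c eta r : R) : (0 <= c)%R -> (0 < eta)%R -> (0 < r)%R ->
  (forall r : R, (0 < r)%R -> (r <= eta)%R ->
    \int[leb]_(x in `]t, (t + r)%R]) m x <= (c * r)%:E) ->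
  \int[leb]_(x in `](t + r)%R, (t + eta)%R])
    ((isqrt (x - t))%:E * m x) <= (4 * c * Num.sqrt eta)%:E.
Proof.
move=> c0 eta0 r0 mass.
pose k := Num.bound (eta / r).
have hk : (eta / 4 ^+ k <= r)%R.
  have h1 : (eta / r < k%:R)%R by rewrite /k archi_boundP// divr_ge0 ?ltW.
  rewrite ler_pdivrMr ?exprn_gt0// mulrC -ler_pdivrMr// (le_trans (ltW h1))//.
  by rewrite -natrX ler_nat ltnW// ltn_expl.
apply: (@le_trans _ _ (\int[leb]_(x in `](t + eta / 4 ^+ k)%R, (t + eta)%R])
    ((isqrt (x - t))%:E * m x))).
  apply: ge0_subset_integral => //.
  - by apply: measurable_funTS; exact: mk.
  - by move=> x /=; rewrite !in_itv/= => /andP[h ->]; rewrite andbT; lra.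
apply: (le_trans (isqrt_mass_dyadic k c0 eta0 mass)).
rewrite lee_fin ler_piMr// ?mulr_ge0 ?sqrtr_ge0//.
Qed.

(** For x > 0 this is 2 sqrt x times the probability that Y is within r of t when
    the squared norm in R^3 is x: on a sphere the third coordinate is uniform. *)
Definition arc_mass (t r x : R) : \bar R :=
  \int[leb]_(y in `]0%R, +oo[) ((isqrt (x - y))%:E * ((`|y - t| <= r)%R%:R)%:E).

(** If x is within 2 r of t the arc may be tangent to the boundary, and the
    integral of the kernel is of order sqrt r; for larger x the kernel is of order
    1 / sqrt (x - t) on the whole window. *)
Lemma arc_mass_le (t r x p : R) : (0 <= t)%R -> (0 < r)%R ->
  p = Num.max (t - r)%R 0%R ->
  arc_mass t r x <= (4 * Num.sqrt r * \1_(`]p, (t + 2 * r)%R]%classic) x +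
    4 * r * (isqrt (x - t) * \1_(`](t + 2 * r)%R, +oo[%classic) x))%:E.
Proof.
move=> t0 r0 pE.
have p_ge0 : (0 <= p)%R by rewrite pE le_max lexx orbT.
have pl : (t - r <= p)%R by rewrite pE le_max lexx.
have pt : (p <= t)%R by rewrite pE ge_max t0 andbT; lra.
have h : arc_mass t r x <= (2 * (Num.sqrt (x - p) - Num.sqrt (x - (t + r))))%:E.
  rewrite -integral_isqrt_rev; last lra.
  rewrite /arc_mass integral_mkcond [leRHS]integral_mkcond.
  apply: ge0_le_integral => //.
  - move=> y _; rewrite patchE; case: ifPn => // _.
    by rewrite mule_ge0// lee_fin ?isqrt_ge0.
  - apply/(measurable_restrictT _ _).1 => /=; first exact: measurable_itv.
    apply: measurable_funTS; apply/measurable_EFinP; apply: measurable_funM.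
      exact: measurable_isqrtBl.
    apply: (measurableT_comp (measurable_norm_le_nat r)); exact: measurable_funB.
  - apply/(measurable_restrictT _ _).1 => /=; first exact: measurable_itv.
    by apply: measurable_funTS; apply/measurable_EFinP; exact: measurable_isqrtBl.
  - move=> y _; rewrite !patchE !mem_setE !in_itv/= andbT.
    have [y0|y0] := ltP 0%R y; last first.
      by case: ifP => // _; rewrite lee_fin isqrt_ge0.
    have [yt|yt] := leP `|y - t|%R r; last first.
      by rewrite mule0; case: ifP => // _; rewrite lee_fin isqrt_ge0.
    have /andP[h1 h2] : (- r <= y - t <= r)%R by rewrite -ler_norml.
    have -> : (p <= y <= t + r)%R.
      by rewrite pE ge_max (ltW y0) andbT; apply/andP; split; lra.
    by rewrite mule1.
apply: (le_trans h); rewrite lee_fin !indicE !mem_setE !in_itv/= andbT.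
have sr0 := sqrtr_ge0 r.
have [xp|px] := leP x p.
  have -> : (t + 2 * r < x)%R = false by apply/negbTE; rewrite -leNgt; lra.
  by rewrite !mulr0 addr0 !ler0_sqrtr ?subrr ?mulr0// subr_le0//; lra.
have sp : (Num.sqrt (x - t) <= Num.sqrt (x - p))%R by rewrite ler_wsqrtr//; lra.
have [xt|tx] := leP x (t + 2 * r)%R.
  rewrite !mulr0 addr0 mulr1.
  have h1 : (Num.sqrt (x - p) <= Num.sqrt (4 * r))%R by rewrite ler_wsqrtr//; lra.
  have h2 : (Num.sqrt (4 * r) = 2 * Num.sqrt r)%R.
    by rewrite sqrtrM// (_ : 4 = 2 ^+ 2)%R ?sqrtr_sqr ?gtr0_norm//; ring.
  have := sqrtr_ge0 (x - (t + r)); lra.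
rewrite mulr0 add0r mulr1 /isqrt.
have s0 : (0 < Num.sqrt (x - t))%R by rewrite sqrtr_gt0; lra.
set P := Num.sqrt (x - p); set Q := Num.sqrt (x - (t + r)).
have Q0 : (0 <= Q)%R by exact: sqrtr_ge0.
have P0 : (0 < P)%R by exact: lt_le_trans sp.
have PQ : (P ^+ 2 - Q ^+ 2 <= 2 * r)%R by rewrite !sqr_sqrtr; lra.
have PQ' : ((P - Q) * P <= 2 * r)%R.
  have QP : (Q <= P)%R by rewrite ler_wsqrtr//; lra.
  apply: le_trans PQ; rewrite subr_sqr ler_wpM2l ?subr_ge0//; lra.
have r2 : (0 <= 2 * r)%R by lra.
have : (P - Q <= 2 * r / P)%R by rewrite ler_pdivlMr.
have : (2 * r / P <= 2 * r / Num.sqrt (x - t))%R by rewrite ler_wpM2l// lef_pV2.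
lra.
Qed.

(** The window within 2 r of t contributes sqrt r times a mass of order r, the
    range from 2 r to eta is [isqrt_mass], and beyond eta the kernel is
    bounded. *)
Lemma integral_arc_mass (t c eta r D p : R) : (0 <= t)%R -> (0 <= c)%R ->
  (0 < r)%R -> (2 * r <= eta)%R -> (0 <= D)%R ->
  p = Num.max (t - r)%R 0%R ->
  (forall r : R, (0 < r)%R -> (r <= eta)%R ->
    \int[leb]_(x in `]t, (t + r)%R]) m x <= (c * r)%:E) ->
  \int[leb]_(x in `]p, (t + 2 * r)%R]) m x <= (3 * c * r)%:E ->
  \int[leb]_(x in `](t + eta)%R, +oo[) m x <= D%:E ->
  \int[leb]_x (m x * arc_mass t r x) <=
    ((28 * c * Num.sqrt eta + 4 * (isqrt eta * D)) * r)%:E.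
Proof.
move=> t0 c0 r0 reta D0 pE mass mass_p tail.
have eta0 : (0 < eta)%R by lra.
pose A : set R := `]p, (t + 2 * r)%R]%classic.
pose A' : set R := `](t + 2 * r)%R, +oo[%classic.
have mA : measurable A by exact: measurable_itv.
have mA' : measurable A' by exact: measurable_itv.
have sr := sqrtr_ge0 r.
have arc0 x : 0 <= arc_mass t r x.
  by apply: integral_ge0 => y _; rewrite mule_ge0// lee_fin ?isqrt_ge0.
have m1 : measurable_fun setT (fun x => (4 * Num.sqrt r)%:E * ((\1_A x)%:E * m x)).
  apply: emeasurable_funM => //; apply: emeasurable_funM => //.
  by apply/measurable_EFinP; exact: measurable_indic.
have m2 : measurable_fun setT (fun x => (4 * r)%:E * ((\1_A' x)%:E * ((isqrt (x - t))%:E * m x))).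
  apply: emeasurable_funM => //; apply: emeasurable_funM; last exact: mk.
  by apply/measurable_EFinP; exact: measurable_indic.
have i1 x : 0 <= (4 * Num.sqrt r)%:E * ((\1_A x)%:E * m x).
  apply: mule_ge0; first by rewrite lee_fin mulr_ge0.
  by apply: mule_ge0.
have i2 x : 0 <= (4 * r)%:E * ((\1_A' x)%:E * ((isqrt (x - t))%:E * m x)).
  apply: mule_ge0; first by rewrite lee_fin mulr_ge0// ltW.
  by apply: mule_ge0.
have ind (B : set R) (f : R -> \bar R) :
    \int[leb]_x ((\1_B x)%:E * f x) = \int[leb]_(x in B) f x.
  rewrite [RHS]integral_mkcond; apply: eq_integral => x _.
  by rewrite patchE indicE; case: (x \in B); rewrite ?mul1e ?mul0e.
apply: (@le_trans _ _ (\int[leb]_x ((4 * Num.sqrt r)%:E * ((\1_A x)%:E * m x) +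
   (4 * r)%:E * ((\1_A' x)%:E * ((isqrt (x - t))%:E * m x))))).
  apply: ge0_le_integral => //.
  - by move=> x _; rewrite mule_ge0.
  - apply: emeasurable_funM => //.
    pose f (q : R * R) := ((\1_(`]0%R, +oo[%classic) q.2)%:E *
      ((isqrt (q.1 - q.2))%:E * ((`|q.2 - t| <= r)%R%:R)%:E)) : \bar R.
    have mf : measurable_fun setT f.
      apply: emeasurable_funM.
        apply/measurable_EFinP.
        by apply: (measurableT_comp (f := (\1_(`]0%R, +oo[%classic) : R -> R)) (g := snd)).
      apply: emeasurable_funM; apply/measurable_EFinP.
        by apply: (measurableT_comp measurable_isqrt); exact: measurable_funB.
      apply: (measurableT_comp (measurable_norm_le_nat r)); exact: measurable_funB.
    have f0 q : 0 <= f q by rewrite mule_ge0// mule_ge0// lee_fin isqrt_ge0.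
    have := @measurable_fun_fubini_tonelli_F _ _ (measurableTypeR R) (measurableTypeR R) R leb f mf f0.
    by apply: eq_measurable_fun => x _; rewrite /fubini_F /f /= ind.
  - by apply: emeasurable_funD.
  - move=> x _; apply: (@le_trans _ _ (m x * (4 * Num.sqrt r * \1_A x +
      4 * r * (isqrt (x - t) * \1_A' x))%:E)).
      by rewrite lee_wpmul2l//; exact: arc_mass_le.
    have a0 : (0 <= 4 * Num.sqrt r * \1_A x)%R by rewrite !mulr_ge0.
    have b0 : (0 <= 4 * r * (isqrt (x - t) * \1_A' x))%R.
      by apply: mulr_ge0; [rewrite mulr_ge0// ltW|rewrite mulr_ge0// isqrt_ge0].
    rewrite EFinD ge0_muleDr ?lee_fin//.
    rewrite le_eqVlt; apply/orP; left; apply/eqP; congr (_ + _).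
      by rewrite EFinM muleCA [X in _ * X]muleC.
    by rewrite !EFinM muleCA; congr (_ * _); rewrite muleC -muleA [RHS]muleCA.
have E1 : \int[leb]_x ((4 * Num.sqrt r)%:E * ((\1_A x)%:E * m x)) <=
    (4 * Num.sqrt r * (3 * c * r))%:E.
  rewrite ge0_integralZl//; last 2 first.
  - apply: emeasurable_funM; last exact: mm.
    by apply/measurable_EFinP; exact: measurable_indic.
  - by move=> x _; apply: mule_ge0.
  by rewrite ind [leRHS]EFinM lee_wpmul2l// lee_fin mulr_ge0.
have E2 : \int[leb]_x ((4 * r)%:E * ((\1_A' x)%:E * ((isqrt (x - t))%:E * m x))) <=
    (4 * r * (4 * c * Num.sqrt eta + isqrt eta * D))%:E.
  have r4 : 0 <= (4 * r)%:E by rewrite lee_fin mulr_ge0// ltW.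
  rewrite ge0_integralZl//; last 2 first.
  - apply: emeasurable_funM; last exact: mk.
    by apply/measurable_EFinP; exact: measurable_indic.
  - by move=> x _; apply: mule_ge0.
  rewrite ind [leRHS]EFinM lee_wpmul2l// EFinD.
  have -> : A' = `](t + 2 * r)%R, (t + eta)%R]%classic `|` `](t + eta)%R, +oo[%classic.
    by rewrite -itv_bndbnd_setU// bnd_simp lerD2l.
  rewrite ge0_integral_setU//=; last 2 first.
  - by apply: measurable_funTS; exact: mk.
  - apply/disj_setPS => x [] /=; rewrite !in_itv/= => /andP[_ xa] /andP[ax _].
    by move: (le_lt_trans xa ax); rewrite ltxx.
  apply: leeD; first by apply: isqrt_mass => //; lra.
  have te : (t < t + eta)%R by rewrite ltrDl.
  by have := kernel_le te tail; rewrite (_ : (t + eta - t = eta)%R)//; ring.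
rewrite ge0_integralD//; apply: (le_trans (leeD E1 E2)).
rewrite -EFinD lee_fin -subr_ge0.
have -> : ((28 * c * Num.sqrt eta + 4 * (isqrt eta * D)) * r -
    (4 * Num.sqrt r * (3 * c * r) + 4 * r * (4 * c * Num.sqrt eta + isqrt eta * D)) =
    12 * c * r * (Num.sqrt eta - Num.sqrt r))%R by ring.
apply: mulr_ge0; first by rewrite !mulr_ge0// ltW.
by rewrite subr_ge0 ler_wsqrtr//; lra.
Qed.

End local_mass.

(** * Consequences of the curvature hypothesis *)

Section population.
Context {R : realType} d0 (T0 : measurableType d0) (P0 : probability T0 R).
Variables (X : {RV P0 >-> (R * R * R)%type}) (Z : {RV P0 >-> R}).
Variables (nu : {sigma_finite_measure set R -> \bar R}) (rho : R * R -> R) (M : R).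
Hypotheses (rho_meas : measurable_fun [set p : R * R | 0 <= p.1 /\ 0 <= p.2] rho)
  (rho_ge0 : forall x z, 0 <= x -> 0 <= z -> 0 <= rho (x, z))
  (XZ_dens : has_radial_density P0 X Z nu rho)
  (M0 : 0 < M) (Z_le : {ae P0, forall w, `|Z w| <= M}).
Variable L : probability (R * R * R)%type R.
Hypothesis L_law : forall A, measurable A ->
  L A = P0 [set w | A ((X w).1.1, (X w).1.2, Z w)].

(** Equal to z almost surely, but nonnegative and bounded at every point, as the
    exponential inequality requires. *)
Definition clip (p : R * R * R) : R := Num.min (pospart p.2) M.
Definition radius2 (p : R * R * R) : R := sqnorm2 p.1.

Lemma clip_bound p : 0 <= clip p <= M.
Proof. by rewrite le_min pospart_ge0 (ltW M0)/= ge_min lexx orbT. Qed.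

Lemma measurable_clip : measurable_fun setT clip.
Proof.
by apply: measurable_minr => //; exact: (measurableT_comp measurable_pospart).
Qed.

Lemma measurable_radius2 : measurable_fun setT radius2.
Proof. exact: (measurableT_comp measurable_sqnorm2). Qed.

Local Open Scope ereal_scope.

Lemma integral_law (g : R * R * R -> \bar R) : measurable_fun setT g ->
  (forall p, 0 <= g p) ->
  \int[L]_p g p = \int[P0]_w g ((X w).1.1, (X w).1.2, Z w).
Proof.
move=> mg g0.
have mX1 : measurable_fun setT (fun w => (X w).1).
  exact: (measurableT_comp measurable_fst).
have mphi : measurable_fun setT (fun w => ((X w).1.1, (X w).1.2, Z w)).
  apply: measurable_fun_pair => //.
  apply: measurable_fun_pair.
    exact: (measurableT_comp measurable_fst mX1).
  exact: (measurableT_comp measurable_snd mX1).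
have := @transfer_integral _ _ T0 _ R P0 L (fun w => ((X w).1.1, (X w).1.2, Z w))
  (cst 1%R) (cst 1%R) mphi _ _ _ _ g _ mg g0.
move=> h; transitivity (\int[L]_p ((cst 1%R p)%:E * g p)).
  by apply: eq_integral => p _; rewrite mul1e.
rewrite -h//; first by apply: eq_integral => w _; rewrite mul1e.
move=> A mA.
transitivity (P0 [set w | A ((X w).1.1, (X w).1.2, Z w)]).
  rewrite -[X in P0 X]setIT -integral_indic//; last first.
    by rewrite -[X in measurable X]setTI; exact: mphi.
  by apply: eq_integral => w _; rewrite mul1r.
rewrite -L_law// -[X in L X]setIT -integral_indic//.
by apply: eq_integral => w _; rewrite mul1r.
Qed.

(** [expectation_abel] for the law L of one observation. *)
Lemma integral_law_abel (h : R -> \bar R) : measurable_fun setT h ->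
  (forall y, 0 <= h y) ->
  \int[L]_p ((clip p)%:E * h (radius2 p)) =
  \int[leb]_(y in `]0%R, +oo[) (h y * abel_mass nu rho y).
Proof.
move=> mh h0.
have mhr : measurable_fun setT (fun p => h (radius2 p)).
  exact: (measurableT_comp mh measurable_radius2).
have clip0 p : 0 <= (clip p)%:E by rewrite lee_fin; have /andP[] := clip_bound p.
rewrite integral_law; last 2 first.
- apply: emeasurable_funM => //; apply/measurable_EFinP; exact: measurable_clip.
- by move=> p; rewrite mule_ge0.
rewrite -(expectation_abel rho_meas rho_ge0 XZ_dens mh h0).
have mX1 : measurable_fun setT (fun w => (X w).1).
  exact: (measurableT_comp measurable_fst).
have mN : measurable_fun setT (fun w => h (sqnorm2 (X w).1)).
  apply: (measurableT_comp mh); exact: (measurableT_comp measurable_sqnorm2 mX1).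
apply: ge0_ae_eq_integral => //.
- apply: emeasurable_funM => //; apply/measurable_EFinP.
  apply: measurable_minr => //; exact: (measurableT_comp measurable_pospart).
- apply: emeasurable_funM => //; apply/measurable_EFinP.
  exact: (measurableT_comp measurable_pospart).
- by move=> w _; rewrite mule_ge0.
- by move=> w _; rewrite mule_ge0// lee_fin pospart_ge0.
- move: Z_le; apply: filterS => w Zw _ /=.
  rewrite /clip /radius2/= (min_idPl _)//.
  by rewrite ge_max (ltW M0) andbT (le_trans (ler_norm _)).
Qed.

(** The function f_x of the introduction; [Num.sqrt] is 0 on negative numbers, so
    no positive part is taken. *)
Definition score (x : R) (p : R * R * R) : R :=
  (clip p * (2 * (Num.sqrt (radius2 p) - Num.sqrt (radius2 p - x))))%R.

Lemma sqrt_increment (y x : R) : (0 <= x)%R ->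
  (0 <= 2 * (Num.sqrt y - Num.sqrt (y - x)) <= 2 * Num.sqrt x)%R.
Proof.
move=> x0; have h : (Num.sqrt (y - x) <= Num.sqrt y)%R by rewrite ler_wsqrtr// gerBl.
rewrite mulr_ge0 ?subr_ge0//= ler_pM2l//.
have := sqrt_holder y (y - x); rewrite ger0_norm ?subr_ge0// => /le_trans; apply.
by rewrite opprB addrCA subrr addr0 ger0_norm.
Qed.

Let measurable_increment (x : R) :
  measurable_fun setT (fun y : R => 2 * (Num.sqrt y - Num.sqrt (y - x)))%R.
Proof.
apply: measurable_funM => //; apply: measurable_funB; first exact: measurable_sqrt.
apply: (measurableT_comp measurable_sqrt); exact: measurable_funB.
Qed.

Lemma measurable_score (x : R) : measurable_fun setT (score x).
Proof.
apply: measurable_funM; first exact: measurable_clip.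
exact: (measurableT_comp (measurable_increment x) measurable_radius2).
Qed.

Lemma score_bound (x : R) p : (0 <= x)%R -> (0 <= score x p <= 2 * M * Num.sqrt x)%R.
Proof.
move=> x0; have /andP[h1 h2] := sqrt_increment (radius2 p) x0.
have /andP[h3 h4] := clip_bound p.
rewrite mulr_ge0//= [leRHS](_ : _ = M * (2 * Num.sqrt x))%R; last by ring.
exact: ler_pM.
Qed.

Lemma integral_Psi_score (x : R) : (0 <= x)%R ->
  \int[leb]_(t in `[0%R, x]) Psi_fun nu rho t = \int[L]_p (score x p)%:E.
Proof.
move=> x0; rewrite (integral_Psi_fun nu rho_meas rho_ge0 x0).
rewrite -(@integral_law_abel (fun y => (2 * (Num.sqrt y - Num.sqrt (y - x)))%:E)).
- by apply: eq_integral => p _; rewrite -EFinM.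
- exact/measurable_EFinP.
- by move=> y; rewrite lee_fin; have /andP[] := sqrt_increment y x0.
Qed.

(** The probability that Y is near t, weighted by Z, in terms of the radial mass:
    through this identity regularity of Psi near t limits the mass of Y near t. *)
Lemma concentration_arc_mass (t r : R) :
  \int[L]_p (clip p * (`|radius2 p - t| <= r)%R%:R)%:E =
  pi%:E * \int[leb]_x (radial_mass nu rho x * arc_mass t r x).
Proof.
have mh : measurable_fun setT (fun y : R => ((`|y - t| <= r)%R%:R)%:E : \bar R).
  apply/measurable_EFinP; apply: (measurableT_comp (measurable_norm_le_nat r)).
  exact: measurable_funB.
under eq_integral do rewrite EFinM.
rewrite (@integral_law_abel (fun y => ((`|y - t| <= r)%R%:R)%:E))//.
by rewrite (integral_abel_mass nu rho_meas rho_ge0 mh).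
Qed.

Let Psi := Psi_fun nu rho.

Lemma Psi_ge0 (t : R) : (0 <= t)%R -> 0 <= Psi t.
Proof.
move=> t0; rewrite /Psi Psi_funE// mule_ge0 ?lee_fin ?sqr_ge0//.
by apply: integral_ge0 => x _; exact: radial_mass_ge0.
Qed.

Lemma measurable_Psi : measurable_fun (`[0%R, +oo[%classic : set R) Psi.
Proof.
have mm := measurable_radial_mass nu rho_meas rho_ge0.
have ma := measurable_abel_mass nu rho_meas rho_ge0.
pose f (q : R * R) := (isqrt (q.2 - q.1))%:E * abel_mass nu rho q.2.
have mf : measurable_fun setT f.
  apply: emeasurable_funM; last exact: (measurableT_comp ma).
  by apply/measurable_EFinP; exact: measurable_isqrtB2.
have f0 q : 0 <= f q by rewrite mule_ge0 ?lee_fin ?isqrt_ge0// abel_mass_ge0.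
have := @measurable_fun_fubini_tonelli_F _ _ (measurableTypeR R) (measurableTypeR R) R leb f mf f0.
move=> mF; have : measurable_fun (`[0%R, +oo[%classic : set R) (fubini_F leb f).
  exact: measurable_funTS.
apply: eq_measurable_fun => t /set_mem /=; rewrite in_itv/= andbT => t0.
by rewrite /Psi Psi_fun_abel.
Qed.

Lemma Psi_split (a b : R) : (0 <= a)%R -> (a <= b)%R ->
  Psi a = (pi ^+ 2)%:E * \int[leb]_(x in `]a, b]) radial_mass nu rho x + Psi b.
Proof.
move=> a0 ab; have mm := measurable_radial_mass nu rho_meas rho_ge0.
have m0 := radial_mass_ge0 nu rho_ge0.
rewrite /Psi !Psi_funE ?(le_trans a0)//.
have -> : `]a, +oo[%classic = `]a, b]%classic `|` `]b, +oo[%classic.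
  by rewrite -itv_bndbnd_setU// bnd_simp.
rewrite ge0_integral_setU//=; last 2 first.
- exact: measurable_funTS.
- apply/disj_setPS => x [] /=; rewrite !in_itv/= => /andP[_ xa] /andP[ax _].
  by move: (le_lt_trans xa ax); rewrite ltxx.
by rewrite ge0_muleDr//; apply: integral_ge0.
Qed.

Lemma Psi_nonincreasing (a b : R) : (0 <= a)%R -> (a <= b)%R -> Psi b <= Psi a.
Proof.
move=> a0 ab; rewrite (Psi_split a0 ab) leeDr// mule_ge0 ?lee_fin ?sqr_ge0//.
by apply: integral_ge0 => x _; exact: radial_mass_ge0.
Qed.

Lemma integral_Psi_fin (x : R) : (0 <= x)%R -> \int[leb]_(t in `[0%R, x]) Psi t < +oo.
Proof.
move=> x0; rewrite /Psi integral_Psi_score//.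
apply: (@le_lt_trans _ _ (\int[L]_p (2 * M * Num.sqrt x)%:E)).
  apply: ge0_le_integral => //.
  - by move=> p _; rewrite lee_fin; have /andP[] := score_bound p x0.
  - by apply/measurable_EFinP; exact: measurable_score.
  - by move=> p _; rewrite lee_fin; have /andP[] := score_bound p x0.
rewrite integral_cst// [X in (_ * X)%E](_ : _ = 1%E) ?mule1 ?ltry//.
exact: probability_setT.
Qed.

(** Monotone convergence of the integrals of the radial mass over (1/n, oo). *)
Lemma Psi_sup_at0 (c : R) : (forall t : R, (0 < t)%R -> Psi t <= c%:E) -> Psi 0%R <= c%:E.
Proof.
move=> h; have mm := measurable_radial_mass nu rho_meas rho_ge0.
have m0 := radial_mass_ge0 nu rho_ge0.
have p0 : (0 < pi ^+ 2 :> R)%R by rewrite exprn_gt0// pi_gt0.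
rewrite /Psi Psi_funE// muleC -lee_pdivlMr//.
pose F n : set R := `](n.+1%:R^-1)%R, +oo[%classic.
have -> : `]0%R, +oo[%classic = \bigcup_n F n.
  apply/seteqP; split => [x /=|x [n _]]; rewrite /F/= !in_itv/= !andbT.
    move=> x0; exists (Num.bound x^-1) => //=; rewrite in_itv/= andbT.
    rewrite invf_plt ?posrE// (lt_trans (archi_boundP _)) ?invr_ge0 ?ltW// ltr_nat//.
  by move=> h1; rewrite (lt_trans _ h1)// invr_gt0.
have cv : \int[leb]_(x in F n) radial_mass nu rho x @[n --> \oo] -->
    \int[leb]_(x in \bigcup_n F n) radial_mass nu rho x.
  apply: ge0_nondecreasing_set_cvg_integral => //.
  - move=> i j ij; rewrite subsetEset => x; rewrite /F/= !in_itv/= !andbT.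
    by apply: le_lt_trans; rewrite lef_pV2 ?posrE// ler_nat.
  - by move=> n; exact: measurable_itv.
  - by move=> n; exact: measurable_funTS.
rewrite -(cvg_lim _ cv)//; apply: lime_le; first by apply: cvgP cv.
apply: nearW => n; rewrite lee_pdivlMr// muleC -Psi_funE ?invr_ge0//.
by apply: h; rewrite invr_gt0.
Qed.

End population.

Section population_bounds.
Context {R : realType} d0 (T0 : measurableType d0) (P0 : probability T0 R).
Variables (X : {RV P0 >-> (R * R * R)%type}) (Z : {RV P0 >-> R}).
Variables (nu : {sigma_finite_measure set R -> \bar R}) (rho : R * R -> R) (M : R).
Hypotheses (rho_meas : measurable_fun [set p : R * R | 0 <= p.1 /\ 0 <= p.2] rho)
  (rho_ge0 : forall x z, 0 <= x -> 0 <= z -> 0 <= rho (x, z))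
  (XZ_dens : has_radial_density P0 X Z nu rho)
  (M0 : 0 < M) (Z_le : {ae P0, forall w, `|Z w| <= M}).
Variable L : probability (R * R * R)%type R.
Hypothesis L_law : forall A, measurable A ->
  L A = P0 [set w | A ((X w).1.1, (X w).1.2, Z w)].
Variables t0 t1 : R.
Hypotheses (t0_ge0 : 0 <= t0) (t01 : t0 < t1)
  (U_C2 : twice_continuously_differentiable (U_fun nu rho) t0 t1)
  (U''_lt0 : 0 < inf [set - derive_ge0 (derive_ge0 (U_fun nu rho)) t | t in `[t0, t1]]).

Let Psi := Psi_fun nu rho.
Let U := U_fun nu rho.
Let p t := fine (Psi t).

Let Psi0 := Psi_ge0 nu rho_meas rho_ge0.
Let mPsi := measurable_Psi nu rho_meas rho_ge0.
Let Psi_dec := Psi_nonincreasing nu rho_meas rho_ge0.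
Let Psi_fin := integral_Psi_fin rho_meas rho_ge0 XZ_dens M0 Z_le L_law.
Let Psi_sup0 := @Psi_sup_at0 _ nu _ rho_meas rho_ge0.

Let derE t (t_ge0 : 0 <= t) (dU : derivable_ge0 U t) :
  Psi t \is a fin_num /\ derive_ge0 U t = p t :=
  derive_ge0_primitive Psi0 mPsi Psi_dec Psi_fin Psi_sup0 t_ge0 dU.

Let slopes : exists c C eta : R, [/\ 0 < c, 0 < C, 0 < eta &
  forall s s' : R, 0 <= s -> s < s' -> s' - s <= eta ->
    (t0 <= s <= t1) || (t0 <= s' <= t1) ->
    [/\ Psi s \is a fin_num, Psi s' \is a fin_num &
     c * (s' - s) <= p s - p s' <= C * (s' - s)]].
Proof.
have U_p t (h : 0 <= t) (dU : derivable_ge0 U t) : derive_ge0 U t = p t.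
  exact: (derE h dU).2.
have [c [C [eta [c0 C0 eta0 h]]]] := slope_bounds t0_ge0 t01 U_p U_C2 U''_lt0.
exists c, C, eta; split => // s s' s0 ss' se o.
have [d d' b] := h s s' s0 ss' se o.
have s'0 : 0 <= s' by rewrite (le_trans s0)// ltW.
by split => //; [exact: (derE s0 d).1|exact: (derE s'0 d').1].
Qed.

Lemma mass_difference (a b : R) : 0 <= a -> a <= b ->
  Psi a \is a fin_num -> Psi b \is a fin_num ->
  (\int[leb]_(x in `]a, b]) radial_mass nu rho x)%E = ((p a - p b) / pi ^+ 2)%:E.
Proof.
move=> a0 ab fa fb.
have p0 : 0 < pi ^+ 2 :> R by rewrite exprn_gt0// pi_gt0.
set I := (\int[leb]_(x in _) _)%E.
have h : (Psi a = (pi ^+ 2)%:E * I + Psi b)%E by exact: Psi_split.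
have h' : (I * (pi ^+ 2)%:E)%E = (p a - p b)%:E.
  by rewrite EFinB /p (fineK fa) (fineK fb) h muleC addeK.
have Ifin : I \is a fin_num.
  have I0 : (0 <= I)%E by apply: integral_ge0 => x _; exact: radial_mass_ge0.
  rewrite ge0_fin_numE// ltNge leye_eq; apply/negP => /eqP IE.
  by move: h'; rewrite IE gt0_mulye// lte_fin.
by move: h'; rewrite -(fineK Ifin) -EFinM => -[<-]; rewrite mulfK// gt_eqF.
Qed.

(** All that the probabilistic part needs to know about U; b is U'.  The lower
    bound p1 = U'(t1) is positive because U' is nonnegative at t1 + eta and
    decreases at a positive rate before. *)
Lemma population_bounds : exists (b : R -> R) (C p1 p2 : R),
  [/\ 0 <= C /\ 0 < p1,
   forall t, t0 <= t <= t1 -> p1 <= b t <= p2,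
   forall t r : R, t0 <= t <= t1 -> 0 < r ->
     (\int[L]_q (clip M q * (`|radius2 q - t| <= r)%R%:R)%:E <= (C * r)%:E)%E &
   forall B : R, t1 <= B -> exists2 kappa : R, 0 < kappa &
     forall t s : R, t0 <= t <= t1 -> 0 <= s <= B ->
     U s <= U t + b t * (s - t) - 2 * kappa * (s - t) ^+ 2].
Proof.
have [c [C [eta [c0 C0 eta0 sl]]]] := slopes.
have ge0 t : t0 <= t <= t1 -> 0 <= t by move=> /andP[h _]; exact: le_trans h.
have right_ t r : t0 <= t <= t1 -> 0 < r -> r <= eta ->
    [/\ Psi t \is a fin_num, Psi (t + r) \is a fin_num &
        c * r <= p t - p (t + r) <= C * r].
  move=> tt r0 re; have := sl t (t + r) (ge0 _ tt).
  by rewrite ltrDl tt addrAC subrr add0r => /(_ r0 re isT).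
have fin t : t0 <= t <= t1 -> Psi t \is a fin_num.
  by move=> tt; have [] := right_ t eta tt eta0 (lexx _).
have dec := integrand_nonincreasing Psi0 mPsi Psi_dec Psi_fin.
have tt0 : t0 <= t0 <= t1 by rewrite lexx ltW.
have tt1 : t0 <= t1 <= t1 by rewrite lexx ltW.
have pge0 := integrand_ge0 Psi0.
have pi2 : 0 < pi ^+ 2 :> R by rewrite exprn_gt0// pi_gt0.
pose c' := C / pi ^+ 2; have c'0 : 0 <= c' by rewrite divr_ge0 ?ltW.
pose D := p t0 / pi ^+ 2; have D0 : 0 <= D by rewrite divr_ge0 ?(ltW pi2)// pge0.
pose K := pi * (28 * c' * Num.sqrt eta + 4 * (isqrt eta * D)).
have K0 : 0 <= K.
  rewrite mulr_ge0 ?pi_ge0// addr_ge0// mulr_ge0 ?sqrtr_ge0// mulr_ge0//.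
  exact: isqrt_ge0.
exists p, (K + 2 * M / eta), (p t1), (p t0); split.
- split; first by rewrite addr_ge0// divr_ge0 ?mulr_ge0 ?ltW.
  have [_ _ /andP[h _]] := right_ t1 eta tt1 eta0 (lexx _).
  have h2 : 0 <= p (t1 + eta) by apply: pge0; rewrite addr_ge0 ?(ltW eta0) ?(ge0 _ tt1).
  apply: lt_le_trans (mulr_gt0 c0 eta0) _; apply: le_trans h _; by rewrite gerBl.
- move=> t tt; have /andP[h1 h2] := tt; apply/andP; split; apply: dec => //.
  + exact: ge0.
  + exact: fin.
  + exact: fin.
- move=> t r tt r0; have t_ge0 := ge0 t tt.
  have C2 : 0 <= 2 * M / eta by rewrite divr_ge0 ?mulr_ge0 ?ltW.
  have [re|er] := leP (2 * r) eta; last first.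
    apply: (@le_trans _ _ (\int[L]_q M%:E)%E).
      apply: ge0_le_integral => //.
      + by move=> q _; rewrite lee_fin; have /andP[h _] := clip_bound M0 q; rewrite mulr_ge0.
      + apply/measurable_EFinP; apply: measurable_funM; first exact: measurable_clip.
        apply: (measurableT_comp (measurable_norm_le_nat r)).
        by apply: measurable_funB => //; exact: measurable_radius2.
      + move=> q _; rewrite lee_fin; have /andP[h h'] := clip_bound M0 q.
        by rewrite (le_trans _ h')// ler_piMr// lern1 leq_b1.
    rewrite integral_cst// [X in (_ * X)%E](_ : _ = 1%E) ?mule1; last exact: probability_setT.
    rewrite lee_fin mulrDl; apply: (@le_trans _ _ (2 * M / eta * r)).
      by rewrite mulrAC ler_pdivlMr// mulrAC mulrC ler_wpM2r ?ltW//.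
    by rewrite lerDr mulr_ge0// ltW.
  rewrite (concentration_arc_mass rho_meas rho_ge0 XZ_dens M0 Z_le L_law).
  have mm := measurable_radial_mass nu rho_meas rho_ge0.
  have m0 := radial_mass_ge0 nu rho_ge0.
  have mass s : 0 < s -> s <= eta ->
      (\int[leb]_(x in `]t, (t + s)%R]) radial_mass nu rho x <= (c' * s)%:E)%E.
    move=> s0 se; have [f1 f2 /andP[_ h]] := right_ t s tt s0 se.
    rewrite mass_difference ?lerDl ?(ltW s0)// lee_fin /c' mulrAC ler_wpM2r//.
    by rewrite invr_ge0 ltW.
  have r20 : 0 < 2 * r by rewrite mulr_gt0.
  pose q := Num.max (t - r) 0.
  have mass_q : (\int[leb]_(x in `]q, (t + 2 * r)%R]) radial_mass nu rho x <= (3 * c' * r)%:E)%E.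
    have q0 : 0 <= q by rewrite le_max lexx orbT.
    have qt : q <= t by rewrite ge_max t_ge0 andbT; lra.
    have qr : t - q <= r by rewrite lerBlDl -lerBlDr le_max lexx.
    have [f1 f2 /andP[_ h]] := right_ t (2 * r) tt r20 re.
    have [fq hq] : Psi q \is a fin_num /\ p q - p t <= C * (t - q).
      move: (qt); rewrite le_eqVlt => /predU1P[->|qt'].
        by rewrite !subrr mulr0; split => //; exact: fin.
      have := sl q t q0 qt'; rewrite tt orbT => /(_ _ isT)[|g1 g2 /andP[_ g]//].
      by rewrite (le_trans qr)// (le_trans _ re)// ler_peMl ?(ltW r0)// ler1n.
    rewrite mass_difference//; last by rewrite (le_trans qt)// lerDl ltW.
    rewrite lee_fin ler_pdivrMr//.
    have -> : 3 * c' * r * pi ^+ 2 = C * r + C * (2 * r).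
      have -> : 3 * c' * r * pi ^+ 2 = 3 * r * (c' * pi ^+ 2) by ring.
      by rewrite /c' divfK ?gt_eqF//; ring.
    have h' : C * (t - q) <= C * r by rewrite ler_pM2l.
    rewrite -(subrKA (p t)); apply: lerD => //; exact: le_trans h'.
  have tail : (\int[leb]_(x in `](t + eta)%R, +oo[) radial_mass nu rho x <= D%:E)%E.
    have te : 0 <= t + eta by rewrite addr_ge0// ltW.
    have [f1 f2 _] := right_ t eta tt eta0 (lexx _).
    rewrite /D EFinM lee_pdivlMr// muleC -Psi_funE// -/Psi -(fineK f2) lee_fin.
    have /andP[t0t _] := tt.
    have t0te : t0 <= t + eta by rewrite (le_trans t0t)// lerDl ltW.
    exact: (dec t0 (t + eta) t0_ge0 (fin t0 tt0) t0te).
  have := integral_arc_mass mm m0 t_ge0 c'0 r0 re D0 erefl mass mass_q tail.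
  move=> h; apply: (le_trans (lee_wpmul2l _ h)); first by rewrite lee_fin pi_ge0.
  rewrite -EFinM lee_fin [leLHS]mulrA [leRHS]mulrDl -/K lerDl.
  by rewrite mulr_ge0// ltW.
- move=> B tB.
  have B0 : 0 < B by rewrite (lt_le_trans _ tB)// (le_lt_trans t0_ge0).
  have slope s s' : 0 <= s -> s < s' -> s' - s <= eta ->
    (t0 <= s <= t1) || (t0 <= s' <= t1) -> c * (s' - s) <= p s - p s'.
    by move=> h1 h2 h3 h4; have [_ _ /andP[]] := sl s s' h1 h2 h3 h4.
  exact: (strict_supergradient Psi0 mPsi Psi_dec Psi_fin t0_ge0 c0 eta0 B0 tB slope fin).
Qed.

End population_bounds.

(** * From a grid to the least concave majorant *)

Section majorant.
Context {R : realType}.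

Lemma affine_majorant (f : R -> R) (u v : R) :
  (forall x, 0 <= x -> f x <= u + v * x) ->
  concave_majorant_ge0 f (fun x => u + v * x).
Proof.
move=> fl; split => // t x y _ _ /=.
pose p : R := t%:inum.
suff : - (u + v * (p * x + (1 - p) * y)) <= p * - (u + v * x) + (1 - p) * - (u + v * y).
  by [].
by rewrite le_eqVlt; apply/orP; left; apply/eqP; ring.
Qed.

Lemma grid_point (N : nat) (h x : R) : 0 < h -> 0 <= x ->
  x <= N%:R * h -> exists2 k : nat, (k <= N)%N & k%:R * h <= x < k%:R * h + h.
Proof.
move=> h0 x0 xN; pose k := Num.truncn (x / h).
have xh : 0 <= x / h by rewrite divr_ge0// ltW.
have /andP[k1 k2] := truncn_itv xh; rewrite -/k in k1 k2.
exists k.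
  by rewrite -(ler_nat R) (le_trans k1)// ler_pdivrMr.
rewrite -ler_pdivlMr// k1/=.
by rewrite -[X in _ + X]mul1r -mulrDl natr1 -ltr_pdivrMr.
Qed.

(** The line of slope beta through (tau, f tau), raised by e plus the oscillation
    2 M sqrt h of f over a cell of the grid, is above f: at grid points by
    assumption, inside a cell because f and the line increase, and beyond the grid
    because a slope of at least p1 / 2 beats the square root.  So it is above the
    majorant, and at t near tau it exceeds f by little. *)
Lemma majorant_from_grid (f ft : R -> R) (t0 t1 B h M p1 beta e tau : R) (N : nat) :
  least_concave_majorant_ge0 f ft -> 0 < h -> B = N%:R * h ->
  (forall s s', 0 <= s -> s <= s' ->
     f s <= f s' <= f s + 2 * M * Num.sqrt (s' - s)) ->
  f 0 = 0 -> 0 < p1 -> p1 / 2 <= beta -> 0 <= t0 -> t0 <= tau <= t1 ->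
  (forall s, B <= s -> 2 * M * Num.sqrt s <= p1 / 2 * (s - t1)) ->
  0 <= e -> 0 <= M ->
  (forall k, (k <= N)%N -> f (k%:R * h) <= f tau + beta * (k%:R * h - tau) + e) ->
  forall t, tau <= t -> t < tau + h ->
    f t <= ft t <= f t + (beta * h + e + 2 * M * Num.sqrt h).
Proof.
move=> [[_ fft] lcm] h0 BE inc f0 p10 pb t0_ge0 /andP[t0tau taut1] far e0 M0 grid t taut tth.
have tau0 : 0 <= tau by exact: le_trans t0tau.
have t_ge0 : 0 <= t by exact: le_trans taut.
have b0 : 0 <= beta by rewrite (le_trans _ pb)// divr_ge0 ?ltW.
have Mh : 0 <= 2 * M * Num.sqrt h by rewrite mulr_ge0 ?sqrtr_ge0// mulr_ge0.
rewrite fft//=.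
have fge0 x : 0 <= x -> 0 <= f x.
  by move=> x0; have /andP[h1 _] := inc 0 x (lexx _) x0; rewrite -f0.
pose u := f tau - beta * tau + e + 2 * M * Num.sqrt h.
have maj x : 0 <= x -> f x <= u + beta * x.
  move=> x0; have [Bx|xB] := leP B x.
    have /andP[_ h1] := inc 0 x (lexx _) x0; rewrite f0 add0r subr0 in h1.
    have h2 := far x Bx.
    have xt1 : 0 <= x - t1.
      have : 0 <= p1 / 2 * (x - t1).
        by rewrite (le_trans _ h2)// mulr_ge0 ?sqrtr_ge0// mulr_ge0.
      by rewrite pmulr_rge0// divr_gt0.
    have h3 : p1 / 2 * (x - t1) <= beta * (x - tau).
      by apply: ler_pM => //; [rewrite divr_ge0 ?ltW|rewrite lerD2l lerN2].
    have h4 := fge0 tau tau0.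
    have -> : u + beta * x = f tau + beta * (x - tau) + e + 2 * M * Num.sqrt h.
      by rewrite /u; ring.
    move: h1 h2 h3 h4 e0 Mh; clear; lra.
  have xN : x <= N%:R * h by rewrite -BE ltW.
  have [k kN /andP[k1 k2]] := grid_point h0 x0 xN.
  have kh0 : 0 <= k%:R * h by rewrite mulr_ge0// ltW.
  have /andP[_ h1] := inc _ _ kh0 k1.
  have h2 := grid k kN.
  have h3 : 2 * M * Num.sqrt (x - k%:R * h) <= 2 * M * Num.sqrt h.
    by rewrite ler_wpM2l ?mulr_ge0// ler_wsqrtr// lerBlDl ltW.
  have h4 : beta * (k%:R * h - tau) <= beta * (x - tau).
    by rewrite ler_wpM2l// lerD2r.
  have -> : u + beta * x = f tau + beta * (x - tau) + e + 2 * M * Num.sqrt h.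
    by rewrite /u; ring.
  move: h1 h2 h3 h4; clear; lra.
have := lcm _ (affine_majorant maj) t t_ge0.
have /andP[h1 _] := inc _ _ tau0 taut.
have h2 : beta * (t - tau) <= beta * h by rewrite ler_wpM2l// lerBlDl ltW.
have -> : u + beta * t = f tau + beta * (t - tau) + e + 2 * M * Num.sqrt h.
  by rewrite /u; ring.
move: h1 h2; clear; lra.
Qed.

End majorant.

(** * The good event *)

Section union_bound.
Context {R : realType} d (T : measurableType d) (P : probability T R).

Lemma union_bound (N : nat) (E : nat -> set T) (c : R) :
  (forall i, (i < N)%N -> measurable (E i)) ->
  (forall i, (i < N)%N -> (P (E i) <= c%:E)%E) ->
  measurable (\big[setU/set0]_(i < N) E i) /\
  (P (\big[setU/set0]_(i < N) E i) <= (N%:R * c)%:E)%E.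
Proof.
elim: N => [|N IH] mE cE.
  by rewrite big_ord0 measure0 mul0r; split.
have [m1 c1] := IH (fun i h => mE i (ltnW h)) (fun i h => cE i (ltnW h)).
rewrite big_ord_recr/=; split; first by apply: measurableU => //; exact: mE.
apply: (le_trans (measureU2 _ m1 (mE N (ltnSn N)))).
by rewrite -natr1 mulrDl mul1r EFinD; apply: leeD => //; exact: cE.
Qed.

Lemma setU_bound (A B : set T) (a b : R) : measurable A -> measurable B ->
  (P A <= a%:E)%E -> (P B <= b%:E)%E ->
  measurable (A `|` B) /\ (P (A `|` B) <= (a + b)%:E)%E.
Proof.
move=> mA mB hA hB; split; first exact: measurableU.
by apply: (le_trans (measureU2 _ mA mB)); rewrite EFinD; exact: leeD.
Qed.

Lemma notin_bigsetU (N : nat) (E : nat -> set T) (w : T) (i : nat) :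
  ~ (\big[setU/set0]_(i < N) E i) w -> (i < N)%N -> ~ E i w.
Proof.
move=> h iN Ei; apply: h; rewrite -bigcup_mkord; by exists i.
Qed.

Context d' (T' : measurableType d') (S : nat -> {RV P >-> T'}).

Let measurable_sum_obs (g : T' -> R) (n : nat) : measurable_fun setT g ->
  measurable_fun setT (fun w => \sum_(i < n) g (S i w)).
Proof. by move=> mg; apply: measurable_sum => i; exact: measurableT_comp. Qed.

Lemma measurable_sum_gt (g : T' -> R) (c : R) (n : nat) : measurable_fun setT g ->
  measurable [set w | c < \sum_(i < n) g (S i w)].
Proof.
move=> mg.
rewrite (_ : mkset _ = (fun w => \sum_(i < n) g (S i w)) @^-1` `]c, +oo[).
  by rewrite -[X in measurable X]setTI; apply: measurable_sum_obs.
by apply/seteqP; split => w /=; rewrite in_itv/= andbT.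
Qed.

Lemma measurable_sum_lt (g : T' -> R) (c : R) (n : nat) : measurable_fun setT g ->
  measurable [set w | \sum_(i < n) g (S i w) < c].
Proof.
move=> mg.
rewrite (_ : mkset _ = (fun w => \sum_(i < n) g (S i w)) @^-1` `]-oo, c[).
  by rewrite -[X in measurable X]setTI; apply: measurable_sum_obs.
by apply/seteqP; split => w /=; rewrite in_itv/=.
Qed.

Lemma mean_combination (L : probability T' R) (f1 f2 f3 : T' -> R) (c B : R) :
  measurable_fun setT f1 -> measurable_fun setT f2 -> measurable_fun setT f3 ->
  (forall p, `|f1 p| <= B) -> (forall p, `|f2 p| <= B) -> (forall p, `|f3 p| <= B) ->
  mean L (fun p => f1 p - f2 p - c * f3 p) = mean L f1 - mean L f2 - c * mean L f3.
Proof.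
move=> m1 m2 m3 b1 b2 b3.
have int (f : T' -> R) : measurable_fun setT f -> (forall p, `|f p| <= B) ->
    L.-integrable setT (EFin \o f).
  move=> mf bf; apply: (@le_integrable _ _ _ L setT _ _ (cst B%:E)) => //.
  - exact/measurable_EFinP.
  - by move=> p _ /=; rewrite lee_fin (le_trans (bf p))// ler_norm.
  - exact: finite_measure_integrable_cst.
have i1 := int _ m1 b1; have i2 := int _ m2 b2; have i3 := int _ m3 b3.
have i4 : L.-integrable setT (EFin \o (fun p => c * f3 p)).
  by have := integrableZl measurableT c i3; apply: eq_integrable.
have i5 : L.-integrable setT (EFin \o (fun p => f1 p - f2 p)).
  by have := integrableB measurableT i1 i2; apply: eq_integrable.
rewrite -[LHS]/(Rintegral L setT (fun p => f1 p - f2 p - c * f3 p)).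
by rewrite RintegralB// RintegralB// RintegralZl.
Qed.

End union_bound.

Section sample.
Context {R : realType} d (T : measurableType d) (P : probability T R).
Variable L : probability (R * R * R)%type R.
Variable S : nat -> {RV P >-> (R * R * R)%type}.
Variables (M : R) (U b : R -> R) (t0 t1 B kappa C p1 p2 : R).
Hypotheses (S_indep : mutually_independent S)
  (S_law : forall i A, measurable A -> P (S i @^-1` A) = L A)
  (M0 : 0 < M) (L_range : L [set p | ~ (0 <= p.2 <= M)] = 0%E)
  (U_mean : forall x, 0 <= x -> U x = mean L (score M x))
  (t0_ge0 : 0 <= t0) (t01 : t0 < t1) (C0 : 0 <= C) (p10 : 0 < p1) (kappa0 : 0 < kappa)
  (b_bounds : forall t, t0 <= t <= t1 -> p1 <= b t <= p2)
  (conc : forall t r : R, t0 <= t <= t1 -> 0 < r ->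
     (\int[L]_q (clip M q * (`|radius2 q - t| <= r)%R%:R)%:E <= (C * r)%:E)%E)
  (U_strict : forall t s : R, t0 <= t <= t1 -> 0 <= s <= B ->
     U s <= U t + b t * (s - t) - 2 * kappa * (s - t) ^+ 2).

Definition sample_mean (g : R * R * R -> R) (n : nat) (w : T) : R :=
  n%:R^-1 * \sum_(i < n) g (S i w).

Let rem delta t s := weighted_remainder (clip M) (@radius2 R) delta t (s - t).
Let trunc delta t := weighted_trunc (clip M) (@radius2 R) delta t.

Let remE delta t s p :
  rem delta t s p = score M s p - score M t p - (s - t) * trunc delta t p.
Proof.
rewrite /rem /trunc /weighted_remainder /weighted_trunc /score /remainder.
rewrite (_ : radius2 p - t - (s - t) = radius2 p - s); last by ring.
by ring.
Qed.

Let mclip := measurable_clip M.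
Let mradius := @measurable_radius2 R.
Let clipM := clip_bound M0.

Let mtrunc delta t : measurable_fun setT (trunc delta t).
Proof.
apply: measurable_funM => //; apply: (measurableT_comp (measurable_trunc_isqrt delta)).
exact: measurable_funB.
Qed.

Let mrem delta t s : measurable_fun setT (rem delta t s).
Proof.
apply: measurable_funM => //; apply: (measurableT_comp (measurable_remainder delta (s - t))).
exact: measurable_funB.
Qed.

Let mean_rem delta t s : 0 < delta -> 0 <= t -> 0 <= s ->
  mean L (rem delta t s) = U s - U t - (s - t) * mean L (trunc delta t).
Proof.
move=> delta0 t_ge0 s0; rewrite !U_mean//.
have remF : rem delta t s = (fun p => score M s p - score M t p - (s - t) * trunc delta t p).
  by apply: funext => p; exact: remE.
rewrite remF.
pose V := 2 * M * Num.sqrt s + 2 * M * Num.sqrt t + M * isqrt delta.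
have M20 : 0 <= 2 * M by rewrite mulr_ge0// ltW.
have v1 : 0 <= 2 * M * Num.sqrt s by rewrite mulr_ge0 ?sqrtr_ge0.
have v2 : 0 <= 2 * M * Num.sqrt t by rewrite mulr_ge0 ?sqrtr_ge0.
have v3 : 0 <= M * isqrt delta by rewrite mulr_ge0 ?isqrt_ge0// ltW.
apply: (@mean_combination _ _ _ L _ _ _ _ V).
- exact: measurable_score.
- exact: measurable_score.
- exact: mtrunc.
- move=> p; have /andP[h1 h2] := score_bound M0 p s0.
  by rewrite ger0_norm// (le_trans h2)// /V -addrA lerDl addr_ge0.
- move=> p; have /andP[h1 h2] := score_bound M0 p t_ge0.
  by rewrite ger0_norm// (le_trans h2)// /V addrAC lerDr addr_ge0.
- move=> p; have /andP[z0 zM] := clipM p.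
  have /andP[h1 h2] := trunc_isqrt_bound (radius2 p - t) delta0.
  rewrite /trunc /weighted_trunc ger0_norm ?mulr_ge0//.
  rewrite (@le_trans _ _ (M * isqrt delta)) ?ler_pM//.
  - by rewrite /V lerDr addr_ge0.
  - exact: isqrt_ge0.
Qed.

(** The bad event collects the large deviations of the remainders for all pairs
    (tau, s), of the truncated derivatives for all tau, and the observations with Z
    outside [0, M].  Off it the slope b(tau) + (P_n - P) phi_tau works: in
      P_n (f_s - f_tau) = U s - U tau + (s - tau) (P_n - P) phi_tau + (P_n - P) W
    the quadratic defect of U s - U tau - b(tau) (s - tau) pays for the part
    kappa (s - tau)^2 of the last term, while K delta^2 is the error. *)
Lemma good_event : exists2 K, 0 <= K & exists2 delta0, 0 < delta0 &
  forall n delta h N, (0 < n)%N -> 0 < delta -> delta <= delta0 -> 0 < h ->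
  B = N%:R * h ->
  let c := expR (- (5 * (n%:R * delta ^+ 2))) in
  exists Bad : set T, [/\ measurable Bad,
    (P Bad <= (N.+1%:R * (N.+1%:R * c + (c + c)))%:E)%E &
    forall w, ~ Bad w -> (forall i, (i < n)%N -> 0 <= (S i w).2 <= M) /\
    forall j, (j <= N)%N -> exists2 beta, p1 / 2 <= beta <= p2 + p1 / 2 &
      forall k, (k <= N)%N ->
      sample_mean (score M (k%:R * h)) n w <=
      sample_mean (score M (Num.min (t0 + j%:R * h) t1)) n w +
      beta * (k%:R * h - Num.min (t0 + j%:R * h) t1) + K * delta ^+ 2].
Proof.
have [K [K0 [delta1 d10 hrem]]] :=
  remainder_deviation S_indep S_law mclip mradius M0 clipM C0 kappa0.
have p120 : 0 < p1 / 2 by rewrite divr_gt0.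
have [delta2 d20 htr] := trunc_isqrt_deviation S_indep S_law mclip mradius M0 clipM p120.
exists K => //; exists (Num.min delta1 delta2); first by rewrite lt_min d10.
move=> n delta h N n0 delta0; rewrite le_min => /andP[dd1 dd2] h0 BE c.
have n0' : 0 < n%:R :> R by rewrite ltr0n.
(* the base points start at t0 and are capped at t1, since the population bounds
   hold on [t0, t1] only; the points s are the multiples of h *)
pose tau j := Num.min (t0 + j%:R * h) t1.
have tauI j : t0 <= tau j <= t1.
  by rewrite le_min (ltW t01) andbT lerDl mulr_ge0 ?(ltW h0)//= ge_min lexx orbT.
have tau0 j : 0 <= tau j by have /andP[h1 _] := tauI j; exact: le_trans h1.
pose E j k := [set w | n%:R * (mean L (rem delta (tau j) (k%:R * h)) +
  (kappa * (k%:R * h - tau j) ^+ 2 + K * delta ^+ 2)) <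
  \sum_(i < n) rem delta (tau j) (k%:R * h) (S i w)].
pose F j := [set w | n%:R * (mean L (trunc delta (tau j)) + p1 / 2) <
  \sum_(i < n) trunc delta (tau j) (S i w)].
pose G j := [set w | \sum_(i < n) trunc delta (tau j) (S i w) <
  n%:R * (mean L (trunc delta (tau j)) - p1 / 2)].
pose O i := S i @^-1` [set p | ~ (0 <= p.2 <= M)].
pose D j := (\big[setU/set0]_(k < N.+1) E j k) `|` (F j `|` G j).
have cE j k : (P (E j k) <= c%:E)%E.
  by apply: hrem => // r r0; exact: conc.
have [mU cU] : measurable (\big[setU/set0]_(j < N.+1) D j) /\
    (P (\big[setU/set0]_(j < N.+1) D j) <= (N.+1%:R * (N.+1%:R * c + (c + c)))%:E)%E.
  have mcD j : measurable (D j) /\ (P (D j) <= (N.+1%:R * c + (c + c))%:E)%E.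
    have mE k : measurable (E j k) by apply: measurable_sum_gt; exact: mrem.
    have [m1 c1] := @union_bound _ _ _ P N.+1 (E j) c (fun k _ => mE k) (fun k _ => cE j k).
    have [f1 f2] := htr delta (tau j) n delta0 dd2.
    have mF : measurable (F j) by apply: measurable_sum_gt; exact: mtrunc.
    have mG : measurable (G j) by apply: measurable_sum_lt; exact: mtrunc.
    have [m2 c2] := setU_bound mF mG f1 f2.
    exact: setU_bound.
  by apply: union_bound => i _; have [] := mcD i.
have mrange : measurable [set p : R * R * R | ~ (0 <= p.2 <= M)].
  rewrite (_ : mkset _ = snd @^-1` (~` `[0, M]%classic)).
    rewrite -[X in measurable X]setTI; apply: (@measurable_snd _ _ (R * R)%type R) => //.
    exact: (measurableC (measurable_itv `[0, M])).
  by apply/seteqP; split => p /=; rewrite in_itv/=.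
have [mO cO] : measurable (\big[setU/set0]_(i < n) O i) /\
    (P (\big[setU/set0]_(i < n) O i) <= (n%:R * 0)%:E)%E.
  apply: union_bound => i _; last by rewrite S_law// L_range.
  by rewrite -[X in measurable X]setTI; apply: measurable_funP.
exists ((\big[setU/set0]_(j < N.+1) D j) `|` (\big[setU/set0]_(i < n) O i)); split.
- exact: measurableU.
- have [_] := setU_bound mU mO cU cO.
  by rewrite mulr0 addr0.
move=> w nBad; split.
  move=> i iN; apply: contrapT => hi.
  have := @notin_bigsetU _ T n O w i _ iN; apply => // hO.
  by apply: nBad; right.
move=> j jN.
have nD : ~ D j w.
  by apply: (@notin_bigsetU _ T N.+1 D w j) => // hD; apply: nBad; left.
set mu := mean L (trunc delta (tau j)).
set phi := sample_mean (trunc delta (tau j)) n w.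
have phiE : \sum_(i < n) trunc delta (tau j) (S i w) = n%:R * phi.
  by rewrite /phi /sample_mean mulVKf// gt_eqF.
have phi1 : phi - mu <= p1 / 2.
  have : ~ F j w by move=> h1; apply: nD; right; left.
  by rewrite /F/= phiE ltr_pM2l// => /negP; rewrite -leNgt -/mu lerBlDl.
have phi2 : - (p1 / 2) <= phi - mu.
  have : ~ G j w by move=> h1; apply: nD; right; right.
  by rewrite /G/= phiE ltr_pM2l// => /negP; rewrite -leNgt -/mu lerBrDl.
exists (b (tau j) + (phi - mu)).
  have /andP[h1 h2] := b_bounds (tauI j).
  by apply/andP; split; lra.
move=> k kN; rewrite -/(tau j).
have kh0 : 0 <= k%:R * h by rewrite mulr_ge0// ltW.
have khB : k%:R * h <= B by rewrite BE ler_wpM2r ?(ltW h0)// ler_nat.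
have nE : ~ E j k w.
  move=> h1; apply: nD; left.
  by rewrite -bigcup_mkord; exists k.
have h1 : sample_mean (rem delta (tau j) (k%:R * h)) n w <=
    mean L (rem delta (tau j) (k%:R * h)) +
    (kappa * (k%:R * h - tau j) ^+ 2 + K * delta ^+ 2).
  by rewrite /sample_mean ler_pdivrMl// leNgt; apply/negP.
have h2 : sample_mean (rem delta (tau j) (k%:R * h)) n w =
    sample_mean (score M (k%:R * h)) n w - sample_mean (score M (tau j)) n w -
    (k%:R * h - tau j) * phi.
  rewrite /phi /sample_mean.
  under eq_bigr do rewrite remE.
  by rewrite !sumrB -mulr_sumr; ring.
have h3 := @U_strict (tau j) (k%:R * h) (tauI j).
rewrite kh0 khB in h3; have {}h3 := h3 isT.
rewrite h2 mean_rem// in h1.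
set s := k%:R * h in h1 h2 h3 *; set t := tau j in h1 h2 h3 *.
have q : 0 <= kappa * (s - t) ^+ 2 by rewrite mulr_ge0 ?sqr_ge0// ltW.
have e1 : 2 * kappa * (s - t) ^+ 2 = kappa * (s - t) ^+ 2 + kappa * (s - t) ^+ 2 by ring.
have e2 : (b t + (phi - mu)) * (s - t) = b t * (s - t) + (s - t) * phi - (s - t) * mu by ring.
rewrite e2; rewrite e1 in h3; move: h1 h3 q; rewrite -/mu; lra.
Qed.

End sample.

(** * The distance to the majorant *)

Section error_bound.
Context {R : realType} d (T : measurableType d) (P : probability T R).
Variable S : nat -> {RV P >-> (R * R * R)%type}.
Variables (M : R) (n : nat) (w : T).
Hypotheses (M0 : 0 < M) (n0 : (0 < n)%N)
  (range : forall i, (i < n)%N -> 0 <= (S i w).2 <= M).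

Lemma U_sharp_sample_mean x : U_sharp S n w x = sample_mean S (score M x) n w.
Proof.
rewrite /U_sharp /sample_mean; congr (_ * _); apply: eq_bigr => i _.
have /andP[z0 zM] := range (ltn_ord i).
have -> : Num.sqrt (Num.max ((S i w).1.1 ^+ 2 + (S i w).1.2 ^+ 2 - x) 0) =
    Num.sqrt ((S i w).1.1 ^+ 2 + (S i w).1.2 ^+ 2 - x).
  by case: leP => // /ler0_sqrtr ->; rewrite sqrtr0.
rewrite /score /radius2 /sqnorm2 /clip.
have -> : Num.min (pospart (S i w).2) M = (S i w).2.
  by rewrite /pospart max_l// min_l.
by ring.
Qed.

Lemma score_increment (s s' : R) p : s <= s' ->
  score M s p <= score M s' p <= score M s p + 2 * M * Num.sqrt (s' - s).
Proof.
move=> ss'; have d0 : 0 <= s' - s by rewrite subr_ge0.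
have /andP[h1 h2] := sqrt_increment (radius2 p - s) d0.
rewrite opprB addrA subrK in h1 h2.
have /andP[h3 h4] := clip_bound M0 p.
have -> : score M s' p = score M s p +
    clip M p * (2 * (Num.sqrt (radius2 p - s) - Num.sqrt (radius2 p - s'))).
  by rewrite /score; ring.
rewrite lerDl mulr_ge0//= lerD2l [leRHS](_ : _ = M * (2 * Num.sqrt (s' - s))).
  exact: ler_pM.
by ring.
Qed.

Lemma U_sharp_increment (s s' : R) : s <= s' ->
  U_sharp S n w s <= U_sharp S n w s' <= U_sharp S n w s + 2 * M * Num.sqrt (s' - s).
Proof.
move=> ss'; rewrite !U_sharp_sample_mean /sample_mean.
have n0' : 0 < n%:R :> R by rewrite ltr0n.
rewrite ler_pM2l ?invr_gt0//; apply/andP; split.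
  by apply: ler_sum => i _; have /andP[] := score_increment (S i w) ss'.
rewrite -[X in _ <= _ + X](mulKf (lt0r_neq0 n0')) -mulrDr ler_pM2l ?invr_gt0//.
have -> : n%:R * (2 * M * Num.sqrt (s' - s)) = \sum_(i < n) 2 * M * Num.sqrt (s' - s).
  by rewrite sumr_const card_ord mulr_natl.
rewrite -big_split/=.
by apply: ler_sum => i _; have /andP[] := score_increment (S i w) ss'.
Qed.

Lemma U_sharp0 : U_sharp S n w 0 = 0.
Proof.
rewrite U_sharp_sample_mean /sample_mean big1 ?mulr0// => i _.
by rewrite /score subr0 subrr !mulr0.
Qed.

Lemma majorant_error (ft : R -> R) (t0 t1 B h p1 p2 e : R) (N : nat) :
  least_concave_majorant_ge0 (U_sharp S n w) ft ->
  0 < h -> B = N%:R * h -> 0 < p1 -> 0 <= t0 -> t0 <= t1 -> t1 <= B -> 0 <= e ->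
  (forall s, B <= s -> 2 * M * Num.sqrt s <= p1 / 2 * (s - t1)) ->
  (forall j, (j <= N)%N -> exists2 beta, p1 / 2 <= beta <= p2 + p1 / 2 &
     forall k, (k <= N)%N -> U_sharp S n w (k%:R * h) <=
       U_sharp S n w (Num.min (t0 + j%:R * h) t1) +
       beta * (k%:R * h - Num.min (t0 + j%:R * h) t1) + e) ->
  forall t, t0 <= t <= t1 ->
    `|ft t - U_sharp S n w t| <= (p2 + p1 / 2) * h + e + 2 * M * Num.sqrt h.
Proof.
move=> lcm h0 BE p10 t00 t01 t1B e0 far grid t /andP[t0t tt1].
have tN : t - t0 <= N%:R * h.
  by rewrite -BE lerBlDr (le_trans tt1)// (le_trans t1B)// lerDl.
have tt0 : 0 <= t - t0 by rewrite subr_ge0.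
have [j jN /andP[j1 j2]] := grid_point h0 tt0 tN.
have [beta /andP[b1 b2] hb] := grid j jN.
have taut : t0 + j%:R * h <= t by rewrite addrC -lerBrDr.
have tauE : Num.min (t0 + j%:R * h) t1 = t0 + j%:R * h.
  by rewrite min_l// (le_trans taut).
rewrite tauE in hb.
have tau1 : t0 <= t0 + j%:R * h <= t1.
  by rewrite lerDl mulr_ge0 ?(ltW h0)//= (le_trans taut).
have ttau : t < t0 + j%:R * h + h by rewrite -addrA addrC -ltrBlDr.
have inc s s' : 0 <= s -> s <= s' ->
    U_sharp S n w s <= U_sharp S n w s' <= U_sharp S n w s + 2 * M * Num.sqrt (s' - s).
  by move=> _; exact: U_sharp_increment.
have /andP[l1 l2] := majorant_from_grid lcm h0 BE inc U_sharp0 p10 b1 t00 tau1 far e0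
  (ltW M0) hb taut ttau.
rewrite ger0_norm ?subr_ge0// lerBlDl (le_trans l2)// lerD2l !lerD2r.
by rewrite ler_wpM2r ?(ltW h0).
Qed.

End error_bound.

Section asymptotics.
Context {R : realType}.

(** With x = sqrt s and q = 2 M / p the claim is q x <= x^2 - t1, and
    x >= q + t1 + 1 is more than enough. *)
Lemma far_sqrt (M p t1 s : R) (B : nat) : 0 < M -> 0 < p -> 0 <= t1 ->
  (2 * M / p + t1 + 1) ^+ 2 <= B%:R -> B%:R <= s ->
  2 * M * Num.sqrt s <= p * (s - t1).
Proof.
move=> M0 p0 t10 hB hs.
have q0 : 0 < 2 * M / p by rewrite divr_gt0 ?mulr_gt0.
have s0 : 0 <= s by rewrite (le_trans _ hs).
have a0 : 0 <= 2 * M / p + t1 + 1 by rewrite addr_ge0 ?addr_ge0// ltW.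
have h1 : 2 * M / p + t1 + 1 <= Num.sqrt s.
  by rewrite -(ger0_norm a0) -sqrtr_sqr ler_wsqrtr// (le_trans hB).
rewrite mulrC -ler_pdivrMl// mulrCA (mulrC p^-1) -[s in leRHS]sqr_sqrtr//.
move: h1 q0; set x := Num.sqrt s; set q := 2 * M / p; move=> h1 q0.
nra.
Qed.

Lemma eps_sqr_mul (n : nat) : (0 < n)%N -> n%:R * eps n ^+ 2 = ln n%:R :> R.
Proof.
move=> n0; have n0' : 0 < n%:R :> R by rewrite ltr0n.
rewrite /eps sqr_sqrtr; first by rewrite mulrCA mulfV ?mulr1// gt_eqF.
by rewrite divr_ge0 ?(ltW n0')// ln_ge0// ler1n.
Qed.

(** From ln n = 2 ln (sqrt n) <= 2 sqrt n. *)
Lemma eps_small (n : nat) (delta0 : R) : 0 < delta0 -> (0 < n)%N ->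
  (2 / delta0 ^+ 2) ^+ 2 <= n%:R -> eps n <= delta0.
Proof.
move=> d0 n0 hn; have n0' : 0 < n%:R :> R by rewrite ltr0n.
rewrite /eps -[leRHS](ger0_norm (ltW d0)) -sqrtr_sqr ler_wsqrtr//.
have s0 : 0 < Num.sqrt n%:R :> R by rewrite sqrtr_gt0.
rewrite -[X in ln X / X](sqr_sqrtr (ltW n0')) lnXn//.
have h1 : 2 / delta0 ^+ 2 <= Num.sqrt n%:R.
  rewrite -[leLHS]ger0_norm -?sqrtr_sqr ?ler_wsqrtr// divr_ge0//.
  by rewrite exprn_ge0// ltW.
have h2 := ltW (ln_sublinear s0).
rewrite ler_pdivrMr ?exprn_gt0//.
move: h1; rewrite ler_pdivrMr ?exprn_gt0// => h1.
rewrite -(mulr_natl _ 2) (expr2 (Num.sqrt _)) mulrA; apply: ler_pM => //.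
  by rewrite ln_ge0// -[leLHS]sqrtr1 ler_wsqrtr// ler1n.
by rewrite mulrC.
Qed.

(** The errors of size 1 / n due to the grid are absorbed in eps_n^2 once
    ln n >= 1. *)
Lemma inv_le_eps_sqr (n : nat) : (0 < n)%N -> expR 1 <= n%:R :> R ->
  n%:R^-1 <= eps n ^+ 2 :> R.
Proof.
move=> n0 hn; have n0' : 0 < n%:R :> R by rewrite ltr0n.
rewrite -[leLHS]mulr1 ler_pdivrMl// eps_sqr_mul//.
by rewrite -[leLHS]expRK ler_ln ?posrE ?expR_gt0.
Qed.

(** For a grid of B n^2 points, of order n^4 pairs times n^-5. *)
Lemma union_bound_small (n B N : nat) (e c : R) : (0 < n)%N -> 0 < e ->
  3 * B.+1%:R ^+ 2 / e <= n%:R ->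
  c = expR (- (5 * ln n%:R)) -> N = (B * n ^ 2)%N ->
  N.+1%:R * (N.+1%:R * c + (c + c)) <= e.
Proof.
move=> n0 e0 hn cE0 NE; have n0' : 0 < n%:R :> R by rewrite ltr0n.
have c0 : 0 < c by rewrite cE0; exact: expR_gt0.
have cE : c = (n%:R ^+ 5)^-1 by rewrite cE0 expRN expRM_natl lnK.
have hN : N.+1%:R <= B.+1%:R * n%:R ^+ 2 :> R.
  by rewrite NE -natrX -natrM ler_nat mulSn -addn1 addnC leq_add// expn_gt0 n0.
have N1 : 1 <= N.+1%:R :> R by rewrite ler1n.
apply: (@le_trans _ _ (N.+1%:R * (3 * (N.+1%:R * c)))).
  rewrite ler_wpM2l//; have h : c <= N.+1%:R * c by rewrite ler_peMl// ltW.
  by move: h; set u := _ * c; lra.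
apply: (@le_trans _ _ ((B.+1%:R * n%:R ^+ 2) * (3 * ((B.+1%:R * n%:R ^+ 2) * c)))).
  have c0' := ltW c0.
  by apply: ler_pM => //; rewrite ?mulr_ge0// ler_wpM2l// ler_wpM2r.
rewrite cE [leLHS](_ : _ = 3 * B.+1%:R ^+ 2 / n%:R); last first.
  by field; rewrite gt_eqF.
by rewrite ler_pdivrMr// (mulrC e) -ler_pdivrMr.
Qed.

End asymptotics.

Theorem theorem2p1 (R : realType)
    (d0 : measure_display) (T0 : measurableType d0) (P0 : probability T0 R)
    (X : {RV P0 >-> (R * R * R)%type}) (Z : {RV P0 >-> R})
    (nu : {sigma_finite_measure set R -> \bar R}) (rho : R * R -> R)
    (d : measure_display) (T : measurableType d) (P : probability T R)
    (S : nat -> {RV P >-> (R * R * R)%type}) (Utilde : nat -> T -> R -> R)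
    (t0 t1 : R)
    (Z_ge0 : {ae P0, forall w, 0 <= Z w})
    (XZ_inv : orthogonally_invariant P0 X Z)
    (nu_ge0 : nu (`]-oo, 0[)%classic = 0%E)
    (rho_meas : measurable_fun [set p : R * R | 0 <= p.1 /\ 0 <= p.2] rho)
    (rho_ge0 : forall x z, 0 <= x -> 0 <= z -> 0 <= rho (x, z))
    (XZ_dens : has_radial_density P0 X Z nu rho)
    (S_indep : mutually_independent S)
    (S_law : forall i (A : set (R * R * R)), measurable A ->
       P (S i @^-1` A) = P0 [set w | A ((X w).1.1, (X w).1.2, Z w)])
    (Utilde_lcm : forall n w,
       least_concave_majorant_ge0 (U_sharp S n w) (Utilde n w))
    (Z_bounded : exists M : R, {ae P0, forall w, `|Z w| <= M})
    (t0_ge0 : 0 <= t0) (t01 : t0 < t1)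
    (U_C2 : twice_continuously_differentiable (U_fun nu rho) t0 t1)
    (U''_lt0 : 0 < inf [set - derive_ge0 (derive_ge0 (U_fun nu rho)) t |
                         t in `[t0, t1]]) :
  bigO_p P
    (fun n w => ereal_sup [set `|Utilde n w t - U_sharp S n w t|%:E |
                            t in `[t0, t1]])
    (fun n => eps n ^+ 2).
Proof.
have [M1 Z_M1] := Z_bounded.
pose M := Num.max M1 1.
have M0 : 0 < M by rewrite lt_max ltr01 orbT.
have Z_le : {ae P0, forall w, `|Z w| <= M}.
  by apply: filterS Z_M1 => w h; rewrite (le_trans h)// le_max lexx.
pose L : probability (R * R * R)%type R := distribution P (S 0%N).
have L_law A : measurable A -> L A = P0 [set w | A ((X w).1.1, (X w).1.2, Z w)].
  by move=> mA; rewrite -(S_law 0%N).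
have S_L i A : measurable A -> P (S i @^-1` A) = L A.
  by move=> mA; rewrite L_law// S_law.
have L_range : L [set p | ~ (0 <= p.2 <= M)] = 0%E.
  have m01 : measurable [set p : R * R * R | ~ (0 <= p.2 <= M)].
    rewrite (_ : mkset _ = snd @^-1` (~` `[0, M]%classic)).
      rewrite -[X in measurable X]setTI; apply: (@measurable_snd _ _ (R * R)%type R) => //.
      exact: (measurableC (measurable_itv `[0, M])).
    by apply/seteqP; split => p /=; rewrite in_itv/=.
  rewrite L_law//; apply: measure_negligible.
    rewrite (_ : mkset _ = Z @^-1` (~` `[0, M]%classic)).
      rewrite -[X in measurable X]setTI; apply: (measurable_funP Z) => //.
      exact: (measurableC (measurable_itv `[0, M])).
    by apply/seteqP; split => w /=; rewrite in_itv/=.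
  have : {ae P0, forall w, 0 <= Z w <= M}.
    apply: filterS2 Z_ge0 Z_le => w z0 zM; rewrite z0/=.
    exact: le_trans (ler_norm _) zM.
  by [].
have [b [C [p1 [p2 [[C0 p10] b_bounds conc strict]]]]] :=
  population_bounds rho_meas rho_ge0 XZ_dens M0 Z_le L_law t0_ge0 t01 U_C2 U''_lt0.
have t10 : 0 <= t1 by rewrite (le_trans t0_ge0)// ltW.
have p20 : 0 <= p2.
  have /andP[h1 h2] : p1 <= b t0 <= p2 by apply: b_bounds; rewrite lexx ltW.
  by rewrite (le_trans (ltW p10))// (le_trans h1).
have hp10 : 0 < p1 / 2 by rewrite divr_gt0.
(* far out, the crude bound 2 M sqrt s on the estimator lies below any line
   of slope at least p1 / 2 *)
pose a := (2 * M / (p1 / 2) + t1 + 1) ^+ 2.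
pose Bn := (Num.truncn (Num.max a t1)).+1.
have Bn_gt : Num.max a t1 < Bn%:R by exact: truncnS_gt.
have aB : a <= Bn%:R by rewrite ltW// (le_lt_trans _ Bn_gt)// le_max lexx.
have t1B : t1 <= Bn%:R by rewrite ltW// (le_lt_trans _ Bn_gt)// le_max lexx orbT.
have far s : Bn%:R <= s -> 2 * M * Num.sqrt s <= p1 / 2 * (s - t1).
  exact: far_sqrt.
have [kappa kappa0 {}strict] := strict Bn%:R t1B.
have U_mean x : 0 <= x -> U_fun nu rho x = mean L (score M x).
  by move=> x0; rewrite /U_fun (integral_Psi_score rho_meas rho_ge0 XZ_dens M0 Z_le L_law).
have [K K0 [delta0 delta00 good]] :=
  good_event S_indep S_L M0 L_range U_mean t0_ge0 t01 C0 p10 kappa0 b_bounds conc strict.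
move=> e e0; exists ((p2 + p1 / 2) + K + 2 * M); near=> n.
have n0 : (0 < n)%N by near: n; exact: nbhs_infty_gt.
have n0' : 0 < n%:R :> R by rewrite ltr0n.
have n_exp : expR 1 <= n%:R :> R by near: n; exact: nbhs_infty_ger.
have n_delta : (2 / delta0 ^+ 2) ^+ 2 <= n%:R by near: n; exact: nbhs_infty_ger.
have n_e : 3 * Bn.+1%:R ^+ 2 / e <= n%:R by near: n; exact: nbhs_infty_ger.
have inv_eps := inv_le_eps_sqr n0 n_exp.
have eps0 : 0 < eps n :> R.
  rewrite lt0r sqrtr_ge0 andbT; apply/eqP => h.
  by move: inv_eps; rewrite h expr0n/= leNgt invr_gt0 n0'.
(* mesh n^-2: the oscillation 2 M sqrt h over a cell is then of order 1 / n *)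
pose h : R := (n%:R ^+ 2)^-1.
have h0 : 0 < h by rewrite invr_gt0 exprn_gt0.
have sqrt_h : Num.sqrt h = n%:R^-1.
  by rewrite /h -exprVn sqrtr_sqr ger0_norm// invr_ge0 ltW.
have h_inv : h <= n%:R^-1.
  by rewrite lef_pV2 ?posrE ?exprn_gt0// -natrX ler_nat expnS leq_pmulr.
pose N := (Bn * n ^ 2)%N.
have BN : Bn%:R = N%:R * h.
  by rewrite /N /h natrM natrX mulfK// expf_neq0// gt_eqF.
have [Bad [mBad cBad hBad]] :=
  good n (eps n) h N n0 eps0 (eps_small delta00 n0 n_delta) h0 BN.
exists Bad; split => //; last first.
  apply: (le_trans cBad); rewrite lee_fin; apply: (union_bound_small n0 e0 n_e) => //.
  by rewrite eps_sqr_mul.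
move=> w /=; apply: contraPP => /hBad[range {}hBad]; apply/negP; rewrite -leNgt.
have err t : t0 <= t <= t1 -> `|Utilde n w t - U_sharp S n w t| <=
    (p2 + p1 / 2 + K + 2 * M) * eps n ^+ 2.
  move=> tt.
  have grid j : (j <= N)%N -> exists2 beta, p1 / 2 <= beta <= p2 + p1 / 2 &
     forall k, (k <= N)%N -> U_sharp S n w (k%:R * h) <=
       U_sharp S n w (Num.min (t0 + j%:R * h) t1) +
       beta * (k%:R * h - Num.min (t0 + j%:R * h) t1) + K * eps n ^+ 2.
    move=> jN; have [beta b1 b2] := hBad j jN.
    by exists beta => // k kN; rewrite !(U_sharp_sample_mean range) b2.
  have e1 : 0 <= K * eps n ^+ 2 by rewrite mulr_ge0 ?sqr_ge0.
  apply: (le_trans (majorant_error M0 n0 range (Utilde_lcm n w) h0 BN p10 t0_ge0 (ltW t01)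
    t1B e1 far grid tt)).
  rewrite sqrt_h (mulrDl _ (2 * M)) (mulrDl _ K) lerD ?lerD2r//.
    by rewrite ler_wpM2l ?(le_trans h_inv)// addr_ge0// ltW.
  by rewrite ler_wpM2l// mulr_ge0 ?(ltW M0).
rewrite gee0_abs; last first.
  apply: (@le_trans _ _ `|Utilde n w t0 - U_sharp S n w t0|%:E); first by rewrite lee_fin.
  by apply: ereal_sup_ubound; exists t0 => //=; rewrite in_itv/= lexx ltW.
apply: ge_ereal_sup => _ [t /= tt <-]; rewrite lee_fin err//.
Unshelve. all: by end_near.
Qed.
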